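(* Let $A$ be a single chain with tip $p$ and $l\ge0$ interior vertices $1,\dots,l$, and let $W\subseteq A_I=\{1,\dots,l\}$. Let $B$ be the convex $(l+3)$-gon with vertex set $(A\setminus\{p\})\cup\{q\}$, where $q$ is an extra point on the side opposite to $p$ (that is, beyond the edge $(0,l+1)$, so that the cyclic order of the vertices of $B$ is $0,1,\dots,l+1,q$). Then the number of pointed pseudo-triangulations of $A$ in which the interior neighbors of $p$ are exactly the points in $W$ (that is, $|\mathcal{PPT}_W(A)|$) equals the number of triangulations of $B$ in which the interior neighbors of $q$ (the points of $\{1,\dots,l\}$ joined to $q$ by a diagonal) are contained in $W$.
   Context: All point sets are finite planar sets in general position (no three points collinear). A pseudo-triangle is a planar simple polygon with exactly three convex vertices (internal angle less than $\pi$). A pseudo-triangulation of a point set $A$ is a partition of $\operatorname{conv}(A)$ into pseudo-triangles whose vertex set is exactly $A$. A vertex is pointed if it has an incident angle greater than $\pi$; a pseudo-triangulation is pointed if all its vertices are pointed. $A_I$ is the set of points of $A$ in the interior of $\operatorname{conv}(A)$. A single chain with $l$ interior vertices is a set $A$ of $l+3$ points: $l+2$ points labelled $0,1,\dots,l,l+1$ forming (in this cyclic order) a convex $(l+2)$-gon, plus a point $p$ (the tip) exterior to this polygon and seeing all edges of it except the edge $(0,l+1)$ (for $l=0$, $A$ is just a triangle). Its convex hull vertices are $p,0,l+1$ and its interior points are $1,\dots,l$. For $W\subseteq A_I$, $\mathcal{PPT}_W(A)$ is the set of pointed pseudo-triangulations of $A$ in which, for each $i\in A_I$, $p$ is joined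 to $i$ by an edge if and only if $i\in W$. *)

(* Defs.v *)
From mathcomp Require Import all_boot all_order all_algebra.
From mathcomp Require Import boolp reals.

Set Implicit Arguments.
Unset Strict Implicit.
Unset Printing Implicit Defensive.

Import Order.TTheory GRing.Theory Num.Theory.
Local Open Scope ring_scope.

Section PlanarPointSets.
Context {R : realType}.

Local Notation point := 'rV[R]_2.

(* Twice the signed area of the triangle a b c: positive iff a, b, c is a
   counterclockwise turn. *)
Definition orient (a b c : point) : R :=
  (b 0 0 - a 0 0) * (c 0 1 - a 0 1) - (b 0 1 - a 0 1) * (c 0 0 - a 0 0).

(* A finite point set is a family A : I -> point; its points are referred to by
   their labels in I, an edge is a two-element set of labels, and a polygon is
   represented by its set of edges. *)
Section Families.
Context {I : finType}.
Implicit Types (A : I -> point) (S : {set I}) (F : {set {set I}}).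
Implicit Types (T : {set {set {set I}}}).

Definition general_position A : Prop :=
  forall i j k : I, uniq [:: i; j; k] -> orient (A i) (A j) (A k) != 0.

(* For S = [set i; j] this is the closed segment between A i and A j. *)
Definition hull A S (z : point) : Prop :=
  exists w : I -> R, [/\ forall i, 0 <= w i, \sum_(i in S) w i = 1
    & z = \sum_(i in S) w i *: A i].

Definition cycle_edges (s : seq I) : {set {set I}} :=
  [set [set x; next s x] | x in s].

Definition simple_polygon A F : Prop :=
  (exists s : seq I, [/\ (2 < size s)%N, uniq s & F = cycle_edges s]) /\
  (forall e f z, e \in F -> f \in F -> e != f -> hull A e z -> hull A f z ->
     exists2 i, i \in e :&: f & z = A i).

Definition vertices F : {set I} := cover F.

Definition boundary A F (z : point) : Prop := exists2 e, e \in F & hull A e z.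

(* The horizontal ray leaving z towards increasing first coordinate meets the
   edge e; counting an edge as containing its lower but not its upper endpoint
   makes the parity below correct for rays through vertices. *)
Definition ray_crosses A (z : point) (e : {set I}) : bool :=
  [exists a in e, exists b in e,
    [&& A a 0 1 <= z 0 1, z 0 1 < A b 0 1 & 0 < orient (A a) (A b) z]].

(* The bounded side of the Jordan curve formed by the edges F. *)
Definition polygon_interior A F (z : point) : Prop :=
  ~ boundary A F z /\ odd #|[set e in F | ray_crosses A z e]|.

Definition region A F (z : point) : Prop :=
  boundary A F z \/ polygon_interior A F z.

(* The internal angle at v is less than pi iff, close to v, it is the convex
   angle spanned by the two edges at v that lies inside the polygon. *)
Definition convex_vertex A F (v : I) : Prop :=
  exists u w : I, [/\ u != w, [set v; u] \in F, [set v; w] \in F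
    & exists2 eps : R, 0 < eps & forall t, 0 < t < eps ->
        polygon_interior A F (A v + t *: ((A u - A v) + (A w - A v)))].

Definition pseudo_triangle A F : Prop :=
  simple_polygon A F /\
  #|[set v in vertices F | `[< convex_vertex A F v >]]| = 3%N.

Definition triangle A F : Prop := simple_polygon A F /\ #|vertices F| = 3%N.

(* T is a partition of the convex hull into polygons satisfying P, using all
   the points as vertices. *)
Definition polygonal_partition A (P : {set {set I}} -> Prop) T : Prop :=
  [/\ forall F, F \in T -> P F,
      forall F G z, F \in T -> G \in T -> F != G ->
        ~ (polygon_interior A F z /\ polygon_interior A G z),
      forall z, hull A setT z <-> exists2 F, F \in T & region A F z
    & \bigcup_(F in T) vertices F = setT].

Definition pseudo_triangulation A T : Prop :=
  polygonal_partition A (pseudo_triangle A) T.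

Definition triangulation A T : Prop := polygonal_partition A (triangle A) T.

Definition edges T : {set {set I}} := cover T.

(* The edges vu and vw are consecutive around v, the angle from vw
   counterclockwise to vu is greater than pi, and all other edges at v lie in
   the complementary angle. *)
Definition pointed A T (v : I) : Prop :=
  exists u w : I, [/\ [set v; u] \in edges T, [set v; w] \in edges T,
    0 < orient (A v) (A u) (A w)
    & forall x, [set v; x] \in edges T -> x != u -> x != w ->
        0 < orient (A v) (A u) (A x) /\ 0 < orient (A v) (A x) (A w)].

Definition pointed_pseudo_triangulation A T : Prop :=
  pseudo_triangulation A T /\ forall v, pointed A T v.

End Families.

(* v 0, ..., v (n-1) are, in this cyclic order and in either sense of rotation,
   the vertices of a convex n-gon. *)
Definition convex_polygon n (v : 'I_n -> point) : Prop :=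
  (forall i j k : 'I_n, (i < j < k)%N -> 0 < orient (v i) (v j) (v k)) \/
  (forall i j k : 'I_n, (i < j < k)%N -> orient (v i) (v j) (v k) < 0).

Definition add_last n (v : 'I_n -> point) (x : point) (i : 'I_n.+1) : point :=
  oapp v x (unlift ord_max i).

(* All of the edge between v i and v j is visible from p, with the convex hull
   of the points of v as the only obstacle. *)
Definition sees n (v : 'I_n -> point) (p : point) (i j : 'I_n) : Prop :=
  forall (x : point) (t : R), hull v [set i; j] x -> 0 <= t < 1 ->
    ~ hull v setT ((1 - t) *: p + t *: x).

(* For l = 0 the polygon degenerates to a segment and the only requirement is
   that v 0, v 1, p form a triangle. *)
Definition single_chain l (v : 'I_l.+2 -> point) (p : point) : Prop :=
  [/\ convex_polygon v, general_position (add_last v p), ~ hull v setT p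
    & (0 < l)%N ->
      (forall i j : 'I_l.+2, j = i.+1 :> nat -> sees v p i j) /\
      ~ sees v p ord0 ord_max].

(* The labels 1, ..., l; in 'I_l.+3 the label ord_max is that of the added
   point (p or q). *)
Definition inner l : {set 'I_l.+3} := [set i : 'I_l.+3 | (0 < i <= l)%N].

Definition PPT l (v : 'I_l.+2 -> point) (p : point) (W : {set 'I_l.+3}) :
    {set {set {set {set 'I_l.+3}}}} :=
  [set T | `[< pointed_pseudo_triangulation (add_last v p) T /\
     (forall i, i \in inner l ->
        ([set ord_max; i] \in edges T <-> i \in W)) >]].

Definition triangulations_within l (v : 'I_l.+2 -> point) (q : point)
    (W : {set 'I_l.+3}) : {set {set {set {set 'I_l.+3}}}} :=
  [set T | `[< triangulation (add_last v q) T /\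
     (forall i, i \in inner l ->
        [set ord_max; i] \in edges T -> i \in W) >]].

End PlanarPointSets.

(* Main.v *)
Require Import Defs.
From mathcomp Require Import all_boot all_order all_algebra.
From mathcomp Require Import boolp reals.
From mathcomp Require Import zify ring lra.
Set Implicit Arguments.
Unset Strict Implicit.
Unset Printing Implicit Defensive.
Import Order.TTheory GRing.Theory Num.Theory.
Local Open Scope ring_scope.

(** Both kinds of subdivisions are encoded by recursive decompositions of the
    interval from 0 to l + 1, and the two recursions have the same solution.

    In both configurations the last label N = ord_max belongs to the added point;
    in A this point p is called the apex and the other points form the chain.

    Triangulations of B. The triangle at the edge ij has a third vertex b between
    i and j, and the rest is a triangulation of the polygons cut off by ib and
    bj. A vertex is joined to q exactly when it appears as b for an edge iq, so the
    condition on the neighbours of q restricts this choice to W. This yields the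
    list tri_splits (triangulation_code, code_triangulation).

    Pseudo-triangulations of A. The chain bulges towards the apex, hence a polygon
    with vertices in the chain only is convex, and a pseudo-triangle that avoids
    the apex is a triangle. In a pseudo-triangle at the apex all the vertices outside
    the angle at the apex are convex; this leaves room for one vertex on either side
    and forces the shape apex_face (apex_face_shape). Since the vertices are pointed,
    a vertex strictly inside the chain is joined to the apex exactly when its other
    edges lie on one side of it. So the set G of the edges off the apex encodes a
    member of PPT v p W (chain_code_inj). Above an edge ij of G there is either a
    triangle ibj, where b has edges on both sides and thus is not in W, or a
    pseudo-triangle at the apex, seen through the gap between consecutive vertices b
    and c = b + 1, each of which is an end of [i, j] or in W. The other edges
    lie within [i, b] and [c, j]. This yields the list chain_splits (PPT_code), and
    every member of the list arises: the pseudo-triangles are assembled along the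
    recursion, merging the two pseudo-triangles at the apex on either side of b in
    the case of a triangle (faces_below_tri, faces_below_gap, code_PPT).

    Counting. Let P be the strictly upper triangular matrix of the numbers of codes
    between i and j, c that of the numbers of triangulations of a convex polygon with
    vertices i, ..., j, Pi the diagonal matrix of W and S the shift. The recursions
    read
      P = P (1 - Pi) P + (1 + P Pi) S (1 + Pi P)  and  c = S + c c,
    and they imply P = c + c Pi P (composed_recursion), because (1 + P Pi)^-1 P
    satisfies the recursion of c. In the column l + 1 this is the recursion of the
    numbers of triangulations of the polygons i, ..., l + 1, q, according to the third
    vertex of the triangle at iq (chain_tri_count).

    Geometry. Interiors of polygons are defined by the parity of ray crossings. At
    generic points, which suffice to test partitions and convexity of vertices
    (polygonal_partitionP, convex_vertexP), this parity is the sum of the parities of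
    the triangles spanned by the apex and the edges of the polygon (par_fan). Close to
    an edge, to the apex or to a vertex of the chain, these triangles are given by the
    order of the labels (below_apex_near, up_wedge, par_near_vertex), so that
    the geometry of the faces becomes combinatorial. *)

(** * Orientations and small perturbations *)

Section Orient.
Context {R : realType}.
Local Notation point := 'rV[R]_2.
Implicit Types a b c d p z w : point.

Lemma orientNl a b c : orient b a c = - orient a b c.
Proof. by rewrite /orient; ring. Qed.

Lemma orientNr a b c : orient a c b = - orient a b c.
Proof. by rewrite /orient; ring. Qed.

Lemma orient_cyc a b c : orient b c a = orient a b c.
Proof. by rewrite /orient; ring. Qed.

Lemma orientxx a b : orient a b a = 0.
Proof. by rewrite /orient; ring. Qed.

Lemma orientxy a b : orient a b b = 0.
Proof. by rewrite /orient; ring. Qed.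

Lemma orient_split a b c z :
  orient a b z + orient b c z + orient c a z = orient a b c.
Proof. by rewrite /orient; ring. Qed.

(** The relation between the 2 x 2 minors of a 2 x 4 matrix, whose columns are the
    four points seen from p. *)
Lemma orient_plucker p a b c d :
  orient p a b * orient p c d + orient p a d * orient p b c
  = orient p a c * orient p b d.
Proof. by rewrite /orient; ring. Qed.

Lemma orient_lin a b z w (e : R) :
  orient a b (z + e *: (w - z)) = (1 - e) * orient a b z + e * orient a b w.
Proof. by rewrite /orient !mxE; ring. Qed.

Lemma orient_sum (I : finType) (S : {set I}) (w : I -> R) (A : I -> point) a b :
  \sum_(i in S) w i = 1 ->
  orient a b (\sum_(i in S) w i *: A i) = \sum_(i in S) w i * orient a b (A i).
Proof.
move=> w1.
have s0 k : (\sum_(i in S) w i *: A i) 0 k = \sum_(i in S) w i * A i 0 k.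
  by rewrite summxE; apply: eq_bigr => i _; rewrite mxE.
have -> : orient a b (\sum_(i in S) w i *: A i) =
    (b 0 0 - a 0 0) * (\sum_(i in S) w i * A i 0 1)
    - (b 0 1 - a 0 1) * (\sum_(i in S) w i * A i 0 0)
    + ((b 0 1 - a 0 1) * a 0 0 - (b 0 0 - a 0 0) * a 0 1) * \sum_(i in S) w i.
  by rewrite w1 /orient !s0; ring.
rewrite !mulr_sumr -sumrB -big_split /=; apply: eq_bigr => i _.
by rewrite /orient; ring.
Qed.

(** Only finitely many conditions are ever imposed on a perturbation, so that
    the properties of all small parameters can be accumulated, and a parameter
    can be chosen at the end. *)
Definition small (P : R -> Prop) : Prop :=
  exists2 e0 : R, 0 < e0 & forall e, 0 < e < e0 -> P e.

Lemma small_imp (P Q : R -> Prop) :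
  (forall e, 0 < e -> P e -> Q e) -> small P -> small Q.
Proof.
by move=> PQ [e0 e00 Pe]; exists e0 => // e /[dup] /andP[/PQ h _] /Pe /h.
Qed.

Lemma small_and (P Q : R -> Prop) :
  small P -> small Q -> small (fun e => P e /\ Q e).
Proof.
move=> [e0 e00 Pe] [e1 e10 Qe]; exists (Num.min e0 e1); first by rewrite lt_min e00.
by move=> e; rewrite lt_min => /and3P[e_gt0 lt0 lt1]; split; [apply: Pe|apply: Qe];
  apply/andP.
Qed.

Lemma small_true (P : R -> Prop) : (forall e, 0 < e -> P e) -> small P.
Proof. by move=> Pe; exists 1 => // e /andP[/Pe]. Qed.

Lemma small_forall (T : finType) (P : T -> R -> Prop) :
  (forall t, small (P t)) -> small (fun e => forall t, P t e).
Proof.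
move=> Pt.
suff [e0 e00 He] : small (fun e => forall t, t \in enum T -> P t e).
  by exists e0 => // e /He h t; apply: h; rewrite mem_enum.
elim: (enum T) => [|t s IH]; first by apply: small_true.
apply: small_imp (small_and (Pt t) IH) => e _ [h1 h2] t'.
by rewrite inE => /orP[/eqP ->//|]; apply: h2.
Qed.

Lemma small_ex (P : R -> Prop) : small P -> exists2 e, 0 < e < 1 & P e.
Proof.
move=> [e0 e00 Pe]; exists (Num.min e0 1 / 2).
  have : 0 < Num.min e0 1 by rewrite lt_min e00 ltr01.
  have : Num.min e0 1 <= 1 by rewrite ge_min lexx orbT.
  by move=> h1 h2; apply/andP; split; lra.
apply: Pe.
have : 0 < Num.min e0 1 by rewrite lt_min e00 ltr01.
have : Num.min e0 1 <= e0 by rewrite ge_min lexx.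
by move=> h1 h2; apply/andP; split; lra.
Qed.

Lemma small_gt0 (c d : R) : 0 < c -> small (fun e => 0 < (1 - e) * c + e * d).
Proof.
move=> c0; have D0 : 0 < c + `|d| by rewrite ltr_wpDr.
exists (c / (c + `|d|)); first by rewrite divr_gt0.
move=> e /andP[e0]; rewrite ltr_pdivlMr // => h.
have : - `|d| * e <= d * e by apply: ler_wpM2r; [exact: ltW|have := ler_norm (- d); rewrite normrN; lra].
by move: h; rewrite mulrDr; lra.
Qed.

(** The sign, for small e > 0, of the affine function of e that takes the value
    c at 0 and d at 1. *)
Definition lexsg (c d : R) : R := if c == 0 then Num.sg d else Num.sg c.

Lemma small_sg (c d : R) : small (fun e => Num.sg ((1 - e) * c + e * d) = lexsg c d).
Proof.
rewrite /lexsg; case: eqVneq => [->|c0].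
  by apply: small_true => e e0; rewrite mulr0 add0r sgrM gtr0_sg // mul1r.
have [c_lt0|c_gt0|c_eq0] := ltrgt0P c; last by rewrite c_eq0 eqxx in c0.
  apply: small_imp (small_gt0 d c_lt0) => e _ h.
  by rewrite !gtr0_sg.
have Nc : 0 < - c by rewrite oppr_gt0.
apply: small_imp (small_gt0 (- d) Nc) => e _ h.
by rewrite !ltr0_sg //; lra.
Qed.

End Orient.

(** * Convex hulls and generic points *)

Section Hulls.
Context {R : realType} {I : finType} (A : I -> 'rV[R]_2).
Implicit Types (z w : 'rV[R]_2) (S : {set I}) (e : {set I}) (F : {set {set I}}).
Local Notation oA i j z := (orient (A i) (A j) z).

Lemma hull_point S i : i \in S -> hull A S (A i).
Proof.
move=> iS; exists (fun k => (k == i)%:R); split=> [k||].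
- by rewrite ler0n.
- by rewrite (bigD1 i) //= eqxx big1 ?addr0 // => k /andP[_ /negbTE->].
- rewrite (bigD1 i) //= eqxx scale1r big1 ?addr0 // => k /andP[_ /negbTE->].
  by rewrite scale0r.
Qed.

Lemma hull_segment S z w (t : R) : 0 <= t <= 1 ->
  hull A S z -> hull A S w -> hull A S (z + t *: (w - z)).
Proof.
move=> /andP[t0 t1] [u [u0 u1 ->]] [v [v0 v1 ->]].
exists (fun i => (1 - t) * u i + t * v i); split=> [i||].
- by rewrite addr_ge0 // mulr_ge0 // subr_ge0.
- by rewrite big_split /= -!mulr_sumr u1 v1; ring.
- under [RHS]eq_bigr => i _ do rewrite scalerDl -!scalerA.
  rewrite big_split /= -!scaler_sumr scalerBr scalerBl scale1r.
  by rewrite addrA addrAC.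
Qed.



Lemma hull_subset S S' z : S \subset S' -> hull A S z -> hull A S' z.
Proof.
move=> /subsetP SS' [u [u0 u1 ->]].
have restr (V : nmodType) (f : I -> V) :
    \sum_(i in S) f i = \sum_(i in S') (if i \in S then f i else 0).
  rewrite -big_mkcondr /=; apply: eq_bigl => i.
  by case iS: (i \in S); rewrite ?andbF // SS'.
exists (fun i => if i \in S then u i else 0); split=> [i||].
- by case: ifP.
- by rewrite -restr.
- by rewrite restr; apply: eq_bigr => i _; case: ifP => // _; rewrite scale0r.
Qed.

Lemma hull_orient_ge0 S a b (s : R) z : hull A S z ->
  (forall i, i \in S -> 0 <= s * orient a b (A i)) -> 0 <= s * orient a b z.
Proof.
move=> [u [u0 u1 ->]] h; rewrite orient_sum // mulr_sumr sumr_ge0 // => i iS.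
by rewrite mulrCA mulr_ge0 // h.
Qed.

Lemma hull_pair i j z : hull A [set i; j] z <->
  exists2 t : R, 0 <= t <= 1 & z = A i + t *: (A j - A i).
Proof.
split=> [[u [u0 u1 ->]]|[t t01 ->]]; last first.
  by apply: hull_segment => //; apply: hull_point; rewrite !inE eqxx ?orbT.
have [eij|nij] := eqVneq i j.
  exists 0; first by rewrite lexx ler01.
  move: u1; rewrite -eij setUid !big_set1 => ->.
  by rewrite scale0r scale1r addr0.
move: u1; rewrite !big_setU1 ?inE //= !big_set1 => u1.
exists (u j); first by rewrite u0 -u1 lerDr u0.
have -> : u i = 1 - u j by rewrite -u1 addrK.
by rewrite scalerBr scalerBl scale1r addrA addrAC.
Qed.

(** The orientations of z with respect to the three sides are, up to the factor
    s * oA i j (A k), the barycentric coordinates of z. *)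
Lemma hull_triangle S i j k z (s : R) : i \in S -> j \in S -> k \in S ->
  0 < s * oA i j (A k) ->
  0 <= s * oA i j z -> 0 <= s * oA j k z -> 0 <= s * oA k i z -> hull A S z.
Proof.
move=> iS jS kS D0 hk hi hj.
set D := s * _ in D0.
have DE : s * oA i j z + s * oA j k z + s * oA k i z = D.
  by rewrite -!mulrDr orient_split.
have [s0|s0] := eqVneq s 0; first by rewrite /D s0 mul0r ltxx in D0.
pose be := s * oA k i z / D; pose ga := s * oA i j z / D.
have be0 : 0 <= be by rewrite divr_ge0 // ltW.
have ga0 : 0 <= ga by rewrite divr_ge0 // ltW.
have sum1 : be + ga <= 1.
  by rewrite -mulrDl ler_pdivrMr // mul1r; lra.
have -> : z = A i + (be *: (A j - A i) + ga *: (A k - A i)).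
  have Dn : oA i j (A k) != 0.
    by apply: contraTneq D0 => h; rewrite /D h mulr0 ltxx.
  apply/rowP => c; rewrite /be /ga /D !mxE.
  move: Dn; rewrite /orient.
  have [-> | ->] : c = 0 \/ c = 1.
      by case: c => [[|[|c]] hc] //; [left|right]; apply: val_inj.
    by move=> h; field; rewrite h s0.
  by move=> h; field; rewrite h s0.
have [sum0|sum0] := eqVneq (be + ga) 0.
  have -> : be = 0 by lra.
  have -> : ga = 0 by lra.
  by rewrite !scale0r !addr0; apply: hull_point.
have sum_gt0 : 0 < be + ga by rewrite lt_def sum0 addr_ge0.
have -> : be *: (A j - A i) + ga *: (A k - A i) =
  (be + ga) *: ((A j + (ga / (be + ga)) *: (A k - A j)) - A i).
  by apply/rowP => c; rewrite !mxE; field.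
apply: hull_segment; [by rewrite ltW|exact: hull_point|].
apply: hull_segment; [|exact: hull_point|exact: hull_point].
by rewrite divr_ge0 ?(ltW sum_gt0) //= ler_pdivrMr // mul1r lerDr.
Qed.

Definition generic z := forall i j, i != j -> oA i j z != 0.

Lemma lexsg_neq0 (c d : R) : (lexsg c d != 0) = (c != 0) || (d != 0).
Proof.
by rewrite /lexsg; have [_|c0] := eqVneq c 0; rewrite sgr_eq0 // (negbTE c0).
Qed.

(** The point z' lies infinitely close to z in the direction of w, as far as
    the lines spanned by the family can tell. *)
Definition towards z w z' :=
  forall i j, Num.sg (oA i j z') = lexsg (oA i j z) (oA i j w).

Lemma small_towards z w : small (fun t => towards z w (z + t *: (w - z))).
Proof.
apply: (@small_forall R I (fun i t => forall j, _)) => i.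
apply: (@small_forall R I (fun j t => _)) => j.
by apply: small_imp (small_sg (oA i j z) (oA i j w)) => t _; rewrite orient_lin.
Qed.

Lemma towards_generic z w z' : generic w -> towards z w z' -> generic z'.
Proof.
move=> gw zw i j ij; rewrite -sgr_eq0 zw -[_ == 0]negbK lexsg_neq0 negbK.
by rewrite (gw i j ij) orbT.
Qed.

Lemma towards_gt0 z w z' i j (s : R) : towards z w z' ->
  0 < s * oA i j z -> 0 < s * oA i j z'.
Proof.
move=> /(_ i j); rewrite /lexsg -sgr_gt0 => h1 h2; rewrite -sgr_gt0 sgrM h1.
case: eqP h2 => [->|_]; first by rewrite mulr0 sgr0 ltxx.
by rewrite sgrM.
Qed.

Lemma towards_gt0r z w z' i j (s : R) : towards z w z' -> oA i j z = 0 ->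
  0 < s * oA i j w -> 0 < s * oA i j z'.
Proof.
by move=> /(_ i j) + z0; rewrite /lexsg z0 eqxx -!(sgr_gt0 (s * _)) !sgrM => ->.
Qed.

(** The lines are avoided one at a time, by a small move towards a point off the
    next line, which stays off the lines already avoided. *)
Lemma exists_generic : general_position A -> (2 < #|I|)%N -> exists z, generic z.
Proof.
move=> gp I3.
suff [z hz] : exists z, forall ij : I * I, ij \in enum {: I * I} ->
    ij.1 != ij.2 -> oA ij.1 ij.2 z != 0.
  by exists z => i j; apply: (hz (i, j)); rewrite mem_enum.
elim: (enum _) => [|[i j] s [z hz]]; first by exists 0.
have [->|nij] := eqVneq i j.
  by exists z => ij; rewrite inE => /orP[/eqP->|/hz//]; rewrite eqxx.
have [k] : exists k, k \notin [set i; j].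
  apply/existsP; rewrite -negb_forall; apply/negP => /forallP h.
  have : (#|I| <= #|[set i; j]|)%N by apply/subset_leq_card/subsetP => k _; apply: h.
  by rewrite cards2 nij leqNgt I3.
rewrite !inE negb_or => /andP[ki kj].
have kij : oA i j (A k) != 0.
  by apply: gp; rewrite /= !inE negb_or nij [i == k]eq_sym ki [j == k]eq_sym kj.
have [t _ ht] := small_ex (small_towards z (A k)).
exists (z + t *: (A k - z)) => ij; rewrite inE -sgr_eq0 ht -[_ == 0]negbK.
rewrite lexsg_neq0 negbK => /orP[/eqP -> _|/hz h /h -> //].
by rewrite kij orbT.
Qed.

Lemma generic_towards z w : generic w -> exists z', [/\ generic z', towards z w z'
  & exists2 t : R, 0 < t < 1 & z' = z + t *: (w - z)].
Proof.
move=> gw; have [t t01 ht] := small_ex (small_towards z w).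
by exists (z + t *: (w - z)); split; [apply: towards_generic ht| |exists t].
Qed.

(** The point c inside the triangle ijk can be moved slightly in a generic
    direction without leaving the triangle. *)
Lemma exists_generic_hull : general_position A -> (2 < #|I|)%N ->
  exists2 z, generic z & hull A setT z.
Proof.
move=> gp I3; have [g gg] := exists_generic gp I3.
have [i [j [k u]]] : exists i j k : I, uniq [:: i; j; k].
  move: I3; rewrite cardE.
  case: (enum I) (enum_uniq I) => [|i [|j [|k s]]] // u _; exists i, j, k.
  by move: u; rewrite -[_ :: _]/([:: i; j; k] ++ s) cat_uniq => /andP[].
have D0 := gp _ _ _ u.
pose s := Num.sg (oA i j (A k)).
pose c := A i + 2^-1 *: ((A j + 2^-1 *: (A k - A j)) - A i).
have pos : 0 < s * oA i j (A k) by rewrite -normrEsg normr_gt0.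
have c1 : s * oA i j c = 4^-1 * (s * oA i j (A k)).
  by rewrite /c !orient_lin orientxx orientxy; field.
have c2 : s * oA j k c = 2^-1 * (s * oA i j (A k)).
  by rewrite /c !orient_lin orientxx orientxy orient_cyc; field.
have c3 : s * oA k i c = 4^-1 * (s * oA i j (A k)).
  by rewrite /c !orient_lin orientxx orientxy (orient_cyc (A k) (A i)); field.
have [z [gz zc _]] := generic_towards c gg.
exists z => //; apply: (@hull_triangle _ i j k z s) => //; apply/ltW/(towards_gt0 zc).
- by rewrite c1 mulr_gt0 // invr_gt0.
- by rewrite c2 mulr_gt0 // invr_gt0.
- by rewrite c3 mulr_gt0 // invr_gt0.
Qed.

Lemma generic_towards_hull z w : generic w -> hull A setT z -> hull A setT w ->
  exists z', [/\ generic z', towards z w z' & hull A setT z'].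
Proof.
move=> gw hz hw; have [z' [gz' tz' [t /andP[t0 t1] zE]]] := generic_towards z gw.
by exists z'; split=> //; rewrite zE; apply: hull_segment => //; rewrite !ltW.
Qed.

End Hulls.

(** * Parities over the edges of a cycle *)

Notation "\xor_ ( i 'in' A ) F" := (\big[addb/false]_(i in A) F)
  (at level 41, F at level 41, i, A at level 50) : bool_scope.

Section Cycles.
Context {I : finType}.
Implicit Types (x y u w : I) (s : seq I) (e : {set I}) (F : {set {set I}}).

Lemma set2_inj x y u w : [set x; y] = [set u; w] ->
  (x = u /\ y = w) \/ (x = w /\ y = u).
Proof.
move=> h.
have hx : x \in [set u; w] by rewrite -h !inE eqxx.
have hy : y \in [set u; w] by rewrite -h !inE eqxx orbT.
move: hx hy; rewrite !inE => /orP[]/eqP xE /orP[]/eqP yE; subst x y.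
- have : w \in [set u; u] by rewrite h !inE eqxx orbT.
  by rewrite !inE orbb => /eqP->; left.
- by left.
- by right.
- have : u \in [set w; w] by rewrite h !inE eqxx.
  by rewrite !inE orbb => /eqP->; left.
Qed.

Lemma set2C x y : [set x; y] = [set y; x] :> {set I}.
Proof. exact: setUC. Qed.

Lemma xor_setU1 (T : finType) (x : T) (S : {set T}) (f : T -> bool) :
  x \notin S -> \xor_(i in x |: S) f i = f x (+) \xor_(i in S) f i.
Proof. exact: big_setU1. Qed.

Lemma odd_card_xor (T : finType) (S : {set T}) (f : T -> bool) :
  odd #|[set x in S | f x]| = \xor_(x in S) f x.
Proof.
rewrite -sum1dep_card big_mkcondr /=.
apply: (big_rec2 (fun n b => odd n = b)) => // x n b _ <-.
by rewrite oddD; case: (f x).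
Qed.

Definition is_cycle F :=
  exists s, [/\ (2 < size s)%N, uniq s & F = cycle_edges s].

Definition nbrs_of F x u w :=
  [/\ u != w, u != x, w != x &
   forall y, ([set x; y] \in F) = (y == u) || (y == w)].

Lemma cycle_rot s n : uniq s -> cycle_edges (rot n s) = cycle_edges s.
Proof.
move=> us; apply/setP => e; apply/imsetP/imsetP => -[x xs ->];
  exists x; by [rewrite -(mem_rot n)|rewrite mem_rot|rewrite next_rot].
Qed.

Lemma is_cycle_at F x : is_cycle F -> x \in cover F ->
  exists y z t, uniq [:: x, y, z & t] /\ F = cycle_edges [:: x, y, z & t].
Proof.
move=> [s [s2 us ->]] /bigcupP[e /imsetP[w ws ->]] xe.
have xs : x \in s.
  by move: xe; rewrite !inE => /orP[]/eqP->//; rewrite mem_next.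
case: (rot_to xs) => n s' rs.
have us' : uniq (x :: s') by rewrite -rs rot_uniq.
have : size (x :: s') = size s by rewrite -rs size_rot.
case: s' us' rs => [|y [|z t]] us' rs /=; try lia.
by exists y, z, t; rewrite -rs cycle_rot.
Qed.

Lemma cycle_nbrs F x : is_cycle F -> x \in cover F -> exists u w, nbrs_of F x u w.
Proof.
move=> cF /(is_cycle_at cF)[y [z [t [us FE]]]].
have nx : next [:: x, y, z & t] x = y by rewrite /= eqxx.
move: (us) => /=; rewrite !inE !negb_or => /and4P[/and3P[xy xz _] /andP[yz _] _ _].
have ny : next [:: x, y, z & t] y = z by rewrite /= eq_sym (negbTE xy) eqxx.
set s := [:: x, y, z & t] in us nx ny FE *.
have xs : x \in s by rewrite !inE eqxx.
have px : next s (prev s x) = x by rewrite next_prev.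
exists y, (prev s x); split.
- by apply: contra_neq xz => h; rewrite -ny h px.
- by rewrite eq_sym.
- by apply: contra_neq xy => h; rewrite -nx -h px.
- move=> w; rewrite FE; apply/imsetP/orP => [[k ks /set2_inj]|].
    move=> [[<- ->]|[xk ->]]; first by left; rewrite nx.
    by right; rewrite xk prev_next.
  move=> [/eqP->|/eqP->]; first by exists x; rewrite ?nx.
  by exists (prev s x); rewrite ?mem_prev ?px // set2C.
Qed.

Lemma nbrs_swap F (k u w : I) : nbrs_of F k u w -> nbrs_of F k w u.
Proof. by move=> [uw uk wk E]; split; rewrite 1?[w == u]eq_sym // => y; rewrite E orbC. Qed.

Lemma nbrs_sym F (k u w v : I) : nbrs_of F k u w -> ([set k; v] \in F) = (v == u) || (v == w).
Proof. by case. Qed.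

Lemma nbrs_mem F (k u w : I) : nbrs_of F k u w -> [/\ k \in cover F, u \in cover F & w \in cover F].
Proof.
move=> [_ _ _ E]; have uF : [set k; u] \in F by rewrite E eqxx.
have wF : [set k; w] \in F by rewrite E eqxx orbT.
by split; apply/bigcupP; [exists [set k; u]|exists [set k; u]|exists [set k; w]];
  rewrite // !inE eqxx ?orbT.
Qed.

Lemma cycle_edge2 F e : is_cycle F -> e \in F -> exists x y, x != y /\ e = [set x; y].
Proof.
move=> cF eF.
have [x xe] : exists x, x \in e.
  move: (cF) eF => [s [_ _ ->]] /imsetP[x xs ->]; exists x.
  by rewrite !inE eqxx.
have xF : x \in cover F by apply/bigcupP; exists e.
have [u [w [uw ux wx h]]] := cycle_nbrs cF xF.
move: (cF) (eF) => [s [_ _ FE]]; rewrite {1}FE => /imsetP[y ys eE].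
exists y, (next s y); split=> //.
apply/eqP => yy; move: xe (h x); rewrite eE -yy setUid inE => /eqP xy.
by move: eF; rewrite eE -yy -xy => ->; rewrite !(eq_sym x) (negbTE ux) (negbTE wx).
Qed.

Lemma xor_at F x u w (f : {set I} -> bool) : is_cycle F -> nbrs_of F x u w ->
  \xor_(e in [set e in F | x \in e]) f e = f [set x; u] (+) f [set x; w].
Proof.
move=> cF [uw ux wx h].
have -> : [set e in F | x \in e] = [set [set x; u]; [set x; w]].
  apply/setP => e; rewrite !inE; apply/andP/orP.
    move=> [eF xe]; have [y [z [yz eE]]] := cycle_edge2 cF eF.
    move: xe eF; rewrite eE !inE => /orP[]/eqP<-.
      by rewrite h => /orP[]/eqP->; [left|right].
    by rewrite set2C h => /orP[]/eqP->; [left|right].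
  by move=> []/eqP->; split; rewrite ?h ?inE eqxx ?orbT.
rewrite xor_setU1 ?big_set1 // inE; apply/eqP => /set2_inj[[_ /eqP]|[xw _]].
  by rewrite (negbTE uw).
by move: wx; rewrite -xw eqxx.
Qed.

(** Double counting: every vertex lies on two edges or on none. *)
Lemma xor_cycle F (f : I -> bool) : is_cycle F ->
  \xor_(e in F) \xor_(x in e) f x = false.
Proof.
move=> cF.
under eq_bigr => e _ do rewrite big_mkcond /=.
rewrite exchange_big big1 //= => x _.
rewrite -big_mkcondr /=.
have [xF|xF] := boolP (x \in cover F).
  have [u [w h]] := cycle_nbrs cF xF.
  transitivity (\xor_(e in [set e in F | x \in e]) f x).
    by apply: eq_bigl => e; rewrite inE.
  by rewrite (xor_at _ cF h) addbb.
rewrite big1 // => e /andP[eF xe]; case/negP: xF.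
by apply/bigcupP; exists e.
Qed.

Lemma cycle_edge_at F x y : is_cycle F -> [set x; y] \in F ->
  exists a b z t, [/\ uniq [:: a, b, z & t], F = cycle_edges [:: a, b, z & t]
    & [set x; y] = [set a; b]].
Proof.
move=> [s [s2 us FE]]; rewrite {1}FE => /imsetP[a as_ ->].
case: (rot_to as_) => n s' rs.
have us' : uniq (a :: s') by rewrite -rs rot_uniq.
have : size (a :: s') = size s by rewrite -rs size_rot.
case: s' us' rs => [|b [|z t]] us' rs /=; try lia.
exists a, b, z, t; split=> //; first by rewrite -rs cycle_rot.
by rewrite -(next_rot n us) rs /= eqxx.
Qed.

(** The cycle minus the two ends of one of its edges is a path, along which a
    property can be propagated from any vertex to any other. *)
Lemma cycle_connected F x y (S : {set I}) v k : is_cycle F -> [set x; y] \in F ->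
  (forall a b, [set a; b] \in F -> a \notin [set x; y] -> b \notin [set x; y] ->
     a \in S -> b \in S) ->
  v \in cover F -> v \notin [set x; y] -> k \in cover F -> k \notin [set x; y] ->
  k \in S -> v \in S.
Proof.
move=> cF /(cycle_edge_at cF)[a [b [z [t [us FE ->]]]]] clS.
have mem_t u : u \in cover F -> u \notin [set a; b] -> u \in z :: t.
  move=> /bigcupP[e]; rewrite FE => /imsetP[c cs ->].
  have : u \in [set c; next [:: a, b, z & t] c] -> u \in [:: a, b, z & t].
    by rewrite !inE => /orP[]/eqP->; rewrite -?[_ || _]/(_ \in [:: a, b, z & t]) ?mem_next.
  by move=> /[apply]; rewrite !inE negb_or => /or4P[->|->|->|->]; rewrite ?orbT // andbF.
move=> /mem_t + vxy => /(_ vxy) vt /mem_t + kxy => /(_ kxy) kt.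
have : path (fun u w => [set u; w] \in F) z t.
  have : cycle (fun u w => [set u; w] \in F) [:: a, b, z & t].
    apply: (cycle_from_next us) => u uin.
    by rewrite FE; apply/imsetP; exists u.
  by rewrite /= rcons_path => /and4P[_ _ + _].
move: us; rewrite !cons_uniq => /and3P[]; rewrite inE negb_or => /andP[ab at_] bt _ pt.
have avoid u : u \in z :: t -> u \notin [set a; b].
  by rewrite !inE negb_or => ut; apply/andP; split;
    [move: at_|move: bt]; apply: contraNneq => <-; rewrite inE.
have all_eq u : u \in z :: t -> (u \in S) = (z \in S).
  elim: t z pt avoid {mem_t at_ bt kt vt FE} u => [|y' t IH] z /= => [_ _|/andP[zy pt] avoid] u.
    by rewrite inE => /eqP->.
  rewrite inE => /orP[/eqP->//|ut].
  have zin := avoid z (mem_head _ _).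
  have yin : y' \notin [set a; b] by apply: avoid; rewrite !inE eqxx orbT.
  rewrite (IH y' pt _ u ut); last by move=> w wt; apply: avoid; rewrite inE wt orbT.
  by apply/idP/idP; apply: clS => //; rewrite set2C.
by rewrite !all_eq.
Qed.

End Cycles.

(** * The parity of a polygon at a point *)

Section Rays.
Context {R : realType} {I : finType} (A : I -> 'rV[R]_2).
Implicit Types (z w : 'rV[R]_2) (x y : I) (e : {set I}) (F : {set {set I}}).
Local Notation oA i j z := (orient (A i) (A j) z).
Local Notation low z x := (A x 0 1 <= (z : 'rV[R]_2) 0 1).

Definition par F z := odd #|[set e in F | ray_crosses A z e]|.

Lemma parE F z : par F z = \xor_(e in F) ray_crosses A z e.
Proof. exact: odd_card_xor. Qed.

Lemma rV2P (a b : 'rV[R]_2) : a 0 0 = b 0 0 -> a 0 1 = b 0 1 -> a = b.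
Proof.
move=> h0 h1; apply/rowP => -[[|[|c]] hc] //.
  by have -> : Ordinal hc = 0 by apply: val_inj.
by have -> : Ordinal hc = 1 by apply: val_inj.
Qed.

(** The two disjuncts are exclusive, according to which end of the edge is lower;
    in particular the edge is never counted twice. *)
Lemma ray_crosses_pair x y z : ray_crosses A z [set x; y] =
  [&& low z x, ~~ low z y & 0 < oA x y z] || [&& low z y, ~~ low z x & 0 < oA y x z].
Proof.
rewrite /ray_crosses -!ltNge; apply/exists_inP/orP.
  move=> [a]; rewrite !inE => /orP[]/eqP-> /exists_inP[b]; rewrite !inE => /orP[]/eqP-> h.
  - by case/and3P: h => h1 h2; rewrite ltNge h1 in h2.
  - by left.
  - by right.
  - by case/and3P: h => h1 h2; rewrite ltNge h1 in h2.
move=> [] h.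
  by exists x; rewrite ?inE ?eqxx //; apply/exists_inP; exists y; rewrite ?inE ?eqxx ?orbT.
by exists y; rewrite ?inE ?eqxx ?orbT //; apply/exists_inP; exists x; rewrite ?inE ?eqxx.
Qed.

Lemma hull_pair_height x y z : A x 0 1 <= z 0 1 <= A y 0 1 -> A x 0 1 < A y 0 1 ->
  oA x y z = 0 -> hull A [set x; y] z.
Proof.
move=> /andP[h1 h2] h3 h4; have D0 : 0 < A y 0 1 - A x 0 1 by rewrite subr_gt0.
apply/hull_pair; exists ((z 0 1 - A x 0 1) / (A y 0 1 - A x 0 1)).
  rewrite divr_ge0 ?(ltW D0) ?subr_ge0 //= ler_pdivrMr // mul1r; lra.
apply: rV2P; rewrite !mxE; last by field; rewrite gt_eqF.
have : (A y 0 1 - A x 0 1) * (z 0 0 - A x 0 0)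
       = (z 0 1 - A x 0 1) * (A y 0 0 - A x 0 0).
  by move: h4; rewrite /orient => h4; lra.
move=> h; rewrite mulrAC -h mulrAC divff ?gt_eqF // mul1r; ring.
Qed.

Lemma orient_span_neq0 x y z : low z x -> ~~ low z y -> ~ hull A [set x; y] z ->
  oA x y z != 0.
Proof.
rewrite -ltNge => h1 h2 nh; apply/eqP => o0; apply: nh.
apply: hull_pair_height => //; first by rewrite h1 ltW.
exact: le_lt_trans h1 h2.
Qed.

Lemma orient_level x y z : A x 0 1 = z 0 1 ->
  oA x y z = (A y 0 1 - z 0 1) * (A x 0 0 - z 0 0).
Proof. by rewrite /orient => ->; ring. Qed.

Lemma small_low z w x : small (fun t =>
  low (z + t *: (w - z)) x = if A x 0 1 == z 0 1 then z 0 1 <= w 0 1 else low z x).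
Proof.
apply: small_imp (small_sg (z 0 1 - A x 0 1) (w 0 1 - A x 0 1)) => t t0 h.
rewrite !mxE -subr_ge0 -sgr_ge0.
have -> : z 0 1 + t * (w 0 1 - z 0 1) - A x 0 1 =
  (1 - t) * (z 0 1 - A x 0 1) + t * (w 0 1 - A x 0 1) by ring.
rewrite h /lexsg subr_eq0 [z 0 1 == _]eq_sym; case: eqP => [->|_].
  by rewrite sgr_ge0 subr_ge0.
by rewrite sgr_ge0 subr_ge0.
Qed.

Lemma small_orient_pos z w x y : oA x y z != 0 ->
  small (fun t => (0 < oA x y (z + t *: (w - z))) = (0 < oA x y z)).
Proof.
move=> o0; apply: small_imp (small_sg (oA x y z) (oA x y w)) => t t0.
by rewrite -orient_lin /lexsg (negbTE o0) -sgr_gt0 => ->; rewrite sgr_gt0.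
Qed.

(** When z moves slightly towards w, the ray from z loses or gains the edges at
    those vertices that lie on it, provided that w is below. *)
Definition on_ray z w x :=
  [&& A x 0 1 == z 0 1, z 0 0 < A x 0 0 & w 0 1 < z 0 1].

Lemma small_ray_crosses x y z w : ~ hull A [set x; y] z ->
  small (fun t => ray_crosses A (z + t *: (w - z)) [set x; y] =
    ray_crosses A z [set x; y] (+) (on_ray z w x (+) on_ray z w y)).
Proof.
move=> nh.
wlog hxy : x y nh / (A y 0 1 == z 0 1) ==> (A x 0 1 == z 0 1).
  move=> W; have [h|] := boolP ((A y 0 1 == z 0 1) ==> (A x 0 1 == z 0 1)).
    exact: (W x y nh h).
  rewrite negb_imply => /andP[h1 h2]; rewrite (set2C x y) (addbC (on_ray _ _ x)).
  by apply: W; rewrite ?h1 ?implybT // set2C.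
have opp a b (u : 'rV[R]_2) : (0 < oA b a u) = (oA a b u < 0).
  by rewrite orientNl oppr_gt0.
have nh' : ~ hull A [set y; x] z by rewrite set2C.
have lows := small_and (small_low z w x) (small_low z w y).
have [ex|nx] := boolP (A x 0 1 == z 0 1); last first.
  have {}hxy : A y 0 1 == z 0 1 = false by move: hxy; rewrite (negbTE nx) implybF => /negbTE.
  rewrite /on_ray (negbTE nx) hxy /=.
  have [sp|nsp] := boolP (low z x == low z y).
    apply: small_imp lows => t t0; rewrite (negbTE nx) hxy => -[hx hy].
    by rewrite !ray_crosses_pair hx hy (eqP sp); case: (low z y).
  have o0 : oA x y z != 0.
    move: nsp; case hx: (low z x); case hy: (low z y) => // _.
      by apply: orient_span_neq0 nh; rewrite ?hx ?hy.
    by rewrite orientNl oppr_eq0; apply: orient_span_neq0 nh'; rewrite ?hx ?hy.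
  have o0' : oA y x z != 0 by rewrite orientNl oppr_eq0.
  apply: small_imp (small_and lows (small_and (small_orient_pos w o0)
    (small_orient_pos w o0'))) => t t0.
  rewrite (negbTE nx) hxy => -[[hx hy] [o1 o2]].
  by rewrite !ray_crosses_pair hx hy o1 o2 !addbF.
have lx : low z x by rewrite (eqP ex).
have [ey|ny] := boolP (A y 0 1 == z 0 1).
  have ly : low z y by rewrite (eqP ey).
  apply: small_imp lows => t t0; rewrite ex ey => -[hx hy].
  rewrite !ray_crosses_pair hx hy lx ly /= /on_ray ex ey /= [w 0 1 < _]ltNge.
  case: (z 0 1 <= w 0 1); rewrite ?andbF ?andbT //=.
  apply/esym/negbTE; rewrite negb_add; apply/eqP; apply/idP/idP => hz.
  - rewrite ltNge; apply/negP => hz'; apply: nh.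
    apply/hull_pair; exists ((A x 0 0 - z 0 0) / (A x 0 0 - A y 0 0)).
      have D0 : 0 < A x 0 0 - A y 0 0 by lra.
      by rewrite divr_ge0 ?(ltW D0) ?subr_ge0 ?(ltW hz) //= ler_pdivrMr // mul1r; lra.
    apply: rV2P; rewrite !mxE; last by rewrite (eqP ex) (eqP ey); ring.
    by field; apply/eqP => h; lra.
  - rewrite ltNge; apply/negP => hz'; apply: nh.
    apply/hull_pair; exists ((z 0 0 - A x 0 0) / (A y 0 0 - A x 0 0)).
      have D0 : 0 < A y 0 0 - A x 0 0 by lra.
      by rewrite divr_ge0 ?(ltW D0) ?subr_ge0 //= ler_pdivrMr // mul1r; lra.
    apply: rV2P; rewrite !mxE; last by rewrite (eqP ex) (eqP ey); ring.
    by field; apply/eqP => h; lra.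
have x0 : A x 0 0 - z 0 0 != 0.
  rewrite subr_eq0; apply/eqP => h; apply: nh.
  have -> : z = A x by apply: rV2P; rewrite ?h ?(eqP ex).
  by apply: hull_point; rewrite !inE eqxx.
have oE := orient_level y (eqP ex).
have o0 : oA x y z != 0 by rewrite oE mulf_neq0 // subr_eq0.
have o0' : oA y x z != 0 by rewrite orientNl oppr_eq0.
apply: small_imp (small_and lows (small_and (small_orient_pos w o0)
  (small_orient_pos w o0'))) => t t0; rewrite ex (negbTE ny) => -[[hx hy] [o1 o2]].
rewrite !ray_crosses_pair hx hy o1 o2 lx /= /on_ray ex (negbTE ny) addbF /=.
rewrite (opp x y) oE [w 0 1 < _]ltNge.
case: (ltgtP (A y 0 1) (z 0 1)) ny => // hyz _; rewrite ?andbF ?orbF /=.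
- by rewrite nmulr_rlt0 ?subr_lt0 // subr_gt0 andbC.
- rewrite pmulr_rgt0 ?subr_gt0 //.
  by case: (z 0 1 <= w 0 1); rewrite /= ?andbF ?andbT ?addbF ?addbb.
Qed.

Lemma xor_pair (f : I -> bool) x y : x != y -> \xor_(k in [set x; y]) f k = f x (+) f y.
Proof. by move=> xy; rewrite xor_setU1 ?inE // big_set1. Qed.

(** The parity is locally constant off the polygon: the changes at the vertices
    on the ray cancel, because two edges meet at each vertex. *)
Lemma small_par F z w : is_cycle F -> ~ boundary A F z ->
  small (fun t => par F (z + t *: (w - z)) = par F z).
Proof.
move=> cF nb.
have h : forall e, small (fun t => e \in F -> ray_crosses A (z + t *: (w - z)) e =
    ray_crosses A z e (+) \xor_(k in e) on_ray z w k).
  move=> e; have [eF|neF] := boolP (e \in F); last by apply: small_true.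
  have [x [y [xy eE]]] := cycle_edge2 cF eF.
  rewrite {}eE in eF *.
  have nh : ~ hull A [set x; y] z by move=> hz; apply: nb; exists [set x; y].
  by apply: small_imp (small_ray_crosses w nh) => t _; rewrite xor_pair.
apply: small_imp (small_forall h) => t _ {}h; rewrite !parE.
by rewrite (eq_bigr _ h) big_split /= xor_cycle // addbF.
Qed.

End Rays.

(** Adds to the context the sign of X * b, given hX on the sign of X and hb on
    that of b. *)
Ltac prod_sign hX hb := let h := fresh in
  first [ have h := mulr_le0_ge0 hX (ltW hb) | have h := mulr_le0 hX (ltW hb)
        | have h := mulr_gt0 hX hb
        | have h := etrans (pmulr_rlt0 _ hX) hb ].

Section Parity.
Context {R : realType} {I : finType} (A : I -> 'rV[R]_2).
Implicit Types (z w : 'rV[R]_2) (x y : I) (e : {set I}) (F : {set {set I}}).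
Local Notation oA i j z := (orient (A i) (A j) z).
Local Notation low z x := (A x 0 1 <= (z : 'rV[R]_2) 0 1).

Lemma xor_exists (T : finType) (S : {set T}) (f : T -> bool) :
  \xor_(e in S) f e -> exists2 e, e \in S & f e.
Proof.
move=> h; apply/exists_inP; move: h; apply: contraLR => /exists_inPn h.
by rewrite big1 // => e /h /negbTE.
Qed.

Lemma level_point x y z : low z x -> ~~ low z y ->
  exists r, [/\ hull A setT r, r 0 1 = z 0 1 &
    (A y 0 1 - A x 0 1) * (r 0 0 - z 0 0) = oA x y z].
Proof.
rewrite -ltNge => h1 h2; have D0 : 0 < A y 0 1 - A x 0 1 by lra.
pose t := (z 0 1 - A x 0 1) / (A y 0 1 - A x 0 1).
exists (A x + t *: (A y - A x)); split.
- apply: hull_segment; [|exact: hull_point|exact: hull_point].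
  by rewrite divr_ge0 ?(ltW D0) ?subr_ge0 //= ler_pdivrMr // mul1r; lra.
- by rewrite !mxE /t; field; rewrite gt_eqF.
- by rewrite !mxE /t /orient; field; rewrite gt_eqF.
Qed.

(** The points inside a closed polygon lie between an edge on their right and
    an edge on their left. *)
Lemma par_hull F z : is_cycle F -> par A F z -> hull A setT z.
Proof.
move=> cF pz.
have sp : forall e, e \in F -> exists x y, [/\ x != y, e = [set x; y],
    low z x || ~~ low z y & \xor_(k in e) low z k = low z x && ~~ low z y].
  move=> e /(cycle_edge2 cF)[x [y [xy ->]]].
  have [h|h] := boolP (low z x || ~~ low z y).
    exists x, y; split=> //; rewrite xor_pair //.
    by move: h; case: (low z x); case: (low z y).
  exists y, x; split; [by rewrite eq_sym|exact: set2C| |];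
    rewrite ?xor_pair //; by move: h; case: (low z x); case: (low z y).
have [r1 [hr1 r1z r1x]] : exists r, [/\ hull A setT r, r 0 1 = z 0 1 & z 0 0 < r 0 0].
  have [e eF] := xor_exists (etrans (esym (parE A F z)) pz).
  have [x [y [xy -> l _]]] := sp e eF; rewrite ray_crosses_pair.
  have -> : [&& low z y, ~~ low z x & 0 < oA y x z] = false.
    by move: l; case: (low z x); case: (low z y).
  rewrite orbF => /and3P[lx ly o0].
  have [r [hr rz rx]] := level_point lx ly; exists r; split=> //.
  rewrite -subr_gt0; move: o0; rewrite -rx pmulr_rgt0 //.
  by move: lx ly; rewrite -ltNge; lra.
have [r2 [hr2 r2z r2x]] : exists r, [/\ hull A setT r, r 0 1 = z 0 1 & r 0 0 <= z 0 0].
  have : \xor_(e in F) (ray_crosses A z e (+) \xor_(k in e) low z k).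
    by rewrite big_split /= xor_cycle // addbF -parE.
  move=> /xor_exists[e eF]; have [x [y [xy -> l ->]]] := sp e eF.
  rewrite ray_crosses_pair.
  have -> : [&& low z y, ~~ low z x & 0 < oA y x z] = false.
    by move: l; case: (low z x); case: (low z y).
  rewrite orbF; case lx: (low z x) => //=; case ly: (low z y) => //=.
  rewrite addbT -leNgt => o0.
  have [r [hr rz rx]] := level_point lx (negbT ly); exists r; split=> //.
  rewrite -subr_le0; move: o0; rewrite -rx pmulr_rle0 //.
  by move/negbT: ly lx; rewrite -ltNge; lra.
have D0 : 0 < r1 0 0 - r2 0 0 by lra.
have -> : z = r2 + ((z 0 0 - r2 0 0) / (r1 0 0 - r2 0 0)) *: (r1 - r2).
  by apply: rV2P; rewrite !mxE ?r1z ?r2z; [field; rewrite gt_eqF|ring].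
apply: hull_segment => //.
by rewrite divr_ge0 ?(ltW D0) ?subr_ge0 //= ler_pdivrMr // mul1r; lra.
Qed.

(** The signs of the level differences X, Y, U and of the orientations a, b, c decide
    which sides of a triangle are met by a ray; the relation between them rules
    out all the combinations that violate the parity. *)
Lemma sign_parity (X Y U a b c : R) : a != 0 -> b != 0 -> c != 0 ->
  X * b + Y * c + U * a = 0 -> (X = 0 -> Y = 0 -> a = 0) ->
  ([&& X <= 0, ~~ (Y <= 0) & 0 < a] || [&& Y <= 0, ~~ (X <= 0) & a < 0])
  (+) ([&& Y <= 0, ~~ (U <= 0) & 0 < b] || [&& U <= 0, ~~ (Y <= 0) & b < 0])
  (+) ([&& U <= 0, ~~ (X <= 0) & 0 < c] || [&& X <= 0, ~~ (U <= 0) & c < 0])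
  = ((0 < a) == (0 < b)) && ((0 < b) == (0 < c)).
Proof.
move=> a0 b0 c0 eq0 dxy.
case: (ltgtP 0 a) a0 => //= ha _; case: (ltgtP 0 b) b0 => //= hb _;
case: (ltgtP 0 c) c0 => //= hc _; case: (lerP X 0) => hX; case: (lerP Y 0) => hY;
case: (lerP U 0) => hU //=; exfalso.
all: prod_sign hX hb; prod_sign hY hc; prod_sign hU ha; (try lra).
all: have /eqP : X * b = 0 by lra.
all: have /eqP : Y * c = 0 by lra.
all: rewrite !mulf_eq0 ?(lt_eqF hb) ?(lt_eqF hc) ?(gt_eqF hb) ?(gt_eqF hc) !orbF.
all: move=> /eqP Y0 /eqP X0.
all: by move: (dxy X0 Y0) ha => ->; rewrite ltxx.
Qed.

(** Inside a triangle the ray leaves through exactly one side; outside it meets none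
    or two. *)
Lemma triangle_parity x y u z : oA x y z != 0 -> oA y u z != 0 -> oA u x z != 0 ->
  ray_crosses A z [set x; y] (+) ray_crosses A z [set y; u] (+) ray_crosses A z [set u; x]
  = ((0 < oA x y z) == (0 < oA y u z)) && ((0 < oA y u z) == (0 < oA u x z)).
Proof.
move=> a0 b0 c0; rewrite !ray_crosses_pair.
rewrite (orientNl (A x) (A y)) (orientNl (A y) (A u)) (orientNl (A u) (A x)) !oppr_gt0.
rewrite -(subr_le0 (z 0 1) (A x 0 1)) -(subr_le0 (z 0 1) (A y 0 1)).
rewrite -(subr_le0 (z 0 1) (A u 0 1)); apply: sign_parity => //.
  by rewrite /orient; ring.
rewrite /orient => h1 h2; have -> : A y 0 1 = A x 0 1 by lra.
by have -> : z 0 1 = A x 0 1 by [lra]; ring.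
Qed.

End Parity.

(** * Partitions tested at generic points *)

Section Partition.
Context {R : realType} {I : finType} (A : I -> 'rV[R]_2).
Implicit Types (z w : 'rV[R]_2) (x y : I) (e : {set I}) (F : {set {set I}}).
Local Notation oA i j z := (orient (A i) (A j) z).

Definition inside_triangle x y u z :=
  ((0 < oA x y z) == (0 < oA y u z)) && ((0 < oA y u z) == (0 < oA u x z)).

Lemma ray_crosses_loop x z : ray_crosses A z [set x; x] = false.
Proof. by rewrite ray_crosses_pair; case: (_ <= _). Qed.

(** The parity of the triangle spanned by an edge and the apex n. *)
Definition fan_parity n z e :=
  ray_crosses A z e (+) \xor_(k in e) ray_crosses A z [set n; k].

(** Replacing each edge of a polygon by its triangle with a common apex does not
    change the parity: the edges at the apex cancel. *)
Lemma par_fan F z n : is_cycle F -> par A F z = \xor_(e in F) fan_parity n z e.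
Proof. by move=> cF; rewrite big_split /= xor_cycle // addbF parE. Qed.

Lemma fan_parity_apex n x z : x != n -> fan_parity n z [set n; x] = false.
Proof.
by move=> xn; rewrite /fan_parity xor_pair 1?eq_sym // ray_crosses_loop addFb addbb.
Qed.

Lemma fan_parityE n x y z : generic A z -> x != n -> y != n -> x != y ->
  fan_parity n z [set x; y] = inside_triangle n x y z.
Proof.
move=> gz xn yn xy; rewrite /fan_parity xor_pair // /inside_triangle.
rewrite -triangle_parity; try by apply: gz; rewrite // eq_sym.
rewrite (set2C y n); case: (ray_crosses A z [set x; y]);
by case: (ray_crosses A z [set n; x]); case: (ray_crosses A z [set n; y]).
Qed.

(** Each triangle of the fan at a fixed vertex is described by orientations alone, so
    that the direction of the rays does not matter. *)
Lemma par_sign F z z' : is_cycle F -> generic A z -> generic A z' ->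
  (forall i j, Num.sg (oA i j z) = Num.sg (oA i j z')) -> par A F z = par A F z'.
Proof.
move=> cF gz gz' sE.
have sE' i j : (0 < oA i j z) = (0 < oA i j z') by rewrite -sgr_gt0 sE sgr_gt0.
have [n _] : exists n : I, true.
  by move: cF => [[|n s] [s2 _ _]] //; exists n.
rewrite !(par_fan _ n) //; apply: eq_bigr => e eF.
have [x [y [xy ->]]] := cycle_edge2 cF eF.
have [nx|nx] := eqVneq x n.
  by rewrite nx !fan_parity_apex // eq_sym -nx.
have [ny|ny] := eqVneq y n.
  by rewrite ny set2C !fan_parity_apex // -ny.
by rewrite !fan_parityE // /inside_triangle !sE'.
Qed.

Lemma generic_nboundary F z : is_cycle F -> generic A z -> ~ boundary A F z.
Proof.
move=> cF gz [e eF]; have [x [y [xy ->]]] := cycle_edge2 cF eF.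
move=> /hull_pair[t t01 zE]; have := gz x y xy.
by rewrite zE orient_lin orientxx orientxy !mulr0 addr0 eqxx.
Qed.

(** The conditions on the interiors in a partition of the hull, restricted to generic
    points, which lie on no boundary. *)
Definition generic_partition (T : {set {set {set I}}}) :=
  (forall z, generic A z -> hull A setT z -> exists2 F, F \in T & par A F z) /\
  (forall z F G, generic A z -> F \in T -> G \in T -> par A F z -> par A G z -> F = G).

(** Parities are locally constant off the polygons. Hence a common interior point
    of two polygons can be moved into general position; and if a point of the hull
    belonged to no polygon, then neither would the points close to it, among them
    generic points of the hull. *)
Lemma polygonal_partitionP (P : {set {set I}} -> Prop) (T : {set {set {set I}}}) :
  general_position A -> (2 < #|I|)%N -> (forall F, P F -> is_cycle F) ->
  polygonal_partition A P T <->
  [/\ forall F, F \in T -> P F, generic_partition T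
    & \bigcup_(F in T) vertices F = setT].
Proof.
move=> gp I3 PC; split=> -[TP].
  move=> dis cov cvr; split=> //; split=> [z gz hz|z F G gz FT GT pF pG].
    have [F FT [bF|[_ pF]]] := (cov z).1 hz; last by exists F.
    by case: (generic_nboundary (PC F (TP F FT)) gz).
  apply/eqP/negPn/negP => FG; apply: (dis F G z FT GT FG).
  by split; split=> //; apply: generic_nboundary gz; apply/PC/TP.
move=> [cov dis] cvr; split=> // [F G z FT GT FG [[bF pF] [bG pG]]|z].
  have [g gg _] := exists_generic_hull gp I3.
  have [t _ [ht [hF hG]]] := small_ex (small_and (small_towards A z g)
    (small_and (small_par g (PC F (TP F FT)) bF) (small_par g (PC G (TP G GT)) bG))).
  case/negP: FG; apply/eqP; apply: (dis (z + t *: (g - z))) => //.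
  - exact: towards_generic ht.
  - by rewrite hF.
  - by rewrite hG.
split=> [hz|[F FT [[e eF he]|[_ pF]]]]; last by apply: par_hull pF; apply/PC/TP.
  have [g gg hg] := exists_generic_hull gp I3.
  apply: contrapT => nz.
  have nb F : F \in T -> ~ boundary A F z /\ par A F z = false.
    move=> FT; have nbF : ~ boundary A F z by move=> b; apply: nz; exists F => //; left.
    split=> //; apply/negbTE/negP => pF; apply: nz; exists F => //; right; split=> //.
  have sm : small (fun t => forall F, F \in T -> par A F (z + t *: (g - z)) = false).
    apply: small_forall => F; have [FT|nFT] := boolP (F \in T); last exact: small_true.
    have [bF pF] := nb F FT.
    by apply: small_imp (small_par g (PC F (TP F FT)) bF) => t _ ->.
  have [t /andP[t0 t1] [ht hF]] := small_ex (small_and (small_towards A z g) sm).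
  have [F FT pF] : exists2 F, F \in T & par A F (z + t *: (g - z)).
    apply: cov; first exact: towards_generic ht.
    by apply: hull_segment => //; rewrite !ltW.
  by rewrite hF in pF.
exact: hull_subset (subsetT e) he.
Qed.


(** For small t the points A v + t *: ((A u - A v) + (A w - A v)) lie off the polygon
    and all see the lines spanned by the family alike, so that a generic point z
    close to one of them decides for all of them. The last two clauses locate z: it
    is on the same side as v of the lines that avoid v, and on the same side as the
    sum of the two edges at v of the lines through v. *)
Lemma convex_vertexP F (v u w : I) : general_position A -> (2 < #|I|)%N -> is_cycle F ->
  nbrs_of F v u w -> exists z, [/\ generic A z, convex_vertex A F v <-> par A F z,
    forall i j s, v != i -> v != j -> 0 < s * oA i j (A v) -> 0 < s * oA i j z &
    forall k s, 0 < s * (oA v k (A u) + oA v k (A w)) -> 0 < s * oA v k z].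
Proof.
move=> gp I3 cF [uw uv wv nb].
have [g gg _] := exists_generic_hull gp I3.
pose d := (A u - A v) + (A w - A v); pose c := A v + d.
have cE k : oA v k c = oA v k (A u) + oA v k (A w).
  by rewrite /c /d /orient !mxE; ring.
have dE t : A v + t *: d = A v + t *: (c - A v) by rewrite /c addrAC subrr add0r.
have near_nb t : towards A (A v) c (A v + t *: d) -> ~ boundary A F (A v + t *: d).
  move=> tc [e eF]; have [x [y [xy eE]]] := cycle_edge2 cF eF; rewrite {}eE in eF *.
  move=> /hull_pair[r _ zE].
  have o0 : oA x y (A v + t *: d) = 0.
    by rewrite zE orient_lin orientxx orientxy !mulr0 addr0.
  have := tc x y; rewrite o0 sgr0 => /esym/eqP; rewrite -[_ == 0]negbK lexsg_neq0.
  have inc p q : [set v; p] \in F -> q \in [:: u; w] -> q != p -> oA v p (A q) != 0.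
    move=> vpF qin qp; apply: gp; rewrite /= !inE !negb_or andbT [p == q]eq_sym qp andbT.
    rewrite nb in vpF; apply/andP; split.
      by rewrite eq_sym; case/orP: vpF => /eqP->.
    by rewrite eq_sym; move: qin; rewrite !inE => /orP[]/eqP->.
  have vert p : [set v; p] \in F -> oA v p (A v) = 0 /\ oA v p c != 0.
    move=> vpF; rewrite orientxx cE; split=> //.
    move: (vpF); rewrite nb => /orP[]/eqP pE.
      by rewrite pE orientxy add0r -pE; apply: inc; rewrite ?inE ?eqxx ?orbT // pE eq_sym.
    by rewrite pE orientxy addr0 -pE; apply: inc; rewrite ?inE ?eqxx // pE.
  have [vx|vx] := eqVneq v x; first by subst x; case: (vert y eF) => _ ->; rewrite orbT.
  have [vy|vy] := eqVneq v y.
    subst y; rewrite set2C in eF; case: (vert x eF) => _.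
    by rewrite orientNl oppr_eq0 => ->; rewrite orbT.
  by rewrite gp //= !inE !negb_or xy [x == v]eq_sym vx [y == v]eq_sym vy.
have sm : small (fun t => towards A (A v) c (A v + t *: d)).
  by apply: small_imp (small_towards A (A v) c) => t _; rewrite dE.
have [t0 _ tow0] := small_ex sm.
have [z [gz towz _]] := generic_towards (A v + t0 *: d) gg.
have parz t : towards A (A v) c (A v + t *: d) -> par A F (A v + t *: d) = par A F z.
  move=> tow.
  have [r _ [r1 r2]] := small_ex (small_and (small_towards A (A v + t *: d) g)
     (small_par g cF (near_nb t tow))).
  rewrite -r2; apply: par_sign => //; first exact: towards_generic r1.
  move=> i j; rewrite r1 towz /lexsg.
  have sgE : Num.sg (oA i j (A v + t *: d)) = Num.sg (oA i j (A v + t0 *: d)).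
    by rewrite tow tow0.
  by rewrite -!(sgr_eq0 (oA i j (A v + _))) sgE.
exists z; split=> //.
- split=> [[u' [w' [uw' vu vw [eps eps0 h]]]]|pz]; last first.
    exists u, w; split; rewrite ?nb ?eqxx ?orbT //.
    case: sm => eps eps0 h; exists eps => // t /h tow; rewrite -/d.
    by split; [apply: near_nb|rewrite -/(par A F _) parz].
  have dE' : (A u' - A v) + (A w' - A v) = d.
    move: vu vw uw'; rewrite !nb => /orP[]/eqP-> /orP[]/eqP->; rewrite ?eqxx //.
    by rewrite addrC.
  have sm' : small (fun t => t < eps) by exists eps => // t /andP[].
  have [t /andP[t0' _] [tow te]] := small_ex (small_and sm sm').
  have [_] : polygon_interior A F (A v + t *: d) by rewrite -dE'; apply: h; rewrite t0'.
  by rewrite -/(par A F _) parz.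
- move=> i j s vi vj h; apply: (towards_gt0 towz); exact: (towards_gt0 tow0).
- move=> k s h; apply: (towards_gt0 towz); apply: (towards_gt0r tow0).
    exact: orientxx.
  by rewrite cE.
Qed.

End Partition.

(** * Recursive decompositions of an interval *)

Section Splits.
Local Open Scope nat_scope.
Context {m : nat} {C : eqType} (leaf : rel 'I_m)
  (ch : 'I_m -> 'I_m -> seq ('I_m * 'I_m)) (base : C)
  (cmb : 'I_m -> 'I_m -> 'I_m * 'I_m -> C -> C -> C).

Fixpoint splits_fuel n i j : seq C :=
  if n isn't n'.+1 then [::] else if leaf i j then [:: base] else
  [seq cmb i j bc xy.1 xy.2 | bc <- ch i j,
     xy <- [seq (x, y) | x <- splits_fuel n' i bc.1, y <- splits_fuel n' bc.2 j]].

(** Both kinds of subdivisions are built by the same recursion. An interval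
    that is not a leaf is split into [i, b] and [c, j] for some (b, c) in ch i j,
    and cmb assembles a decomposition of each into one of [i, j]. The fuel exceeds
    the length of the interval, which decreases. *)
Definition splits (i j : 'I_m) := splits_fuel (j - i).+1 i j.

Context (ch_gap : forall i j (b c : 'I_m), ~~ leaf i j -> (b, c) \in ch i j ->
  (b - i < j - i) && (j - c < j - i)).

Lemma splits_fuelE n (i j : 'I_m) : j - i < n -> splits_fuel n i j = splits i j.
Proof.
rewrite /splits; have [k le_k] := ubnP (j - i).
elim: k n i j le_k => // k IH [|n] i j //= le_k lt_n; case: ifPn => // nl.
apply: (f_equal flatten); apply/eq_in_map => -[b c] /(ch_gap nl) /andP[h1 h2] /=.
have fE (p q : 'I_m) : q - p < j - i -> splits_fuel n p q = splits_fuel (j - i) p q.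
  by move=> h; rewrite !IH //; lia.
by rewrite !fE.
Qed.

Lemma splitsE i j : splits i j = if leaf i j then [:: base] else
  [seq cmb i j bc xy.1 xy.2 | bc <- ch i j,
     xy <- [seq (x, y) | x <- splits i bc.1, y <- splits bc.2 j]].
Proof.
rewrite {1}/splits /=; case: ifPn => // nl.
apply: (f_equal flatten); apply/eq_in_map => -[b c] /(ch_gap nl) /andP[h1 h2] /=.
by rewrite !splits_fuelE.
Qed.

Lemma mem_splits i j t : ~~ leaf i j ->
  reflect (exists b c x y, [/\ (b, c) \in ch i j, x \in splits i b, y \in splits c j
    & t = cmb i j (b, c) x y]) (t \in splits i j).
Proof.
move=> nl; rewrite splitsE (negbTE nl).
apply: (iffP idP).
  move=> /allpairsPdep[[b c] [_ [h /allpairsP[[x y] /= [hx hy ->]] ->]]].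
  by exists b, c, x, y.
move=> [b [c [x [y [h hx hy ->]]]]]; apply/allpairsPdep.
exists (b, c), (x, y); split=> //.
by apply/allpairsP; exists (x, y).
Qed.

Lemma splits_ind (P : 'I_m -> 'I_m -> C -> Prop) :
  (forall i j, leaf i j -> P i j base) ->
  (forall i j b c x y, ~~ leaf i j -> (b, c) \in ch i j ->
    x \in splits i b -> y \in splits c j -> P i b x -> P c j y ->
    P i j (cmb i j (b, c) x y)) ->
  forall i j t, t \in splits i j -> P i j t.
Proof.
move=> Pl Pn i j; have [k le_k] := ubnP (j - i).
elim: k i j le_k => // k IH i j le_k t; have [lf|nl] := boolP (leaf i j).
  by rewrite splitsE lf inE => /eqP->; apply: Pl.
move=> /(mem_splits _ nl)[b [c [x [y [bc hx hy ->]]]]].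
by have /andP[h1 h2] := ch_gap nl bc; apply: Pn => //; apply: IH => //; lia.
Qed.

Lemma splits_leaf i j : leaf i j -> splits i j = [:: base].
Proof. by rewrite splitsE => ->. Qed.

Lemma size_splits i j : ~~ leaf i j ->
  size (splits i j) = \sum_(bc <- ch i j) size (splits i bc.1) * size (splits bc.2 j).
Proof.
move=> nl; rewrite splitsE (negbTE nl) size_allpairs_dep sumnE big_map.
by apply: eq_bigr => bc _; rewrite size_allpairs.
Qed.

(** The size of the list counts the decompositions when the assembled value
    determines its parts. *)
Lemma splits_uniq i j : (forall i j, uniq (ch i j)) ->
  (forall i j b c x y b' c' x' y', ~~ leaf i j ->
    (b, c) \in ch i j -> x \in splits i b -> y \in splits c j ->
    (b', c') \in ch i j -> x' \in splits i b' -> y' \in splits c' j ->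
    cmb i j (b, c) x y = cmb i j (b', c') x' y' -> [/\ (b, c) = (b', c'), x = x' & y = y']) ->
  uniq (splits i j).
Proof.
move=> uch inj; have [k le_k] := ubnP (j - i).
elim: k i j le_k => // k IH i j le_k; rewrite splitsE; case: ifPn => // nl.
apply: allpairs_uniq_dep => [//|[b c] /(ch_gap nl) /andP[h1 h2] /=|].
  apply: allpairs_uniq; [by apply: IH; lia|by apply: IH; lia|].
  by move=> [x y] [x' y'] _ _ [-> ->].
move=> p1 p2 /allpairsPdep[[b c] [xy [h /allpairsP[[x y] /= [hx hy ->]] ->]]].
move=> /allpairsPdep[[b' c'] [xy' [h' /allpairsP[[x' y'] /= [hx' hy' ->]] ->]]] /=.
move=> /(inj _ _ _ _ _ _ _ _ _ _ nl h hx hy h' hx' hy')[bcE xE yE].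
by rewrite bcE xE yE.
Qed.

End Splits.

(** * Triangles and crossing segments *)

Section Triangles.
Context {I : finType}.
Implicit Types (x y z : I) (s : seq I) (F : {set {set I}}).

Definition tri x y z : {set {set I}} := [set [set x; y]; [set y; z]; [set x; z]].

Lemma mem_tri e x y z : (e \in tri x y z) =
  [|| e == [set x; y], e == [set y; z] | e == [set x; z]].
Proof. by rewrite !inE orbA. Qed.

Lemma tri_swap12 x y z : tri x y z = tri y x z.
Proof.
apply/setP => e; rewrite !mem_tri (set2C y x).
by case: (e == [set x; y]); case: (e == [set y; z]); case: (e == [set x; z]).
Qed.

Lemma tri_swap23 x y z : tri x y z = tri x z y.
Proof.
apply/setP => e; rewrite !mem_tri (set2C z y).
by case: (e == [set x; y]); case: (e == [set y; z]); case: (e == [set x; z]).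
Qed.

Lemma tri_rot x y z : tri x y z = tri y z x.
Proof. by rewrite tri_swap12 tri_swap23. Qed.

Lemma cycle_edges3 x y z : uniq [:: x; y; z] -> cycle_edges [:: x; y; z] = tri x y z.
Proof.
rewrite /= !inE negb_or andbT => /andP[/andP[xy xz] yz]; apply/setP => e.
rewrite mem_tri; apply/imsetP/or3P => [[k]|].
  rewrite !inE => /or3P[]/eqP-> ->; rewrite /= !eqxx.
  - by apply: Or31.
  - by rewrite [y == x]eq_sym (negbTE xy); apply: Or32.
  - by rewrite [z == x]eq_sym (negbTE xz) [z == y]eq_sym (negbTE yz) set2C; apply: Or33.
case=> /eqP->; [exists x|exists y|exists z]; rewrite ?inE ?eqxx ?orbT //= ?eqxx //.
  by rewrite [y == x]eq_sym (negbTE xy).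
by rewrite [z == x]eq_sym (negbTE xz) [z == y]eq_sym (negbTE yz) set2C.
Qed.

Lemma tri_cycle x y z : uniq [:: x; y; z] -> is_cycle (tri x y z).
Proof. by move=> u; exists [:: x; y; z]; rewrite cycle_edges3. Qed.

Lemma cover_tri x y z : cover (tri x y z) = [set x; y; z].
Proof.
apply/setP => k; apply/bigcupP/idP => [[e]|].
  rewrite mem_tri => /or3P[]/eqP->; rewrite !inE; case: (k == x) => //=;
  by case: (k == y); rewrite ?orbT //= => ->.
rewrite !inE -orbA => /or3P[]/eqP->.
- by exists [set x; y]; rewrite ?mem_tri ?inE ?eqxx ?orbT.
- by exists [set x; y]; rewrite ?mem_tri ?inE ?eqxx ?orbT.
- by exists [set x; z]; rewrite ?mem_tri ?inE ?eqxx ?orbT.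
Qed.

Lemma cover_cycle_edges s : uniq s -> cover (cycle_edges s) = [set x in s].
Proof.
move=> us; apply/setP => k; rewrite inE; apply/bigcupP/idP => [[e /imsetP[x xs ->]]|ks].
  by rewrite !inE => /orP[]/eqP->; rewrite ?mem_next.
by exists [set k; next s k]; [apply/imsetP; exists k|rewrite !inE eqxx].
Qed.

Lemma card_cover_cycle_edges s : uniq s -> #|cover (cycle_edges s)| = size s.
Proof. by move=> us; rewrite cover_cycle_edges // cardsE; apply/card_uniqP. Qed.

Lemma cycle_tri F : is_cycle F -> #|cover F| = 3%N ->
  exists x y z, uniq [:: x; y; z] /\ F = tri x y z.
Proof.
move=> [s [_ us ->]]; rewrite card_cover_cycle_edges //.
case: s us => [|x [|y [|z [|]]]] // us _.
by exists x, y, z; rewrite cycle_edges3.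
Qed.

End Triangles.

Section TriangleGeometry.
Context {R : realType} {I : finType} (A : I -> 'rV[R]_2).
Implicit Types (x y w u v : I) (z g : 'rV[R]_2).
Local Notation oA i j z := (orient (A i) (A j) z).

Definition crossing x y u v :=
  oA u v (A x) * oA u v (A y) < 0 /\ oA x y (A u) * oA x y (A v) < 0.

Lemma mul_lt0_frac (a b : R) : a * b < 0 -> 0 < a / (a - b) < 1.
Proof.
move=> ab; have [a0|a0|a0] := ltgtP a 0; last by move: ab; rewrite a0 mul0r ltxx.
  have b0 : 0 < b by move: ab; rewrite nmulr_rlt0.
  by rewrite ltr_ndivlMr ?ltr_ndivrMr; lra.
have b0 : b < 0 by move: ab; rewrite pmulr_rlt0.
by rewrite ltr_pdivlMr ?ltr_pdivrMr; lra.
Qed.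

Lemma crossing_point x y u v : crossing x y u v -> exists t r : R,
  [/\ 0 < t < 1, 0 < r < 1 & A x + t *: (A y - A x) = A u + r *: (A v - A u)].
Proof.
move=> [h1 h2]; exists (oA u v (A x) / (oA u v (A x) - oA u v (A y))).
exists (oA x y (A u) / (oA x y (A u) - oA x y (A v))).
split; try exact: mul_lt0_frac.
have D1 : oA u v (A x) - oA u v (A y) != 0.
  by apply/eqP => /subr0_eq h; move: h1; rewrite h ltNge -expr2 sqr_ge0.
have D2 : oA x y (A u) - oA x y (A v) != 0.
  by apply/eqP => /subr0_eq h; move: h2; rewrite h ltNge -expr2 sqr_ge0.
by move: D1 D2; rewrite /orient => D1 D2; apply: rV2P; rewrite !mxE; field; rewrite D1 D2.
Qed.

(** The diagonals of a quadrilateral cut out four quadrants, each of which contains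
    the points close to the midpoint of one side. *)
Lemma crossing_quadrant x y u v (s1 s2 : R) : general_position A -> (2 < #|I|)%N ->
  crossing x y u v -> s1 != 0 -> s2 != 0 ->
  exists g, [/\ generic A g, 0 < s1 * oA x y g & 0 < s2 * oA u v g].
Proof.
move=> gp I3 [h1 h2] s10 s20.
have side (s a b : R) : s != 0 -> a * b < 0 -> 0 < s * a \/ 0 < s * b.
  move=> s0 ab; have [a0|a0|a0] := ltgtP a 0; last by move: ab; rewrite a0 mul0r ltxx.
    have b0 : 0 < b by move: ab; rewrite nmulr_rlt0.
    have [s_lt0|s_gt0|] := ltgtP s 0; last by move/eqP: s0.
      by left; rewrite nmulr_rgt0.
    by right; rewrite mulr_gt0.
  have b0 : b < 0 by move: ab; rewrite pmulr_rlt0.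
  have [s_lt0|s_gt0|] := ltgtP s 0; last by move/eqP: s0.
    by right; rewrite nmulr_rgt0.
  by left; rewrite mulr_gt0.
have [p [pxy puv]] : exists p, 0 < s1 * oA x y (A p) /\ oA u v (A p) = 0.
  by case: (side s1 _ _ s10 h2) => h; [exists u; rewrite orientxx|exists v; rewrite orientxy].
have [q [quv qxy]] : exists q, 0 < s2 * oA u v (A q) /\ oA x y (A q) = 0.
  by case: (side s2 _ _ s20 h1) => h; [exists x; rewrite orientxx|exists y; rewrite orientxy].
have [g gg _] := exists_generic_hull gp I3.
have [z [gz zt _]] := generic_towards (A p + 2^-1 *: (A q - A p)) gg.
exists z; split=> //; apply: (towards_gt0 zt); rewrite orient_lin ?qxy ?puv; lra.
Qed.

Lemma xor_tri x y w (f : {set I} -> bool) : uniq [:: x; y; w] ->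
  \xor_(e in tri x y w) f e = f [set x; y] (+) f [set y; w] (+) f [set x; w].
Proof.
rewrite /= !inE negb_or andbT => /andP[/andP[xy xw] yw].
rewrite /tri (setUC _ [set [set x; w]]) xor_setU1 ?xor_setU1 ?big_set1 1?addbC //.
  by rewrite inE; apply/eqP => /set2_inj[[xE _]|[xE _]]; [rewrite xE eqxx in xy|
    rewrite xE eqxx in xw].
rewrite !inE; apply/norP; split; apply/eqP => /set2_inj[[E1 E2]|[E1 E2]].
- by rewrite E2 eqxx in yw.
- by rewrite E1 eqxx in xy.
- by rewrite E1 eqxx in xy.
- by rewrite E1 eqxx in xw.
Qed.

Lemma par_tri x y w z : uniq [:: x; y; w] -> generic A z ->
  par A (tri x y w) z = inside_triangle A x y w z.
Proof.
move=> u gz; rewrite parE xor_tri // (set2C x w) triangle_parity //;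
move: u; rewrite /= !inE negb_or andbT => /andP[/andP[xy xw] yw]; apply: gz => //.
by rewrite eq_sym.
Qed.

(** At the points of the open side xy the orientations with respect to the two
    other sides have the sign that they have inside, and a small move keeps them;
    only the side of the line xy is to be checked. *)
Lemma tri_near x y w (t : R) g z : general_position A -> uniq [:: x; y; w] ->
  0 < t < 1 -> generic A z -> towards A (A x + t *: (A y - A x)) g z ->
  0 < oA x y (A w) * oA x y g -> par A (tri x y w) z.
Proof.
move=> gp u /andP[t0 t1] gz tow hg.
have D0 := gp _ _ _ u; have DD : 0 < oA x y (A w) * oA x y (A w).
  by rewrite -expr2 exprn_even_gt0.
have h1 : 0 < oA x y (A w) * oA x y z.
  by apply: (towards_gt0r tow) => //; rewrite orient_lin orientxx orientxy; lra.
have h2 : 0 < oA x y (A w) * oA y w z.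
  apply: (towards_gt0 tow); rewrite orient_lin orientxx mulr0 addr0 (orient_cyc (A x) (A y)).
  by rewrite mulrCA mulr_gt0 ?subr_gt0.
have h3 : 0 < oA x y (A w) * oA w x z.
  apply: (towards_gt0 tow); rewrite orient_lin orientxy mulr0 add0r -(orient_cyc (A w) (A x)).
  by rewrite mulrCA mulr_gt0.
rewrite par_tri // /inside_triangle; move: h1 h2 h3.
case: (ltgtP (oA x y (A w)) 0) D0 => // D _.
  by rewrite !nmulr_rgt0 // => /lt_gtF-> /lt_gtF-> /lt_gtF->.
by rewrite !pmulr_rgt0 // => -> -> ->.
Qed.

Lemma sgn_mul (x y : R) : x != 0 -> y != 0 -> (0 < x * y) = ((0 < x) == (0 < y)).
Proof.
move=> x0 y0; case: (ltgtP x 0) x0 => // hx _.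
  by rewrite nmulr_rgt0 //; case: (ltgtP y 0) y0.
by rewrite pmulr_rgt0 //; case: (ltgtP y 0) y0.
Qed.

(** The three orientations of z add up to that of the triangle, so that they cannot
    all have the opposite sign. *)
Lemma inside_trianglePos x y w z (s : R) : uniq [:: x; y; w] -> generic A z ->
  0 < s * oA x y (A w) -> inside_triangle A x y w z =
  [&& 0 < s * oA x y z, 0 < s * oA y w z & 0 < s * oA w x z].
Proof.
rewrite /= !inE !negb_or !andbT => /andP[/andP[xy xw] yw] gz D0.
have s0 : s != 0 by apply: contraTneq D0 => ->; rewrite mul0r ltxx.
have n1 : oA x y z != 0 by exact: gz.
have n2 : oA y w z != 0 by exact: gz.
have n3 : oA w x z != 0 by apply: gz; rewrite eq_sym.
have sum : 0 < s * (oA x y z + oA y w z + oA w x z) by rewrite orient_split.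
rewrite /inside_triangle; move: n1 n2 n3 sum.
set p := oA x y z; set q := oA y w z; set r := oA w x z.
move=> n1 n2 n3 sum; clearbody p q r.
rewrite !(sgn_mul s0) //; move: sum.
have [s1|s1|s1] := ltgtP s 0; last by rewrite s1 eqxx in s0.
  rewrite nmulr_rgt0 //; move: n1 n2 n3; case: (ltgtP p 0) => // ? _;
  by case: (ltgtP q 0) => // ? _; case: (ltgtP r 0) => // ? _; lra.
rewrite pmulr_rgt0 //; move: n1 n2 n3; case: (ltgtP p 0) => // ? _;
by case: (ltgtP q 0) => // ? _; case: (ltgtP r 0) => // ? _; lra.
Qed.

(** In general position the two lines meet only at their common end. *)
Lemma hull_pair_share x y w z : general_position A -> uniq [:: x; y; w] ->
  hull A [set x; y] z -> hull A [set x; w] z -> z = A x.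
Proof.
move=> gp u /hull_pair[t _ zE] /hull_pair[r _ zE'].
have := gp _ _ _ u; have : oA x y z = 0.
  by rewrite zE orient_lin orientxx orientxy !mulr0 addr0.
rewrite zE' orient_lin orientxx mulr0 add0r => /eqP; rewrite mulf_eq0.
by move=> /orP[/eqP->|/eqP->]; rewrite ?eqxx // scale0r addr0.
Qed.

Lemma tri_simple x y w : general_position A -> uniq [:: x; y; w] ->
  simple_polygon A (tri x y w).
Proof.
move=> gp u; split; first exact: tri_cycle.
have perms : [/\ uniq [:: y; x; w], uniq [:: x; w; y] & uniq [:: w; x; y]].
  move: u; rewrite /= !inE !negb_or !andbT => /andP[/andP[xy xw] yw].
  by rewrite [y == x]eq_sym [w == y]eq_sym [w == x]eq_sym xy xw yw.
case: perms => u1 u2 u3.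
have share a b c z : uniq [:: a; b; c] -> hull A [set a; b] z -> hull A [set a; c] z ->
    exists2 i, i \in [set a; b] :&: [set a; c] & z = A i.
  by move=> abc h1 h2; exists a; rewrite ?inE ?eqxx //; apply: (hull_pair_share gp abc h1 h2).
have share' a b c z : uniq [:: a; b; c] -> hull A [set a; c] z -> hull A [set a; b] z ->
    exists2 i, i \in [set a; c] :&: [set a; b] & z = A i.
  by rewrite setIC => abc h1 h2; apply: share.
move=> e f z; rewrite !mem_tri => /or3P[]/eqP-> /or3P[]/eqP-> => ef; rewrite ?eqxx // in ef *.
- by rewrite (set2C x y); apply: share.
- exact: share.
- by rewrite (set2C x y); apply: share'.
- by rewrite (set2C y w) (set2C x w); apply: share'.
- exact: share'.
- by rewrite (set2C y w) (set2C x w); apply: share.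
Qed.

End TriangleGeometry.

(** * Triangulations of a convex polygon *)

(** lia, after removal of the geometric hypotheses, which slow it down. *)
Ltac ord_lia :=
  repeat match goal with
  | H : context [@orient _] |- _ => clear H
  | H : context [@towards _] |- _ => clear H
  | H : context [@generic _] |- _ => clear H
  | H : context [@par _] |- _ => clear H
  | H : context [@set_of _] |- _ => clear H
  | H : context [@hull _] |- _ => clear H
  | H : context [@crossing _] |- _ => clear H
  | H : @eq (matrix _ _ _) _ _ |- _ => clear H
  | H : @sub_mem _ _ _ |- _ => clear H
  end; rewrite -?val_eqE /=; lia.

Lemma uniq_ltn3 m (x y w : 'I_m) : (x < y < w)%N -> uniq [:: x; y; w].
Proof. by move=> h; rewrite /= !inE !negb_or -!val_eqE /=; lia. Qed.

Lemma cycle_tri_sorted m (F : {set {set 'I_m}}) : is_cycle F -> #|cover F| = 3%N ->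
  exists x y w : 'I_m, (x < y < w)%N /\ F = tri x y w.
Proof.
move=> cF /(cycle_tri cF)[x [y [w [u ->]]]].
wlog xy : x y u / (x < y)%N.
  move=> W; have [|h|/val_inj h] := ltngtP x y; first exact: W.
    have [||a [b [c [abc E]]]] := W y x => //.
      by move: u; rewrite /= !inE !negb_or -!val_eqE /=; lia.
    by exists a, b, c; rewrite tri_swap12.
  by move: u; rewrite h /= inE eqxx.
have [yw|yw] := ltnP y w; first by exists x, y, w; rewrite xy.
have [xw|xw] := ltnP x w.
  exists x, w, y; rewrite tri_swap23; split=> //.
  by move: u; rewrite /= !inE !negb_or -!val_eqE /=; lia.
exists w, x, y; rewrite tri_swap23 tri_swap12; split=> //.
by move: u; rewrite /= !inE !negb_or -!val_eqE /=; lia.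
Qed.

Section ConvexPolygon.
Context {R : realType} {l : nat} (A : 'I_l.+3 -> 'rV[R]_2) (s : R).
Local Notation I := 'I_l.+3.
Local Notation oA i j z := (orient (A i) (A j) z).
Implicit Types (i j k a b c x y u v w : I) (z g : 'rV[R]_2).
Implicit Types (F G : {set {set I}}) (T : {set {set {set I}}}).
Context (convA : forall i j k, (i < j < k)%N -> 0 < s * oA i j (A k)).

Lemma conv_outside i j k : (i < j)%N -> (k < i)%N || (j < k)%N -> 0 < s * oA i j (A k).
Proof.
move=> ij /orP[ki|jk]; last by apply: convA; rewrite ij.
by rewrite (orient_cyc (A k)); apply: convA; rewrite ki.
Qed.

Lemma conv_between i j k : (i < k < j)%N -> s * oA i j (A k) < 0.
Proof.
move=> h; rewrite orientNr mulrN oppr_lt0; exact: convA.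
Qed.

Lemma conv_weak i j k : (i < j)%N -> (k <= i)%N || (j <= k)%N -> 0 <= s * oA i j (A k).
Proof.
move=> ij h; have [->|ki] := eqVneq k i; first by rewrite orientxx mulr0.
have [->|kj] := eqVneq k j; first by rewrite orientxy mulr0.
apply/ltW/conv_outside => //; move: ki kj; rewrite -!val_eqE /=; ord_lia.
Qed.

Lemma conv_gp : general_position A.
Proof.
have aux i j k : (i < j)%N -> uniq [:: i; j; k] -> oA i j (A k) != 0.
  rewrite /= !inE !negb_or -!val_eqE /= => ij u.
  have [h|h] := boolP (i < k < j)%N.
    by have := conv_between h; apply: contraTneq => ->; rewrite mulr0 ltxx.
  have : 0 < s * oA i j (A k) by apply: conv_outside => //; ord_lia.
  by apply: contraTneq => ->; rewrite mulr0 ltxx.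
move=> i j k u; have [ij|ji|/val_inj h] := ltngtP i j; first exact: aux.
  rewrite orientNl oppr_eq0; apply: aux => //.
  by move: u; rewrite /= !inE !negb_or -!val_eqE /=; ord_lia.
by move: u; rewrite h /= inE eqxx.
Qed.

Lemma card_gt2 : (2 < #|{: I}|)%N.
Proof. by rewrite card_ord. Qed.

Lemma conv_sign_neq0 : s != 0.
Proof.
have h : (@inord l.+2 0 < @inord l.+2 1 < @inord l.+2 2)%N by rewrite !inordK.
by apply: contraTneq (convA h) => ->; rewrite mul0r ltxx.
Qed.

Lemma par_tri_conv x y w z : (x < y < w)%N -> generic A z ->
  par A (tri x y w) z =
  [&& 0 < s * oA x y z, 0 < s * oA y w z & 0 < s * oA w x z].
Proof.
by move=> h gz; rewrite par_tri ?uniq_ltn3 // (inside_trianglePos (uniq_ltn3 h) gz (convA h)).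
Qed.

Lemma triangulation_tri T : triangulation A T -> [/\
  forall F, F \in T -> exists x y w, (x < y < w)%N /\ F = tri x y w,
  generic_partition A T & cover T = \bigcup_(F in T) F].
Proof.
have cyc F : triangle A F -> is_cycle F by move=> [[h _] _].
move=> /(polygonal_partitionP _ conv_gp card_gt2 cyc)[h1 h2 h3]; split=> //.
by move=> F /h1[[cF _] c3]; apply: cycle_tri_sorted.
Qed.

Lemma conv_crossing x u y v : (x < u < y)%N -> (y < v)%N -> crossing A x y u v.
Proof.
move=> h h'; have s0 := conv_sign_neq0; have ss : 0 < s * s by rewrite -expr2 exprn_even_gt0.
rewrite /crossing; split; rewrite -(pmulr_rlt0 _ ss) mulrACA.
  rewrite pmulr_rlt0; first by apply: conv_between; ord_lia.
  by apply: conv_outside; ord_lia.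
rewrite nmulr_rlt0; first by apply: conv_outside; ord_lia.
by apply: conv_between; ord_lia.
Qed.

Lemma tri_edge_apex F x y : (exists a b c, (a < b < c)%N /\ F = tri a b c) ->
  [set x; y] \in F -> exists w, uniq [:: x; y; w] /\ F = tri x y w.
Proof.
move=> [a [b [c [abc ->]]]]; rewrite mem_tri.
move: abc (uniq_ltn3 abc) => _ u.
have perms : [/\ uniq [:: b; c; a], uniq [:: a; c; b] & uniq [:: c; b; a]]
   /\ (uniq [:: c; a; b] /\ uniq [:: b; a; c]).
  by split; split; move: u; rewrite /= !inE !negb_or -!val_eqE /=; ord_lia.
move: perms => [[u1 u2 u3] [u4 u5]].
case/or3P => /eqP/set2_inj[[-> ->]|[-> ->]].
- by exists c.
- by exists c; rewrite tri_swap12.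
- by exists a; rewrite tri_rot.
- by exists a; rewrite (tri_swap12 c b) (tri_rot a).
- by exists b; rewrite tri_swap23.
- by exists b; rewrite (tri_rot c).
Qed.

(** Each of two crossing edges has its triangle on some side; the points of the
    quadrant common to both sides, close to the crossing point, lie in both
    triangles, which therefore coincide. A triangle has no crossing edges. *)
Lemma triangulation_nocross T x u y v : triangulation A T ->
  (x < u < y)%N -> (y < v)%N -> [set x; y] \in edges T -> [set u; v] \in edges T -> False.
Proof.
move=> /triangulation_tri[trT [_ dis] _] h h' /bigcupP[F FT xyF] /bigcupP[G GT uvG].
have [w [uF FE]] := tri_edge_apex (trT F FT) xyF.
have [w' [uG GE]] := tri_edge_apex (trT G GT) uvG.
have cr := conv_crossing h h'.
have [t [r [t01 r01 cE]]] := crossing_point cr.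
have D1 := conv_gp uF; have D2 := conv_gp uG.
have [g [gg g1 g2]] := crossing_quadrant conv_gp card_gt2 cr D1 D2.
have [z [gz tz _]] := generic_towards (A x + t *: (A y - A x)) gg.
have pF : par A F z by rewrite FE; apply: (tri_near conv_gp uF t01 gz tz).
have pG : par A G z by rewrite GE; apply: (tri_near conv_gp uG r01 gz _ g2); rewrite -cE.
have FG := dis z F G gz FT GT pF pG.
have : [set u; v] \subset cover F by rewrite FG; apply: (bigcup_sup [set u; v]).
rewrite FE cover_tri => /subsetP sub.
have /sub : u \in [set u; v] by rewrite !inE eqxx.
have /sub : v \in [set u; v] by rewrite !inE eqxx orbT.
have neq (p q : I) : (p < q)%N || (q < p)%N -> (p == q) = false.
  by move=> pq; ord_lia.
rewrite !inE (neq v x) ?(neq v y) ?(neq u x) ?(neq u y) /=; by clear -h h'; ord_lia.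
Qed.

Lemma tri_inside_ge0 a b c z i j : (a < b < c)%N -> generic A z ->
  par A (tri a b c) z ->
  (forall k, k \in [set a; b; c] -> 0 <= s * oA i j (A k)) -> 0 <= s * oA i j z.
Proof.
move=> abc gz; rewrite par_tri_conv // => /and3P[h1 h2 h3] pos.
apply: (@hull_orient_ge0 _ _ A [set a; b; c]) => //.
by apply: (@hull_triangle _ _ A _ a b c _ s); rewrite ?inE ?eqxx ?orbT ?ltW ?convA.
Qed.

(** A generic point z close to the midpoint of ij, on the side of the vertices
    between i and j, lies in some triangle. This triangle cannot cross ij, so that
    its vertices lie between i and j; if it did not have both i and j as vertices,
    a side of it would separate it from the midpoint. *)
Lemma triangulation_apex T i j : triangulation A T -> (i.+1 < j)%N ->
  [set i; j] \in edges T \/ (i = ord0 /\ j = ord_max) ->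
  exists b, (i < b < j)%N /\ tri i b j \in T.
Proof.
move=> trT ij ijE; have [tris [cov dis] _] := triangulation_tri trT.
have k0 : (i.+1 < l.+3)%N by apply: ltn_trans ij (ltn_ord j).
pose k : I := Ordinal k0.
have [g0 gg0 hg0] := exists_generic_hull conv_gp card_gt2.
have [g [gg tg hg]] := generic_towards_hull gg0 (hull_point A (in_setT k)) hg0.
pose m := A i + 2^-1 *: (A j - A i).
have hm : hull A setT m.
  by apply: hull_segment; [lra|exact: hull_point|exact: hull_point].
have [z [gz tz hz]] := generic_towards_hull gg hm hg.
have zneg : 0 < - s * oA i j z.
  apply: (towards_gt0r tz); first by rewrite /m orient_lin orientxx orientxy; lra.
  by apply: (towards_gt0 tg); rewrite mulNr oppr_gt0 conv_between //=; ord_lia.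
have [F FT pF] := cov z gz hz; have [a [b [c [abc FE]]]] := tris F FT.
rewrite FE in pF.
have edg p q : p \in [set a; b; c] -> q \in [set a; b; c] -> p != q -> [set p; q] \in edges T.
  move=> pF' qF' pq; apply/bigcupP; exists F => //; rewrite FE mem_tri.
  move: pF' qF' pq; rewrite !inE -!orbA => /or3P[]/eqP-> /or3P[]/eqP->;
  by rewrite ?eqxx // 1?(set2C b a) 1?(set2C c a) 1?(set2C c b) ?eqxx ?orbT.
have nomix p q : p \in [set a; b; c] -> q \in [set a; b; c] -> (i < p < j)%N ->
    (q < i)%N || (j < q)%N -> False.
  move=> pF' qF' hp hq; have pq : [set p; q] \in edges T.
    by apply: edg => //; ord_lia.
  case: ijE => [ijE|[i0 jN]]; last by move: hq; rewrite i0 jN /=; have := ltn_ord q; ord_lia.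
  case/orP: hq => hq; last by apply: (triangulation_nocross trT _ _ ijE pq); ord_lia.
  by rewrite set2C in pq; apply: (triangulation_nocross trT _ _ pq ijE); ord_lia.
have [/existsP[p /andP[pF' hp]]|/existsPn nb] :=
    boolP [exists p, (p \in [set a; b; c]) && (i < p < j)%N]; last first.
  have : 0 <= s * oA i j z.
    apply: (tri_inside_ge0 abc gz pF) => q qF; apply: conv_weak; first ord_lia.
    by move: (nb q); rewrite qF /=; ord_lia.
  by move: zneg; rewrite mulNr; lra.
have inij q : q \in [set a; b; c] -> (i <= q <= j)%N.
  move=> qF; rewrite -[_ && _]negbK; apply/negP => h; apply: (nomix p q pF' qF hp).
  by move: h; rewrite negb_and -!ltnNge.
have ha : (i <= a <= j)%N by apply: inij; rewrite !inE eqxx.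
have hc : (i <= c <= j)%N by apply: inij; rewrite !inE eqxx orbT.
have [ea|na] := eqVneq i a; last first.
  exfalso; have : 0 < s * oA a c z.
    apply: (towards_gt0 tz); rewrite /m orient_lin.
    have h1 : 0 < s * oA a c (A i).
      by apply: conv_outside; [ord_lia|move: na; ord_lia].
    have h2 : 0 <= s * oA a c (A j) by apply: conv_weak; ord_lia.
    by lra.
  by move: pF; rewrite par_tri_conv // (orientNl (A a) (A c)) => /and3P[_ _]; lra.
have [ec|nc] := eqVneq j c; last first.
  exfalso; have : 0 < s * oA a c z.
    apply: (towards_gt0 tz); rewrite /m orient_lin.
    have h1 : 0 < s * oA a c (A j).
      by apply: conv_outside; [ord_lia|move: nc; ord_lia].
    have h2 : 0 <= s * oA a c (A i) by apply: conv_weak; ord_lia.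
    by lra.
  by move: pF; rewrite par_tri_conv // (orientNl (A a) (A c)) => /and3P[_ _]; lra.
by exists b; rewrite ea ec abc -FE.
Qed.

End ConvexPolygon.

Section TriangulationCodes.
Context {l : nat} (W : {set 'I_l.+3}).
Local Notation I := 'I_l.+3.
Implicit Types (i j k a b c : I) (F : {set {set I}}) (T X Y : {set {set {set I}}}).

(** The label ord_max is that of q. In the triangle i b q the third vertex b becomes a
    neighbour of q, so it has to lie in W unless it is already one on the boundary. *)
Definition apex_allowed i j b :=
  (i < b < j)%N && ((j == ord_max) ==> (b \in W) || (b.+1 == j :> nat)).

Definition tri_choices i j := [seq (b, b) | b <- enum 'I_l.+3 & apex_allowed i j b].

Definition tri_join i j (bc : I * I) X Y := tri i bc.1 j |: (X :|: Y).

(** The triangulations of the polygon with vertices i, ..., j, built from the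
    third vertex b of the triangle at the edge ij and the triangulations of the
    polygons cut off by ib and bj. An edge ij with j = i + 1 cuts off nothing. *)
Definition tri_splits := splits (fun i j : I => (j <= i.+1)%N) tri_choices set0 tri_join.

Lemma mem_tri_choices i j b c :
  ((b, c) \in tri_choices i j) = (b == c) && apex_allowed i j b.
Proof.
apply/mapP/andP => [[b']|[/eqP<- h]]; last by exists b; rewrite // mem_filter h mem_enum.
by rewrite mem_filter => /andP[h _] [-> ->].
Qed.

Lemma tri_choices_gap i j b c : ~~ (j <= i.+1)%N -> (b, c) \in tri_choices i j ->
  ((b - i < j - i) && (j - c < j - i))%N.
Proof. by rewrite mem_tri_choices /apex_allowed => _ /andP[/eqP<-] /andP[h _]; lia. Qed.

Definition within T i j := [set F in T | cover F \subset [set k : I | i <= k <= j]]%N.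

Lemma cover_tri_within i j a b c : (a < b < c)%N ->
  (cover (tri a b c) \subset [set k : I | i <= k <= j]%N) = (i <= a)%N && (c <= j)%N.
Proof.
move=> h; rewrite cover_tri; apply/subsetP/idP => [sub|h' k].
  have := sub a; have := sub c; rewrite !inE !eqxx /= orbT => /(_ isT) h1 /(_ isT) h2.
  by lia.
by rewrite !inE -!val_eqE /=; lia.
Qed.

Lemma tri_splits_tri i j T : T \in tri_splits i j ->
  forall F, F \in T -> exists a b c, [/\ (i <= a < b)%N, (b < c <= j)%N & F = tri a b c].
Proof.
move: i j T; apply: (splits_ind tri_choices_gap) => [i j _ F|]; first by rewrite inE.
move=> i j b c X Y _; rewrite mem_tri_choices => /andP[/eqP<-] /andP[ibj _] _ _ IX IY F.
rewrite !inE /= => /or3P[/eqP->|/IX[a [b' [c' [h1 h2 ->]]]]|/IY[a [b' [c' [h1 h2 ->]]]]].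
- by exists i, b, j; split=> //; lia.
- by exists a, b', c'; split=> //; lia.
- by exists a, b', c'; split=> //; lia.
Qed.

Lemma tri_splits_within i b j X Y : (i < b < j)%N ->
  X \in tri_splits i b -> Y \in tri_splits b j ->
  let T := tri i b j |: (X :|: Y) in within T i b = X /\ within T b j = Y.
Proof.
move=> h hX hY; split; apply/setP => F; rewrite !inE.
  apply/andP/idP => [[/or3P[/eqP->|//|/(tri_splits_tri hY)[a [b' [c [h1 h2 ->]]]]]]|FX].
  - by rewrite cover_tri_within //; lia.
  - by rewrite cover_tri_within //; lia.
  - have [a [b' [c [h1 h2 FE]]]] := tri_splits_tri hX FX.
    by rewrite FX orbT; split=> //; rewrite FE cover_tri_within //; lia.
apply/andP/idP => [[/or3P[/eqP->|/(tri_splits_tri hX)[a [b' [c [h1 h2 ->]]]]|//]]|FY].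
- by rewrite cover_tri_within //; lia.
- by rewrite cover_tri_within //; lia.
- have [a [b' [c [h1 h2 FE]]]] := tri_splits_tri hY FY.
  by rewrite FY !orbT; split=> //; rewrite FE cover_tri_within //; lia.
Qed.

(** The third vertex b can be read off because the parts lie within [i, b] and [b, j],
    so that no other triangle contains both i and j. *)
Lemma tri_splits_uniq i j : uniq (tri_splits i j).
Proof.
apply: (splits_uniq tri_choices_gap) => {i j} [i j|].
  by rewrite map_inj_uniq => [|b b' []//]; apply: filter_uniq; apply: enum_uniq.
move=> i j b c X Y b' c' X' Y' _; rewrite !mem_tri_choices.
move=> /andP[/eqP<-] /andP[h _] hX hY /andP[/eqP<-] /andP[h' _] hX' hY' TE.
have bb : b = b'.
  have : tri i b j \in tri_join i j (b', b') X' Y' by rewrite -TE !inE eqxx.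
  have no (x y : I) U : (y < j)%N || (i < x)%N -> U \in tri_splits x y -> tri i b j \notin U.
    move=> xy hU; apply/negP => /(tri_splits_tri hU)[p [q [r [h1 h2 E]]]].
    have : cover (tri i b j) \subset [set k : I | x <= k <= y]%N.
      by rewrite E cover_tri_within //; ord_lia.
    by rewrite cover_tri_within //; ord_lia.
  rewrite !inE /= (negbTE (no _ _ _ _ hX')) ?(negbTE (no _ _ _ _ hY')); try ord_lia.
  rewrite !orbF => /eqP triE.
  have : b \in cover (tri i b' j) by rewrite -triE cover_tri !inE eqxx orbT.
  by rewrite cover_tri !inE -!val_eqE /= => hb; apply: val_inj => /=; ord_lia.
subst b'; move: TE; rewrite /tri_join /= => TE.
have [e1 e2] := tri_splits_within h hX hY.
have [e3 e4] := tri_splits_within h hX' hY'.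
by split=> //; [rewrite -e1 TE e3|rewrite -e2 TE e4].
Qed.

End TriangulationCodes.

Section ConvexCodes.
Context {R : realType} {l : nat} (A : 'I_l.+3 -> 'rV[R]_2) (s : R).
Local Notation I := 'I_l.+3.
Local Notation oA i j z := (orient (A i) (A j) z).
Context (convA : forall i j k : I, (i < j < k)%N -> 0 < s * oA i j (A k)).
Context (W : {set 'I_l.+3}).
Implicit Types (i j k a b c : I) (F G : {set {set I}}) (T X Y : {set {set {set I}}}).

(** The triangle at ij on the side of the vertices between exists, and since edges do
    not cross, the other triangles within [i, j] lie within [i, b] or [b, j]. *)
Lemma triangulation_code T : triangulation A T ->
  (forall i, i \in inner l -> [set ord_max; i] \in edges T -> i \in W) ->
  T \in tri_splits W ord0 ord_max.
Proof.
move=> trT TW; have [tris _ _] := triangulation_tri convA trT.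
have nc := triangulation_nocross convA trT.
have edge a b c x y : tri a b c \in T -> [set x; y] \in tri a b c -> [set x; y] \in edges T.
  by move=> FT xy; apply/bigcupP; exists (tri a b c).
suff main i j : (j <= i.+1)%N \/ [set i; j] \in edges T \/ (i = ord0 /\ j = ord_max) ->
    within T i j \in tri_splits W i j.
  have -> : T = within T ord0 ord_max; last by apply: main; right; right.
  apply/setP => F; rewrite inE; have [FT|//] := boolP (F \in T).
  by apply/esym/subsetP => k _; rewrite inE /= leq_ord.
have [n le_n] := ubnP (j - i); elim: n i j le_n => // n IH i j le_n ijE.
have [lf|nl] := leqP j i.+1.
  rewrite /tri_splits splits_leaf // ?inE; last exact: tri_choices_gap.
  apply/eqP/setP => F; rewrite !inE; apply/negbTE/negP => /andP[/tris[a [b [c [abc ->]]]]].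
  by rewrite cover_tri_within //; ord_lia.
have ijE' : [set i; j] \in edges T \/ (i = ord0 /\ j = ord_max).
  by case: ijE => //; ord_lia.
have [b [ibj bT]] := triangulation_apex convA trT nl ijE'.
have ibE : [set i; b] \in edges T by apply: (edge _ _ _ _ _ bT); rewrite mem_tri eqxx.
have bjE : [set b; j] \in edges T by apply: (edge _ _ _ _ _ bT); rewrite mem_tri eqxx orbT.
apply/mem_splits => //; first exact: tri_choices_gap.
  by rewrite -ltnNge.
exists b, b, (within T i b), (within T b j); split.
- rewrite mem_tri_choices eqxx /apex_allowed ibj /=; apply/implyP => /eqP jN.
  have [bl|bl] := boolP (b.+1 == j :> nat); first by rewrite orbT.
  rewrite orbF; apply: TW.
    by rewrite inE; move: bl ibj; rewrite jN /=; ord_lia.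
  by rewrite set2C -jN.
- by apply: IH; [ord_lia|right; left].
- by apply: IH; [ord_lia|right; left].
apply/setP => F; rewrite !inE /=; apply/andP/or3P => [[FT]|[/eqP->|/andP[FT]|/andP[FT]]].
- have [a [b' [c [abc FE]]]] := tris F FT; rewrite {1}FE cover_tri_within // => /andP[ia cj].
  have abE x y : [set x; y] \in tri a b' c -> [set x; y] \in edges T.
    by apply: edge; rewrite -FE.
  have acE : [set a; c] \in edges T by apply: abE; rewrite mem_tri eqxx !orbT.
  have ab'E : [set a; b'] \in edges T by apply: abE; rewrite mem_tri eqxx.
  have b'cE : [set b'; c] \in edges T by apply: abE; rewrite mem_tri eqxx orbT.
  have [ba|ab] := leqP b a.
    by apply: Or33; rewrite FT FE cover_tri_within //; ord_lia.
  have [cb|bc] := leqP c b.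
    by apply: Or32; rewrite FT FE cover_tri_within //; ord_lia.
  have ai : i = a.
    apply/eqP; apply: contraT => ai; case: (nc _ _ _ _ _ _ ibE acE); last by [].
    by move: ai; ord_lia.
  have cj' : j = c.
    apply/eqP; apply: contraT => cj'; case: (nc _ _ _ _ _ _ acE bjE).
      by ord_lia.
    by move: cj'; ord_lia.
  subst a c; apply: Or31; rewrite FE; have [bb|bb|/val_inj->//] := ltngtP b b'.
    by case: (nc _ _ _ _ _ _ ab'E bjE); ord_lia.
  by case: (nc _ _ _ _ _ _ ibE b'cE); ord_lia.
- by split; rewrite // cover_tri_within // !leqnn.
- by move=> h; rewrite FT; split=> //; apply: subset_trans h _; apply/subsetP => k;
    rewrite !inE; ord_lia.
- by move=> h; rewrite FT; split=> //; apply: subset_trans h _; apply/subsetP => k;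
    rewrite !inE; ord_lia.
Qed.


Implicit Types z : 'rV[R]_2.

Lemma generic_gt0 i j z : generic A z -> i != j -> 0 <= s * oA i j z -> 0 < s * oA i j z.
Proof.
move=> gz ij h; rewrite lt_def h andbT mulf_neq0 ?gz //; exact: (conv_sign_neq0 convA).
Qed.

(** A point behind ij that is in front of all the sides of the polygon is behind ib, or
    behind bj, or in the triangle ibj. *)
Lemma tri_splits_cover i j T : T \in tri_splits W i j -> (i < j)%N ->
  forall z, generic A z -> s * oA i j z < 0 ->
  (forall k k', (i <= k)%N -> k' = k.+1 :> nat -> (k' <= j)%N -> 0 < s * oA k k' z) ->
  exists2 F, F \in T & par A F z.
Proof.
move: i j T; apply: (splits_ind (@tri_choices_gap _ W)) => [i j ji ij z gz h1 h2|].
  have : 0 < s * oA i j z by apply: h2 => //; lia.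
  by lra.
move=> i j b c X Y nl; rewrite mem_tri_choices => /andP[/eqP<-] /andP[ibj _] _ _ IX IY.
move=> ij z gz h1 h2; have /andP[ib bj] := ibj.
have nib : i != b by rewrite -val_eqE /=; lia.
have nbj : b != j by rewrite -val_eqE /=; lia.
have [h3|h3] := ltP (s * oA i b z) 0.
  have [|F FX pF] := IX ib z gz h3; last by exists F; rewrite // !inE FX orbT.
  by move=> k k' k1 k2 k3; apply: h2 => //; lia.
have [h4|h4] := ltP (s * oA b j z) 0.
  have [|F FY pF] := IY bj z gz h4; last by exists F; rewrite // !inE FY !orbT.
  by move=> k k' k1 k2 k3; apply: h2 => //; lia.
exists (tri i b j); rewrite ?inE ?eqxx // (par_tri_conv convA) //.
apply/and3P; split; [exact: generic_gt0|exact: generic_gt0|].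
by rewrite (orientNl (A i)) mulrN oppr_gt0.
Qed.

Lemma tri_inside_le0 a b c z i j : (i < j)%N -> (a < b < c)%N -> generic A z ->
  par A (tri a b c) z -> (i <= a)%N -> (c <= j)%N -> s * oA i j z <= 0.
Proof.
move=> ij abc gz pz ia cj; rewrite -oppr_ge0 -mulrN -orientNl.
apply: (tri_inside_ge0 convA abc gz pz) => k; rewrite !inE => kabc.
rewrite orientNl mulrN oppr_ge0; have [->|ki] := eqVneq k i; first by rewrite orientxx mulr0.
have [->|kj] := eqVneq k j; first by rewrite orientxy mulr0.
apply/ltW/(conv_between convA); move: kabc ki kj; rewrite -!val_eqE /=.
by clear -ia cj abc; lia.
Qed.

(** The lines ib and bj separate the triangle ibj from the two parts, and the two parts
    from each other. *)
Lemma tri_splits_disjoint i j T : T \in tri_splits W i j ->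
  forall z F G, generic A z -> F \in T -> G \in T -> par A F z -> par A G z -> F = G.
Proof.
move: i j T; apply: (splits_ind (@tri_choices_gap _ W)) => [i j ji z F G _|].
  by rewrite inE.
move=> i j b c X Y nl; rewrite mem_tri_choices => /andP[/eqP<-] /andP[ibj _] hX hY IX IY.
move=> z F G gz; have /andP[ib bj] := ibj.
have pos (p q : I) : (p < q)%N -> s * oA p q z <= 0 -> 0 <= s * oA p q z -> False.
  move=> pq h1 h2; have : 0 < s * oA p q z by apply: generic_gt0 => //; rewrite -val_eqE /=; lia.
  by lra.
have inX H : H \in X -> par A H z -> s * oA i b z <= 0 /\ 0 <= s * oA b j z.
  move=> /(tri_splits_tri hX)[a [b' [c' [h1 h2 ->]]]] pz.
  have abc : (a < b' < c')%N by lia.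
  split; first by apply: (tri_inside_le0 ib abc gz pz); lia.
  apply: (tri_inside_ge0 convA abc gz pz) => k; rewrite !inE => kabc.
  apply: (conv_weak convA) => //; move: kabc; rewrite -!val_eqE /=; clear -h1 h2; lia.
have inY H : H \in Y -> par A H z -> s * oA b j z <= 0 /\ 0 <= s * oA i b z.
  move=> /(tri_splits_tri hY)[a [b' [c' [h1 h2 ->]]]] pz.
  have abc : (a < b' < c')%N by lia.
  split; first by apply: (tri_inside_le0 bj abc gz pz); lia.
  apply: (tri_inside_ge0 convA abc gz pz) => k; rewrite !inE => kabc.
  apply: (conv_weak convA) => //; move: kabc; rewrite -!val_eqE /=; clear -h1 h2; lia.
have inT : par A (tri i b j) z -> 0 <= s * oA i b z /\ 0 <= s * oA b j z.
  by rewrite (par_tri_conv convA) // => /and3P[h1 h2 _]; split; apply: ltW.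
rewrite !inE /= => /or3P[/eqP->|FX|FY] /or3P[/eqP->|GX|GY] pF pG //.
- by case: (inT pF) (inX _ GX pG) => h1 h2 [h3 h4]; case: (pos i b).
- by case: (inT pF) (inY _ GY pG) => h1 h2 [h3 h4]; case: (pos b j).
- by case: (inT pG) (inX _ FX pF) => h1 h2 [h3 h4]; case: (pos i b).
- exact: IX pF pG.
- by case: (inX _ FX pF) (inY _ GY pG) => h1 h2 [h3 h4]; case: (pos i b).
- by case: (inT pG) (inY _ FY pF) => h1 h2 [h3 h4]; case: (pos b j).
- by case: (inX _ GX pG) (inY _ FY pF) => h1 h2 [h3 h4]; case: (pos i b).
- exact: IY pF pG.
Qed.

Lemma tri_splits_vertices i j T : T \in tri_splits W i j -> (i.+1 < j)%N ->
  forall k, (i <= k <= j)%N -> exists2 F, F \in T & k \in cover F.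
Proof.
move: i j T; apply: (splits_ind (@tri_choices_gap _ W)) => [i j ji|]; first by lia.
move=> i j b c X Y nl; rewrite mem_tri_choices => /andP[/eqP<-] /andP[ibj _] hX hY IX IY.
move=> _ k ikj.
have [kv|] := boolP (k \in [set i; b; j]).
  by exists (tri i b j); rewrite ?inE ?eqxx // cover_tri.
rewrite !inE !negb_or -!val_eqE /= => kv; have [kb|bk] := leqP k b.
  have [||F FX kF] := IX _ k; [by clear -kv kb ikj; lia|by clear -kv kb ikj; lia|].
  by exists F; rewrite // !inE FX orbT.
have [||F FY kF] := IY _ k; [by clear -kv bk ikj; lia|by clear -kv bk ikj; lia|].
by exists F; rewrite // !inE FY !orbT.
Qed.

Lemma tri_splits_edges i j T : T \in tri_splits W i j -> (i < j)%N ->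
  forall k F, F \in T -> [set ord_max; k] \in F ->
  [|| k == i, k.+1 == l.+2 | k \in W].
Proof.
move: i j T; apply: (splits_ind (@tri_choices_gap _ W)) => [i j _ _ k F|].
  by rewrite inE.
move=> i j b c X Y nl; rewrite mem_tri_choices => /andP[/eqP<-] /andP[ibj okb] hX hY IX IY.
move=> ij k F; have bN : ord_max != b.
  by have := ltn_ord j; rewrite -val_eqE /=; clear -ibj; lia.
have iN : ord_max != i by have := ltn_ord j; rewrite -val_eqE /=; clear -ij; lia.
have okb' : j = ord_max -> (b.+1 == l.+2) || (b \in W).
  by move=> jN; move: okb; rewrite jN eqxx /= orbC.
rewrite !inE /= => /or3P[/eqP->|FX|FY].
- rewrite mem_tri => /or3P[]/eqP/set2_inj[[NE ->]|[NE ->]];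
  rewrite ?NE ?eqxx // in bN iN *; by rewrite okb' ?orbT.
- move=> NkF; have : ord_max \in cover F.
    by apply/bigcupP; exists [set ord_max; k]; rewrite // !inE eqxx.
  have [a [b' [c' [h1 h2 ->]]]] := tri_splits_tri hX FX.
  by have := ltn_ord j; rewrite cover_tri !inE -!val_eqE /=; clear -h1 h2 ibj; lia.
- move=> NkF; have jN : j = ord_max.
    have : ord_max \in cover F.
      by apply/bigcupP; exists [set ord_max; k]; rewrite // !inE eqxx.
    have [a [b' [c' [h1 h2 ->]]]] := tri_splits_tri hY FY.
    have := ltn_ord j; rewrite cover_tri !inE -!val_eqE /= => jl; clear -h1 h2 jl => h.
    by apply: val_inj => /=; lia.
  have bj : (b < j)%N by case/andP: ibj.
  case/or3P: (IY bj k F FY NkF) => [/eqP->|->|->]; rewrite ?orbT //.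
  by rewrite okb' ?orbT.
Qed.

Lemma code_triangulation T : T \in tri_splits W ord0 ord_max ->
  triangulation A T /\
  (forall i, i \in inner l -> [set ord_max; i] \in edges T -> i \in W).
Proof.
move=> hT; have gp := conv_gp convA; have I3 := card_gt2 (l := l).
have trF F : F \in T -> exists a b c, (a < b < c)%N /\ F = tri a b c.
  by move=> /(tri_splits_tri hT)[a [b [c [h1 h2 ->]]]]; exists a, b, c; split=> //; lia.
split; last first.
  move=> i; rewrite inE => h /bigcupP[F FT NiF].
  have := tri_splits_edges hT isT FT NiF; rewrite -val_eqE /=; case: (i \in W) => //.
  by clear -h; lia.
apply/polygonal_partitionP => //; first by move=> F [[h _] _].
split=> [F /trF[a [b [c [abc ->]]]]||].
- split; first exact: tri_simple (uniq_ltn3 abc).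
  rewrite /vertices cover_tri setUC cardsU1 cards2 !inE negb_or.
  have := uniq_ltn3 abc; rewrite /= !inE negb_or andbT => /andP[/andP[ab ac] bc].
  by rewrite ab [c == a]eq_sym [c == b]eq_sym ac bc.
- split; last exact: tri_splits_disjoint hT.
  move=> z gz hz; apply: (tri_splits_cover hT) => //.
    have : 0 < - s * oA ord0 ord_max z.
      rewrite mulNr -mulrN -orientNl; apply: generic_gt0 => //.
      apply: (hull_orient_ge0 hz) => k _; rewrite orientNl mulrN oppr_ge0.
      have [->|k0] := eqVneq k ord0; first by rewrite orientxx mulr0.
      have [->|kN] := eqVneq k ord_max; first by rewrite orientxy mulr0.
      apply/ltW/(conv_between convA); have := ltn_ord k.
      by move: k0 kN; rewrite -!val_eqE /=; clear; lia.
    by rewrite mulNr oppr_gt0.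
  move=> k k' _ kk' _; apply: generic_gt0 => //; first by rewrite -val_eqE /=; lia.
  by apply: (hull_orient_ge0 hz) => j _; apply: (conv_weak convA); lia.
- apply/setP => k; rewrite inE; apply/bigcupP.
  have [||F FT kF] := tri_splits_vertices hT _ (k := k) => //; last by exists F.
  exact: leq_ord.
Qed.

End ConvexCodes.

(** * The geometry of a single chain *)

(** The label N of the tip p is ord_max, called the apex, and the other labels form the
    chain. The sign s is the sense of rotation in which the apex sees the chain
    in the order 0, ..., l + 1; the chain, seen from the apex, bulges towards it.
    The apex is thought of as lying above the chain, and above the edge xy means on
    the side of the apex. *)
Section ChainGeometry.
Context {R : realType} {l : nat} (A : 'I_l.+3 -> 'rV[R]_2) (s : R).
Local Notation I := 'I_l.+3.
Local Notation N := (@ord_max l.+2).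
Local Notation oA i j z := (orient (A i) (A j) z).
Implicit Types (i j k x y u v w : I) (z g c : 'rV[R]_2).
Implicit Types (e : {set I}) (F G : {set {set I}}) (T : {set {set {set I}}}).
Context (gp : general_position A)
  (apexA : forall i j, (i < j < l.+2)%N -> 0 < s * oA N i (A j))
  (chainA : forall i j k, (i < j < k)%N -> (k < l.+2)%N -> s * oA i j (A k) < 0).

Lemma neqN k : (k != N) = (k < l.+2)%N.
Proof. by rewrite -val_eqE /=; have := ltn_ord k; lia. Qed.

Lemma apex_lt i j : (j < i < l.+2)%N -> s * oA N i (A j) < 0.
Proof. by move=> h; rewrite orientNr mulrN oppr_lt0 apexA. Qed.

Lemma apex_ge i j : (i <= j < l.+2)%N -> 0 <= s * oA N i (A j).
Proof.
rewrite leq_eqVlt => /andP[/orP[/eqP/val_inj->|ij] jl]; first by rewrite orientxy mulr0.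
by rewrite ltW // apexA ?ij.
Qed.

Lemma apex_le i j : (j <= i < l.+2)%N -> s * oA N i (A j) <= 0.
Proof.
rewrite leq_eqVlt => /andP[/orP[/eqP/val_inj->|ij] jl]; first by rewrite orientxy mulr0.
by rewrite ltW // apex_lt ?ij.
Qed.

Lemma chord_apex x y : (x < y < l.+2)%N -> 0 < s * oA x y (A N).
Proof. by move=> h; rewrite orient_cyc; apply: apexA. Qed.

Lemma chord_between x y k : (x < k < y)%N -> (y < l.+2)%N -> 0 < s * oA x y (A k).
Proof. by move=> h h'; rewrite orientNr mulrN oppr_gt0 chainA. Qed.

Lemma chord_outside x y k : (x < y < l.+2)%N -> (k < l.+2)%N ->
  (k < x)%N || (y < k)%N -> s * oA x y (A k) < 0.
Proof.
move=> h kl /orP[kx|yk]; last by apply: chainA; lia.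
by rewrite (orient_cyc (A k)); apply: chainA; lia.
Qed.

Lemma chord_between_ge x y k : (x <= k <= y)%N -> (x < y < l.+2)%N -> 0 <= s * oA x y (A k).
Proof.
move=> h h'; have [->|kx] := eqVneq k x; first by rewrite orientxx mulr0.
have [->|ky] := eqVneq k y; first by rewrite orientxy mulr0.
by rewrite ltW // chord_between //; move: kx ky; rewrite -!val_eqE /=; lia.
Qed.

Lemma chord_outside_le x y k : (x < y < l.+2)%N -> (k < l.+2)%N ->
  (k <= x)%N || (y <= k)%N -> s * oA x y (A k) <= 0.
Proof.
move=> h h' h''; have [->|kx] := eqVneq k x; first by rewrite orientxx mulr0.
have [->|ky] := eqVneq k y; first by rewrite orientxy mulr0.
by rewrite ltW // chord_outside //; move: kx ky; rewrite -!val_eqE /=; lia.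
Qed.

Lemma apex_sign_neq0 : s != 0.
Proof.
have h : (@inord l.+2 0 < @inord l.+2 1 < l.+2)%N by rewrite !inordK.
by apply: contraTneq (apexA h) => ->; rewrite mul0r ltxx.
Qed.

Lemma towards_lt0 z g z' i j : towards A z g z' -> s * oA i j z < 0 -> s * oA i j z' < 0.
Proof.
by move=> tow h; rewrite -oppr_gt0 -mulNr (towards_gt0 tow) // mulNr oppr_gt0.
Qed.

(** The triangle spanned by the apex and the edge xy, as seen by generic points. *)
Definition below_apex x y z := [&& 0 < s * oA N x z, s * oA N y z < 0 & 0 < s * oA x y z].

Lemma fan_parity_chord x y z : (x < y < l.+2)%N -> generic A z ->
  fan_parity A N z [set x; y] = below_apex x y z.
Proof.
move=> h gz; have xN : x != N by rewrite neqN; lia.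
have yN : y != N by rewrite neqN; lia.
have xy : x != y by rewrite -val_eqE /=; lia.
rewrite fan_parityE // (@inside_trianglePos _ _ _ _ _ _ _ s) //; last exact: apexA.
  by rewrite /below_apex (orientNl (A N) (A y)) mulrN oppr_gt0 [X in _ && X]andbC.
by rewrite /= !inE negb_or ![N == _]eq_sym xN yN xy.
Qed.

Lemma fan_parity_N x z : x != N -> fan_parity A N z [set N; x] = false.
Proof. exact: fan_parity_apex. Qed.

(** The edges of the chain that are met by the rays from the apex in all the
    directions between x and y. *)
Definition spans x y e := [exists u : I, exists v : I,
  [&& (u < v)%N, (v < l.+2)%N, e == [set u; v], (u <= x)%N & (y <= v)%N]].

Lemma spansE x y u v : (u < v < l.+2)%N -> spans x y [set u; v] = (u <= x)%N && (y <= v)%N.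
Proof.
move=> uv; apply/existsP/idP => [[a /existsP[b /and5P[ab bl /eqP/set2_inj]]]|h].
  by move=> [[-> ->] h1 h2|[ea eb]]; [rewrite h1|move: ab uv; rewrite ea eb; lia].
by exists u; apply/existsP; exists v; rewrite eqxx; case/andP: uv => -> ->.
Qed.

Lemma spans_N x y u : spans x y [set N; u] = false.
Proof.
apply/negbTE/existsP => -[a /existsP[b /and5P[ab bl /eqP/set2_inj]]].
by move=> [[Na _]|[Nb _]]; [move: ab bl; rewrite -Na /=|move: bl; rewrite -Nb /=]; lia.
Qed.

(** By the fan formula, the parity of F at the points just above the edge xy, which, if
    no edge crosses xy, see below them exactly the edges that span [x, y]. *)
Definition up F x y := \xor_(e in F) spans x y e.

Lemma cycle_edgeP F e : is_cycle F -> e \in F ->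
  (exists2 k : I, (k < l.+2)%N & e = [set N; k]) \/
  (exists x y : I, (x < y < l.+2)%N /\ e = [set x; y]).
Proof.
move=> cF /(cycle_edge2 cF)[x [y [xy ->]]].
have [xN|xN] := eqVneq x N.
  by left; exists y; rewrite -?neqN -xN // eq_sym.
have [yN|yN] := eqVneq y N.
  by left; exists x; rewrite -?neqN -yN // set2C.
rewrite !neqN in xN yN; right; have [h|h|/val_inj h] := ltngtP x y.
- by exists x, y; rewrite h.
- by exists y, x; rewrite h set2C.
- by rewrite h eqxx in xy.
Qed.

(** By convexity of the chain, no edge of F crosses the segment xy. *)
Definition uncrossed F x y := forall u v : I, (u < v < l.+2)%N -> [set u; v] \in F ->
  ~~ ((x < u < y)%N && (y < v)%N) /\ ~~ ((u < x < v)%N && (v < y)%N).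

Lemma convex_pos (t a b : R) : 0 < t < 1 -> 0 <= a -> 0 <= b -> 0 < a + b ->
  0 < (1 - t) * a + t * b.
Proof.
move=> /andP[t0 t1] a0 b0 ab; have [a1|a1] := eqVneq a 0.
  by rewrite a1 mulr0 add0r mulr_gt0 //; lra.
have : 0 < (1 - t) * a by rewrite mulr_gt0 ?subr_gt0 // lt_def a1.
by have : 0 <= t * b; [rewrite mulr_ge0 // ltW|lra].
Qed.

(** An edge uv that does not cross xy lies below the point z close to the open
    segment xy exactly when it spans [x, y]; for the edge xy itself this depends on
    the side of z. *)
Lemma below_apex_near x y (t : R) g z u v : (x < y < l.+2)%N -> 0 < t < 1 ->
  generic A z -> towards A (A x + t *: (A y - A x)) g z -> (u < v < l.+2)%N ->
  ~~ ((x < u < y)%N && (y < v)%N) -> ~~ ((u < x < v)%N && (v < y)%N) ->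
  below_apex u v z =
    [&& (u <= x)%N, (y <= v)%N & ([set u; v] == [set x; y]) ==> (0 < s * oA x y g)].
Proof.
move=> xy t01 gz tow uv nc1 nc2.
have comb i j : s * oA i j (A x + t *: (A y - A x)) =
    (1 - t) * (s * oA i j (A x)) + t * (s * oA i j (A y)).
  by rewrite orient_lin; ring.
have pos i j : 0 <= s * oA i j (A x) -> 0 <= s * oA i j (A y) ->
    0 < s * oA i j (A x) + s * oA i j (A y) -> 0 < s * oA i j z.
  by move=> h1 h2 h3; apply: (towards_gt0 tow); rewrite comb convex_pos.
have neg i j : s * oA i j (A x) <= 0 -> s * oA i j (A y) <= 0 ->
    s * oA i j (A x) + s * oA i j (A y) < 0 -> s * oA i j z < 0.
  move=> h1 h2 h3; apply: (towards_lt0 tow); rewrite comb.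
  by have := @convex_pos t (- (s * oA i j (A x))) (- (s * oA i j (A y))) t01; lra.
rewrite /below_apex; have [ux|ux] := leqP u x; last first.
  have [yu|uy] := leqP y u.
    have -> : (0 < s * oA N u z) = false.
      apply/negbTE; rewrite -leNgt ltW //; apply: neg.
      - by apply: apex_le; lia.
      - by apply: apex_le; lia.
      - have : s * oA N u (A x) < 0 by apply: apex_lt; lia.
        by have : s * oA N u (A y) <= 0; [apply: apex_le; lia|lra].
    by [].
  have vy : (v <= y)%N by lia.
  have -> : (0 < s * oA u v z) = false; last by rewrite !andbF.
  apply/negbTE; rewrite -leNgt ltW //; apply: neg.
  - by apply: chord_outside_le; lia.
  - by apply: chord_outside_le; lia.
  - have : s * oA u v (A x) < 0 by apply: chord_outside; lia.
    by have : s * oA u v (A y) <= 0; [apply: chord_outside_le; lia|lra].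
have [yv|vy] := leqP y v; last first.
  have [vx|xv] := leqP v x.
    have -> : (s * oA N v z < 0) = false; last by rewrite andbF.
    apply/negbTE; rewrite -leNgt ltW //; apply: pos.
    - by apply: apex_ge; lia.
    - by apply: apex_ge; lia.
    - have : 0 <= s * oA N v (A x) by apply: apex_ge; lia.
      by have : 0 < s * oA N v (A y); [apply: apexA; lia|lra].
  have -> : (0 < s * oA u v z) = false; last by rewrite !andbF.
  apply/negbTE; rewrite -leNgt ltW //; apply: neg.
  - by apply: chord_outside_le; lia.
  - by apply: chord_outside_le; lia.
  - have : s * oA u v (A x) <= 0 by apply: chord_outside_le; lia.
    by have : s * oA u v (A y) < 0; [apply: chord_outside; lia|lra].
have -> : 0 < s * oA N u z.
  apply: pos; [by apply: apex_ge; lia|by apply: apex_ge; lia|].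
  have : 0 <= s * oA N u (A x) by apply: apex_ge; lia.
  by have : 0 < s * oA N u (A y); [apply: apexA; lia|lra].
have -> : s * oA N v z < 0.
  apply: neg; [by apply: apex_le; lia|by apply: apex_le; lia|].
  have : s * oA N v (A x) < 0 by apply: apex_lt; lia.
  by have : s * oA N v (A y) <= 0; [apply: apex_le; lia|lra].
rewrite /=; have [/set2_inj[[-> ->]|[eu ev]]|ne] := eqVneq; last 2 first.
- by move: uv xy; rewrite eu ev; lia.
- apply: pos; [by apply: chord_between_ge; lia|by apply: chord_between_ge; lia|].
  have h1 : 0 <= s * oA u v (A x) by apply: chord_between_ge; lia.
  have h2 : 0 <= s * oA u v (A y) by apply: chord_between_ge; lia.
  have [ux'|xu] := ltnP u x.
    by have : 0 < s * oA u v (A x) by [apply: chord_between; lia]; lra.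
  have yv' : (y < v)%N.
    rewrite ltn_neqAle yv andbT; apply: contra ne => /eqP/val_inj yv'.
    by rewrite yv' (_ : u = x) //; apply: val_inj => /=; lia.
  by have : 0 < s * oA u v (A y) by [apply: chord_between; lia]; lra.
rewrite implyTb.
have o0 : oA x y (A x + t *: (A y - A x)) = 0.
  by rewrite orient_lin orientxx orientxy !mulr0 addr0.
by have := tow x y; rewrite /lexsg o0 eqxx -(sgr_gt0 (s * _)) sgrM => ->; rewrite -sgrM sgr_gt0.
Qed.

End ChainGeometry.

(** * Faces at points close to the edges and to the apex *)

Section ChainPoints.
Context {R : realType} {l : nat} (A : 'I_l.+3 -> 'rV[R]_2) (s : R).
Local Notation I := 'I_l.+3.
Local Notation N := (@ord_max l.+2).
Local Notation oA i j z := (orient (A i) (A j) z).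
Implicit Types (i j k x y u v w : I) (z g c : 'rV[R]_2).
Implicit Types (e : {set I}) (F G : {set {set I}}) (T : {set {set {set I}}}).
Context (gp : general_position A)
  (apexA : forall i j, (i < j < l.+2)%N -> 0 < s * oA N i (A j))
  (chainA : forall i j k, (i < j < k)%N -> (k < l.+2)%N -> s * oA i j (A k) < 0).

(** The fan formula, with the triangles of the fan evaluated next to the edge xy. *)
Lemma par_near_edge F x y (t : R) g z : is_cycle F -> uncrossed F x y ->
  (x < y < l.+2)%N -> 0 < t < 1 ->
  generic A z -> towards A (A x + t *: (A y - A x)) g z ->
  par A F z = \xor_(e in F) (spans x y e && ((e == [set x; y]) ==> (0 < s * oA x y g))).
Proof.
move=> cF uc xy t01 gz tow; rewrite (par_fan _ _ N) //; apply: eq_bigr => e eF.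
have [[k kN ->]|[u [v [uv eE]]]] := cycle_edgeP cF eF.
  by rewrite spans_N fan_parity_N // neqN.
rewrite {}eE in eF *; have [nc1 nc2] := uc u v uv eF.
by rewrite (fan_parity_chord apexA) // (below_apex_near apexA chainA xy t01 gz tow) //
   spansE // andbA.
Qed.

Lemma par_above F x y (t : R) g z : is_cycle F -> uncrossed F x y ->
  (x < y < l.+2)%N -> 0 < t < 1 ->
  generic A z -> towards A (A x + t *: (A y - A x)) g z -> 0 < s * oA x y g ->
  par A F z = up F x y.
Proof.
move=> cF uc xy t01 gz tow gpos; rewrite (par_near_edge cF uc xy t01 gz tow).
by apply: eq_bigr => e _; rewrite gpos implybT andbT.
Qed.

Lemma par_below F x y (t : R) g z : is_cycle F -> uncrossed F x y ->
  (x < y < l.+2)%N -> 0 < t < 1 ->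
  generic A z -> towards A (A x + t *: (A y - A x)) g z -> s * oA x y g < 0 ->
  par A F z = up F x y (+) ([set x; y] \in F).
Proof.
move=> cF uc xy t01 gz tow gneg; rewrite (par_near_edge cF uc xy t01 gz tow).
have -> : (0 < s * oA x y g) = false by apply/negbTE; rewrite -leNgt ltW.
have -> : ([set x; y] \in F) = \xor_(e in F) (e == [set x; y]).
  have [xyF|nF] := boolP ([set x; y] \in F).
    by rewrite (bigD1 [set x; y]) //= eqxx big1 ?addbF // => e /andP[_ /negbTE].
  by rewrite big1 // => e eF; apply: contraNF nF => /eqP<-.
rewrite -big_split /=; apply: eq_bigr => e _; rewrite implybF.
by have [->|_] := eqVneq e; rewrite ?spansE // ?andbT ?addbF // !leqnn.
Qed.

(** Four points of a convex chain are in convex position. *)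
Lemma chain_crossing x u y v : (x < u < y)%N -> (y < v < l.+2)%N -> crossing A x y u v.
Proof.
move=> h h'; have s0 := apex_sign_neq0 apexA; have ss : 0 < s * s by rewrite -expr2 exprn_even_gt0.
rewrite /crossing; split; rewrite -(pmulr_rlt0 _ ss) mulrACA.
  rewrite nmulr_rlt0; first by apply: (chord_between chainA); lia.
  by apply: (chord_outside chainA); lia.
rewrite pmulr_rlt0; first by apply: (chord_outside chainA); lia.
by apply: (chord_between chainA); lia.
Qed.

Lemma simple_nocross F x u y v : simple_polygon A F -> (x < u < y)%N -> (y < v < l.+2)%N ->
  [set x; y] \in F -> [set u; v] \in F -> False.
Proof.
move=> [_ sF] h h' xyF uvF.
have [t [r [/andP[t0 t1] /andP[r0 r1] cE]]] := crossing_point (chain_crossing h h').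
have ne : [set x; y] != [set u; v].
  by apply/eqP => /set2_inj[[E1 E2]|[E1 E2]]; move: h h'; rewrite ?E1 ?E2; clear; lia.
have [||i] := sF _ _ (A x + t *: (A y - A x)) xyF uvF ne.
- by apply/hull_pair; exists t; rewrite ?ltW.
- by rewrite cE; apply/hull_pair; exists r; rewrite ?ltW.
by rewrite !inE -!val_eqE /= => hi _; clear -h h' hi; lia.
Qed.

Lemma simple_uncrossed F x y : simple_polygon A F -> (x < y < l.+2)%N ->
  [set x; y] \in F -> uncrossed F x y.
Proof.
move=> sF xy xyF u v uv uvF; split; apply/negP => h.
  by apply: (simple_nocross sF _ _ xyF uvF); lia.
by apply: (simple_nocross sF _ _ uvF xyF); lia.
Qed.

(** Each of two crossing edges belongs to a face, which near the crossing point lies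
    on one side of that edge only. A generic point of the quadrant on these sides
    lies in both faces, which therefore coincide, although the edges of a simple
    polygon do not cross. *)
Lemma faces_nocross T x u y v : (forall F, F \in T -> simple_polygon A F) ->
  generic_partition A T -> (x < u < y)%N -> (y < v < l.+2)%N ->
  [set x; y] \in edges T -> [set u; v] \in edges T -> False.
Proof.
move=> sT [_ dis] h h' /bigcupP[F FT xyF] /bigcupP[G GT uvG].
have cr := chain_crossing h h'.
have xy : (x < y < l.+2)%N by lia.
have uv : (u < v < l.+2)%N by lia.
have [t [r [t01 r01 cE]]] := crossing_point cr.
have s0 := apex_sign_neq0 apexA.
pose sg (b : bool) : R := if b then s else - s.
have sg0 b : sg b != 0 by rewrite /sg; case: b; rewrite ?oppr_eq0.
have [g [gg g1 g2]] := crossing_quadrant gp (card_gt2 (l := l)) cr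
  (sg0 (up F x y)) (sg0 (up G u v)).
have [z [gz tz _]] := generic_towards (A x + t *: (A y - A x)) gg.
have inside H (a b : I) (q : R) : H \in T -> (a < b < l.+2)%N -> [set a; b] \in H -> 0 < q < 1 ->
    towards A (A a + q *: (A b - A a)) g z -> 0 < sg (up H a b) * oA a b g -> par A H z.
  move=> HT ab abH q01 tow; have [cH _] := sT H HT.
  have uc := simple_uncrossed (sT H HT) ab abH.
  case hu: (up H a b); rewrite /sg => g0; first by rewrite (par_above cH uc ab q01 gz tow).
  by rewrite (par_below cH uc ab q01 gz tow) ?hu ?abH // -oppr_gt0 -mulNr.
have pF : par A F z by apply: (inside F x y t).
have pG : par A G z by apply: (inside G u v r); rewrite // -cE.
have FG := dis z F G gz FT GT pF pG.
by apply: (simple_nocross (sT F FT) h h' xyF); rewrite FG.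
Qed.

(** Points of the hull just above the edge xy, on the side of the apex. *)
Lemma point_above x y : (x < y < l.+2)%N ->
  exists z, [/\ generic A z, hull A setT z &
    forall F, is_cycle F -> uncrossed F x y -> par A F z = up F x y].
Proof.
move=> xy; have [g0 gg0 hg0] := exists_generic_hull gp (card_gt2 (l := l)).
have [g [gg tg hg]] := generic_towards_hull gg0 (hull_point A (in_setT N)) hg0.
have h12 : 0 < (2^-1 : R) < 1 by lra.
have hm : hull A setT (A x + 2^-1 *: (A y - A x)).
  by apply: hull_segment; [lra|exact: hull_point|exact: hull_point].
have [z [gz tz hz]] := generic_towards_hull gg hm hg.
exists z; split=> // F cF uc; apply: (par_above cF uc xy h12 gz tz).
by apply: (towards_gt0 tg); exact: (chord_apex apexA).
Qed.

(** Below the edge xy there are points of the hull as soon as xy is not the edge opposite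
    to the apex, that is if some vertex k of the chain lies below it. *)
Lemma point_below x y k : (x < y < l.+2)%N -> (k < l.+2)%N -> (k < x)%N || (y < k)%N ->
  exists z, [/\ generic A z, hull A setT z &
    forall F, is_cycle F -> uncrossed F x y -> par A F z = up F x y (+) ([set x; y] \in F)].
Proof.
move=> xy kl kxy; have [g0 gg0 hg0] := exists_generic_hull gp (card_gt2 (l := l)).
have [g [gg tg hg]] := generic_towards_hull gg0 (hull_point A (in_setT k)) hg0.
have h12 : 0 < (2^-1 : R) < 1 by lra.
have hm : hull A setT (A x + 2^-1 *: (A y - A x)).
  by apply: hull_segment; [lra|exact: hull_point|exact: hull_point].
have [z [gz tz hz]] := generic_towards_hull gg hm hg.
exists z; split=> // F cF uc; apply: (par_below cF uc xy h12 gz tz).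
by apply: (towards_lt0 tg); exact: (chord_outside chainA).
Qed.

(** Points of the hull close to the apex, between the directions of two
    consecutive vertices of the chain. *)
Lemma point_apex (a b : I) : b = a.+1 :> nat -> (b < l.+2)%N ->
  exists z, [/\ generic A z, hull A setT z & forall F, is_cycle F -> par A F z = up F a b].
Proof.
move=> ab bl; have [g0 gg0 hg0] := exists_generic_hull gp (card_gt2 (l := l)).
have hm : hull A setT (A a + 2^-1 *: (A b - A a)).
  by apply: hull_segment; [lra|exact: hull_point|exact: hull_point].
have [g [gg tg hg]] := generic_towards_hull gg0 hm hg0.
have [z [gz tz hz]] := generic_towards_hull gg (hull_point A (in_setT N)) hg.
exists z; split=> // F cF; rewrite (par_fan _ _ N) //; apply: eq_bigr => e eF.
have [[k kN ->]|[u [v [uv eE]]]] := cycle_edgeP cF eF.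
  by rewrite spans_N fan_parity_N // neqN.
rewrite {}eE in eF *.
have comb k : s * oA N k (A a + 2^-1 *: (A b - A a)) =
    2^-1 * (s * oA N k (A a)) + 2^-1 * (s * oA N k (A b)).
  by rewrite orient_lin; field.
have Lpos k : (k <= a)%N -> 0 < s * oA N k z.
  move=> ka; apply: (towards_gt0r tz); first exact: orientxx.
  apply: (towards_gt0 tg); rewrite comb.
  have : 0 <= s * oA N k (A a) by apply: (apex_ge apexA); lia.
  by have : 0 < s * oA N k (A b); [apply: apexA; lia|lra].
have Lneg k : (b <= k < l.+2)%N -> s * oA N k z < 0.
  move=> ka; rewrite -oppr_gt0 -mulNr; apply: (towards_gt0r tz); first exact: orientxx.
  rewrite mulNr oppr_gt0; apply: (towards_lt0 tg); rewrite comb.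
  have : s * oA N k (A b) <= 0 by apply: (apex_le apexA); lia.
  by have : s * oA N k (A a) < 0; [apply: (apex_lt apexA); lia|lra].
rewrite (fan_parity_chord apexA) // spansE // /below_apex.
rewrite (towards_gt0 tz (chord_apex apexA uv)) andbT.
have [ua|au] := leqP u a; last first.
  by rewrite [0 < _]ltNge ltW // Lneg //; lia.
rewrite Lpos //=; have [bv|vb] := leqP b v; first by rewrite Lneg //; lia.
by rewrite ltNge ltW // Lpos //; lia.
Qed.

(** Summing h over the ends of the edges of F within the chain. Since all the
    vertices of F have degree two, only the neighbours of the apex contribute,
    having lost one edge. *)
Definition chain_xor F (h : I -> bool) :=
  \xor_(e in F) (if N \in e then false else \xor_(k in e) h k).

Lemma chain_xor_noapex F h : is_cycle F -> N \notin cover F -> chain_xor F h = false.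
Proof.
move=> cF nN; rewrite -(xor_cycle h cF); apply: eq_bigr => e eF; case: ifPn => // Ne.
by case/negP: nN; apply/bigcupP; exists e.
Qed.

Lemma chain_xor_apex F h a b : is_cycle F -> nbrs_of F N a b -> h N = false ->
  chain_xor F h = h a (+) h b.
Proof.
move=> cF nb hN; have [ab aN bN nbE] := nb.
have -> : h a (+) h b = \xor_(e in F) (if N \in e then \xor_(k in e) h k else false).
  rewrite -big_mkcondr /=.
  have := xor_at (fun e => \xor_(k in e) h k) cF nb.
  rewrite !xor_pair 1?eq_sym // hN !addFb => <-.
  by apply: eq_bigl => e; rewrite inE.
have : chain_xor F h (+) \xor_(e in F) (if N \in e then \xor_(k in e) h k else false)
    = \xor_(e in F) \xor_(k in e) h k.
  rewrite /chain_xor -big_split /=; apply: eq_bigr => e _.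
  by case: ifP => _; rewrite ?addbF ?addFb.
by rewrite xor_cycle //; case: (chain_xor F h); case: (\xor_(e in F) _).
Qed.

(** An edge of the chain spans [a, a + 1] when exactly one of its ends is at most a. *)
Lemma up_wedge F (a b : I) : is_cycle F -> b = a.+1 :> nat -> (b < l.+2)%N ->
  up F a b = chain_xor F (fun k => k <= a)%N.
Proof.
move=> cF ab bl; apply: eq_bigr => e eF.
have [[k kN ->]|[u [v [uv ->]]]] := cycle_edgeP cF eF; first by rewrite spans_N !inE eqxx.
rewrite spansE // !inE ![N == _]eq_sym.
have -> : (u == N) || (v == N) = false by rewrite -!val_eqE /=; lia.
by rewrite xor_pair -?val_eqE /=; [|lia]; case: (leqP u a); case: (leqP b v);
  case: (leqP v a); lia.
Qed.

Lemma up_wedge_apex F (a b al be : I) : is_cycle F -> b = a.+1 :> nat -> (b < l.+2)%N ->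
  nbrs_of F N al be -> up F a b = (al <= a)%N (+) (be <= a)%N.
Proof.
move=> cF ab bl nb; rewrite (up_wedge cF ab bl) (chain_xor_apex cF nb) //=; lia.
Qed.

Lemma up_wedge_noapex F (a b : I) : is_cycle F -> b = a.+1 :> nat -> (b < l.+2)%N ->
  N \notin cover F -> up F a b = false.
Proof. by move=> cF ab bl nN; rewrite (up_wedge cF ab bl) chain_xor_noapex. Qed.

End ChainPoints.

(** * Convex vertices of a polygon with vertices in the chain *)

Section ChainConvexity.
Context {R : realType} {l : nat} (A : 'I_l.+3 -> 'rV[R]_2) (s : R).
Local Notation I := 'I_l.+3.
Local Notation N := (@ord_max l.+2).
Local Notation oA i j z := (orient (A i) (A j) z).
Implicit Types (i j k x y u v w : I) (z g c : 'rV[R]_2).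
Implicit Types (e : {set I}) (F G : {set {set I}}) (T : {set {set {set I}}}).
Context (gp : general_position A)
  (apexA : forall i j, (i < j < l.+2)%N -> 0 < s * oA N i (A j))
  (chainA : forall i j k, (i < j < k)%N -> (k < l.+2)%N -> s * oA i j (A k) < 0).

Definition left_of z k := (k != N) && (0 < s * oA N k z).

(** The edges kw in whose direction z lies, but below them: chain_xor counts them
    although z is not in their fan triangle. *)
Definition edge_above k w z := (w != N) &&
  (if (k < w)%N then left_of z k && (s * oA k w z < 0)
   else ~~ left_of z k && (s * oA w k z < 0)).

(** Close to k, every triangle of the fan whose side xy avoids k contains z exactly when
    x and y are on different sides of the ray from the apex through z, since it
    then contains k. Only the two edges at k may lie above z instead of below it. *)
Lemma par_near_vertex F k u w z : is_cycle F -> (k < l.+2)%N -> nbrs_of F k u w ->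
  generic A z ->
  (forall i j s', k != i -> k != j -> 0 < s' * oA i j (A k) -> 0 < s' * oA i j z) ->
  par A F z = chain_xor F (left_of z) (+) (edge_above k u z (+) edge_above k w z).
Proof.
move=> cF kl nb gz near; have [uw uk wk _] := nb.
have pos i j : k != i -> k != j -> 0 < s * oA i j (A k) -> 0 < s * oA i j z by exact: near.
have neg i j : k != i -> k != j -> s * oA i j (A k) < 0 -> s * oA i j z < 0.
  by move=> ki kj h; rewrite -oppr_gt0 -mulNr near // mulNr oppr_gt0.
have neq (x y : I) : (x < y)%N || (y < x)%N -> x != y.
  by move=> h; rewrite -val_eqE /=; clear -h; lia.
have left_lt i : (i < k)%N -> left_of z i.
  move=> ik; rewrite /left_of neqN (ltn_trans ik kl) /=; apply: pos.
  - by apply: neq; rewrite /= kl.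
  - by apply: neq; rewrite ik orbT.
  - by apply: apexA; rewrite ik.
have left_gt i : (k < i < l.+2)%N -> s * oA N i z < 0 /\ left_of z i = false.
  move=> /andP[ki il]; have h : s * oA N i z < 0.
    apply: neg; [by apply: neq; rewrite /= kl|by apply: neq; rewrite ki|].
    by apply: (apex_lt apexA); rewrite ki.
  by split=> //; rewrite /left_of [0 < _]ltNge ltW // andbF.
have kN : k != N by rewrite neqN.
pose sg e := if N \in e then false else \xor_(i in e) left_of z i.
have sgE x y : (x < y < l.+2)%N -> sg [set x; y] = left_of z x (+) left_of z y.
  move=> xy; rewrite /sg !inE ![N == _]eq_sym.
  have -> : (x == N) || (y == N) = false by rewrite -!val_eqE /=; clear -xy; lia.
  by rewrite xor_pair //; apply: neq; case/andP: xy => ->.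
have nz x y : (x < y)%N -> (s * oA x y z < 0) = ~~ (0 < s * oA x y z).
  move=> xy; rewrite -leNgt lt_neqAle mulf_neq0 ?(apex_sign_neq0 apexA) //.
  by apply: gz; apply: neq; rewrite xy.
pose dl e := fan_parity A N z e (+) sg e.
have dl0 e : e \in F -> k \notin e -> dl e = false.
  move=> eF; have [[x xN ->] _|[x [y [xy ->]]]] := cycle_edgeP cF eF.
    by rewrite /dl fan_parity_N ?neqN // /sg !inE eqxx.
  rewrite !inE negb_or => /andP[kx ky].
  rewrite /dl sgE // (fan_parity_chord apexA) // /below_apex.
  have [xk|xk] := leqP x k; last first.
    have [|h1 h2] := left_gt x; first by rewrite xk; clear -xy; lia.
    have [|h3 h4] := left_gt y; first by clear -xy xk; lia.
    by rewrite h2 h4 [0 < _]ltNge ltW.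
  have {}xk : (x < k)%N by move: xk kx; rewrite -val_eqE /=; clear; lia.
  have [yk|yk] := ltnP y k.
    have /andP[_ h] := left_lt y yk.
    have hy : (s * oA N y z < 0) = false by apply/negbTE; rewrite -leNgt ltW.
    by rewrite (left_lt x) // (left_lt y) // hy andbF.
  have {}yk : (k < y)%N by move: yk ky; rewrite -val_eqE /=; clear; lia.
  have [|h1 h2] := left_gt y; first by rewrite yk; clear -xy; lia.
  rewrite h1 h2 (left_lt x) //=.
  have := left_lt x xk; rewrite /left_of => /andP[_ ->] /=.
  by rewrite pos //; apply: (chord_between chainA); rewrite ?xk //; clear -xy; lia.
have dlk v : v \in [set u; w] -> dl [set k; v] = edge_above k v z.
  move=> vuw; have [->|vN] := eqVneq v N.
    by rewrite /edge_above eqxx /dl set2C fan_parity_N // /sg !inE eqxx.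
  have kv : k != v by rewrite eq_sym; move: vuw; rewrite !inE => /orP[]/eqP->.
  rewrite /edge_above vN /=; rewrite neqN in vN.
  have [kv'|vk|/val_inj e] := ltngtP k v; last by rewrite e eqxx in kv.
    have [|h1 h2] := left_gt v; first by rewrite kv'.
    rewrite /dl sgE ?kv' // (fan_parity_chord apexA) ?kv' // /below_apex h1 h2 (nz k v) //.
    by rewrite /left_of kN /=; case: (0 < s * oA N k z); case: (0 < s * oA k v z).
  rewrite set2C /dl sgE ?vk // (fan_parity_chord apexA) ?vk // /below_apex left_lt // (nz v k) //.
  have := left_lt v vk; rewrite /left_of kN => /andP[_ ->] /=.
  have -> : (s * oA N k z < 0) = ~~ (0 < s * oA N k z).
    by rewrite -leNgt lt_neqAle mulf_neq0 ?(apex_sign_neq0 apexA) // gz // eq_sym.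
  by case: (0 < s * oA N k z); case: (0 < s * oA v k z).
rewrite (par_fan _ _ N) //.
have -> : \xor_(e in F) fan_parity A N z e = \xor_(e in F) (sg e (+) dl e).
  by apply: eq_bigr => e _; rewrite /dl addbCA addbb addbF.
rewrite big_split /= -/(chain_xor F _); congr addb.
rewrite -!dlk ?inE ?eqxx ?orbT // -(xor_at _ cF nb) big_mkcond [RHS]big_mkcond /=.
apply: eq_bigr => e _; rewrite inE; case eF: (e \in F) => //=.
by case: ifPn => // ke; rewrite dl0.
Qed.

(** If u and w are on the same side of k, then z lies between the lines ku and kw,
    hence below exactly one of the edges. If k is between u and w, then z lies below
    both lines, and on the side of exactly one of u and w. *)
Lemma edge_above_sector k u w z : (k < l.+2)%N -> (u < w < l.+2)%N -> u != k -> w != k ->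
  generic A z ->
  (forall j s', 0 < s' * (oA k j (A u) + oA k j (A w)) -> 0 < s' * oA k j z) ->
  edge_above k u z (+) edge_above k w z.
Proof.
move=> kl uwl uk wk gz sec.
have kN : k != N by rewrite neqN.
have spos (j : I) : 0 < s * (oA k j (A u) + oA k j (A w)) -> 0 < s * oA k j z by exact: sec.
have sneg (j : I) : s * (oA k j (A u) + oA k j (A w)) < 0 -> s * oA k j z < 0.
  by move=> h; rewrite -oppr_gt0 -mulNr sec // mulNr oppr_gt0.
have uN : u != N by rewrite neqN; clear -uwl; lia.
have wN : w != N by rewrite neqN; clear -uwl; lia.
have leftE : left_of z k = (s * oA k N z < 0).
  by rewrite /left_of kN (orientNl (A k)) mulrN oppr_gt0.
have flip (a : I) : s * oA a k z = - (s * oA k a z) by rewrite orientNl mulrN.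
rewrite /edge_above uN wN /=.
have [ku|uk'] := ltnP k u.
  have kw : (k < w)%N by clear -ku uwl; lia.
  have c : s * oA k u (A w) < 0 by apply: chainA; clear -ku uwl; lia.
  have -> : left_of z k.
    rewrite leftE; apply: sneg; rewrite !(orientNl (A N) (A k)).
    have : 0 < s * oA N k (A u) by apply: apexA; clear -ku uwl; lia.
    by have : 0 < s * oA N k (A w); [apply: apexA; clear -ku uwl; lia|lra].
  rewrite kw /=.
  have -> : s * oA k u z < 0 by apply: sneg; rewrite orientxy add0r.
  have -> : (s * oA k w z < 0) = false; last by [].
  apply/negbTE; rewrite -leNgt ltW //; apply: spos; rewrite orientxy addr0.
  by rewrite orientNr mulrN oppr_gt0.
have {}uk' : (u < k)%N by move: uk uk'; rewrite -val_eqE /=; clear; lia.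
have [kw|wk'] := ltnP k w.
  have c : s * oA u k (A w) < 0 by apply: chainA; clear -kw uk' uwl; lia.
  have -> : s * oA u k z < 0.
    rewrite flip oppr_lt0; apply: spos; rewrite orientxy add0r.
    by rewrite orientNl mulrN oppr_gt0.
  have -> : s * oA k w z < 0.
    by apply: sneg; rewrite orientxy addr0 orient_cyc.
  by case: (left_of z k).
have {}wk' : (w < k)%N by move: wk wk'; rewrite -val_eqE /=; clear; lia.
have c : s * oA u w (A k) < 0 by apply: chainA; clear -wk' uwl kl; lia.
have -> : left_of z k = false.
  rewrite leftE; apply/negbTE; rewrite -leNgt ltW //; apply: spos.
  rewrite !(orientNl (A N) (A k)).
  have : s * oA N k (A u) < 0 by apply: (apex_lt apexA); clear -uk' kl; lia.
  by have : s * oA N k (A w) < 0; [apply: (apex_lt apexA); clear -wk' kl; lia|lra].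
have -> : s * oA w k z < 0.
  rewrite flip oppr_lt0; apply: spos; rewrite orientxy addr0.
  by rewrite -(orient_cyc (A k)) (orientNl (A u)) mulrN oppr_gt0.
have -> : (s * oA u k z < 0) = false; last by [].
apply/negbTE; rewrite -leNgt ltW // flip oppr_gt0; apply: sneg.
by rewrite orientxy add0r -(orient_cyc (A k)).
Qed.

End ChainConvexity.

Section ChainPseudoTriangles.
Context {R : realType} {l : nat} (A : 'I_l.+3 -> 'rV[R]_2) (s : R).
Local Notation I := 'I_l.+3.
Local Notation N := (@ord_max l.+2).
Local Notation oA i j z := (orient (A i) (A j) z).
Implicit Types (i j k a b x y u v w al be : I) (z g c : 'rV[R]_2).
Implicit Types (e : {set I}) (F G : {set {set I}}) (T : {set {set {set I}}}).
Context (gp : general_position A)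
  (apexA : forall i j, (i < j < l.+2)%N -> 0 < s * oA N i (A j))
  (chainA : forall i j k, (i < j < k)%N -> (k < l.+2)%N -> s * oA i j (A k) < 0).

Lemma left_of_near z k a : (k < l.+2)%N -> (a < l.+2)%N -> a != k ->
  (forall i j s', k != i -> k != j -> 0 < s' * oA i j (A k) -> 0 < s' * oA i j z) ->
  left_of A s z a = (a < k)%N.
Proof.
move=> kl al ak near; have kN : k != N by rewrite neqN.
rewrite /left_of neqN al /=; have [h|h|/val_inj e] := ltngtP a k.
- by apply: near; rewrite // 1?eq_sym // apexA // h.
- apply/negbTE; rewrite -leNgt ltW // -oppr_gt0 -mulNr; apply: near; rewrite // 1?eq_sym //.
  by rewrite mulNr oppr_gt0 (apex_lt apexA) // h.
- by rewrite e eqxx in ak.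
Qed.

Lemma convex_chain F k u w : is_cycle F -> (k < l.+2)%N -> nbrs_of F k u w ->
  u != N -> w != N ->
  exists z, [/\ generic A z, convex_vertex A F k <-> ~~ chain_xor F (left_of A s z) &
    forall i j s', k != i -> k != j -> 0 < s' * oA i j (A k) -> 0 < s' * oA i j z].
Proof.
move=> cF kl nb; wlog uw : u w nb / (u < w)%N.
  move=> W uN wN; have [h|h|/val_inj h] := ltngtP u w.
  - exact: (W u w nb h uN wN).
  - exact: (W w u (nbrs_swap nb) h wN uN).
  - by case: nb; rewrite h eqxx.
rewrite !neqN => ul wl; have [z [gz cz near sec]] := convex_vertexP gp (card_gt2 (l := l)) cF nb.
exists z; split=> //; rewrite cz (par_near_vertex apexA chainA cF kl nb gz near).
have [_ uk wk _] := nb.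
by rewrite (edge_above_sector apexA chainA) ?uw // addbT.
Qed.

(** A polygon within a convex chain is convex. *)
Lemma convex_noapex F k : is_cycle F -> N \notin cover F -> k \in cover F ->
  convex_vertex A F k.
Proof.
move=> cF nN kF; have [u [w nb]] := cycle_nbrs cF kF; have [_ uF wF] := nbrs_mem nb.
have neq a : a \in cover F -> a != N by apply: contraTneq => ->.
have kl : (k < l.+2)%N by rewrite -neqN neq.
have [z [gz -> _]] := convex_chain cF kl nb (neq _ uF) (neq _ wF).
by rewrite chain_xor_noapex.
Qed.

Section WithApex.
Context (F : {set {set I}}) (al be : I) (cF : is_cycle F).
Context (nbN : nbrs_of F N al be) (albe : (al < be)%N).

Lemma nbrN_lt : (be < l.+2)%N.
Proof. by have [_ _ bN _] := nbN; rewrite -neqN. Qed.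

(** By chain_xor_apex, the parity at a point close to k depends on whether the ray from
    the apex through this point separates the two neighbours of the apex, that is
    whether k is between them. *)
Lemma convex_inner k u w : (k < l.+2)%N -> nbrs_of F k u w -> u != N -> w != N ->
  convex_vertex A F k <-> (k < al)%N || (be < k)%N.
Proof.
move=> kl nb uN wN; have [z [gz -> near]] := convex_chain cF kl nb uN wN.
have bl := nbrN_lt; have [_ _ _ nbE] := nbN.
have kN : [set N; k] \notin F.
  rewrite set2C (nbrs_sym _ nb); apply/negP => /orP[]/eqP e.
    by rewrite -e eqxx in uN.
  by rewrite -e eqxx in wN.
have kal : k != al by apply: contraNneq kN => ->; rewrite nbE eqxx.
have kbe : k != be by apply: contraNneq kN => ->; rewrite nbE eqxx orbT.
rewrite (chain_xor_apex cF nbN); last by rewrite /left_of eqxx.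
rewrite !(left_of_near kl _ _ near) // 1?eq_sym //; last by rewrite (ltn_trans albe bl).
move: kal kbe; rewrite -!val_eqE /=; clear -albe.
by case: (ltngtP al k); case: (ltngtP be k) => //; lia.
Qed.

(** The sector between the edge to the apex and ku lies on the side of u and above
    the line ku. *)
Lemma apex_sector k u z : (k < l.+2)%N -> nbrs_of F k N u -> generic A z ->
  (forall j s', 0 < s' * (oA k j (A N) + oA k j (A u)) -> 0 < s' * oA k j z) ->
  left_of A s z k = (k < u)%N /\ edge_above A s k u z = false.
Proof.
move=> kl nb gz sec; have [Nu Nk uk _] := nb.
have ul : (u < l.+2)%N by rewrite -neqN eq_sym.
have flip : s * oA k N z = - (s * oA N k z) by rewrite orientNl mulrN.
rewrite /edge_above [u == N]eq_sym Nu /= /left_of neqN kl /=.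
have [ku|uk'] := ltnP k u.
  have -> : 0 < s * oA N k z.
    rewrite -oppr_lt0 -flip -oppr_gt0 -mulNr; apply: sec.
    by rewrite orientxy add0r mulNr -mulrN -orientNl; apply: apexA; rewrite ku.
  split=> //; apply/negbTE; rewrite -leNgt ltW //; apply: sec; rewrite orientxy addr0.
  by apply: (chord_apex apexA); rewrite ku.
have {}uk' : (u < k)%N by move: uk' uk; rewrite -val_eqE /=; clear; lia.
have h : (0 < s * oA N k z) = false.
  apply/negbTE; rewrite -leNgt -oppr_ge0 -flip ltW //; apply: sec; rewrite orientxy add0r.
  by rewrite orientNl mulrN oppr_gt0; apply: (apex_lt apexA); rewrite uk'.
rewrite h; split=> //=; apply/negbTE; rewrite -leNgt ltW //.
rewrite orientNl mulrN -mulNr; apply: sec; rewrite orientxy addr0 mulNr -mulrN -orientNl.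
by apply: (chord_apex apexA); rewrite uk'.
Qed.

Lemma convex_left u : nbrs_of F al N u -> convex_vertex A F al <-> (al < u)%N.
Proof.
move=> nb; have bl := nbrN_lt; have alt := ltn_trans albe bl.
have [z [gz cz near sec]] := convex_vertexP gp (card_gt2 (l := l)) cF nb.
have [h1 h2] := apex_sector alt nb gz sec.
rewrite cz (par_near_vertex apexA chainA cF alt nb gz near) h2.
rewrite (chain_xor_apex cF nbN) ?h1; last by rewrite /left_of eqxx.
have bal : be != al by rewrite -val_eqE /=; clear -albe; lia.
have h0 : edge_above A s al N z = false by rewrite /edge_above eqxx.
by rewrite h0 (left_of_near alt bl bal near) [(be < al)%N]ltnNge (ltnW albe) //; case: (al < u)%N.
Qed.

Lemma convex_right u : nbrs_of F be N u -> convex_vertex A F be <-> (u < be)%N.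
Proof.
move=> nb; have bl := nbrN_lt; have alt := ltn_trans albe bl.
have [z [gz cz near sec]] := convex_vertexP gp (card_gt2 (l := l)) cF nb.
have [h1 h2] := apex_sector bl nb gz sec.
rewrite cz (par_near_vertex apexA chainA cF bl nb gz near) h2.
rewrite (chain_xor_apex cF nbN) ?h1; last by rewrite /left_of eqxx.
have bal : al != be by rewrite -val_eqE /=; clear -albe; lia.
have h0 : edge_above A s be N z = false by rewrite /edge_above eqxx.
have [_ _ ub _] := nb; rewrite h0 (left_of_near bl alt bal near) albe addbF addTb.
by move: ub; rewrite -val_eqE /=; clear; lia.
Qed.

(** Between the directions of al and be, a generic point is to the right of the
    first vertices of the chain and to the left of the others. *)
Lemma left_of_mono z u v : generic A z -> 0 < s * oA N al z -> s * oA N be z < 0 ->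
  (u < v < l.+2)%N -> left_of A s z v -> left_of A s z u.
Proof.
move=> gz La Lb uv /andP[_ Lv]; have bl := nbrN_lt.
rewrite /left_of neqN; apply/andP; split; first by clear -uv; lia.
have [//|Lu|Lu] := ltgtP 0 (s * oA N u z); last first.
  by have := apex_sign_neq0 apexA; have : oA N u z != 0;
    [apply: gz; rewrite -val_eqE /=; clear -uv; lia|
     move=> h1 h2; have := mulf_neq0 h2 h1; rewrite -Lu eqxx].
have plk (a b : I) : (s * oA N a (A b)) * (s * oA N u z) + (s * oA N a z) * (s * oA N b (A u))
   = (s * oA N a (A u)) * (s * oA N b z).
  have h := orient_plucker (A N) (A a) (A b) (A u) z.
  transitivity (s * s * (oA N a (A b) * oA N u z + oA N a z * oA N b (A u))); first by ring.
  by rewrite h; ring.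
have [ualb|alu|/val_inj e] := ltngtP u al; last by move: La; rewrite -e ltNge ltW.
- (* seen from the apex, u comes before al, and z after al *)
  have h1 : 0 < s * oA N al (A be) by apply: apexA; rewrite albe.
  have h2 : s * oA N al (A u) < 0 by apply: (apex_lt apexA); rewrite ualb (ltn_trans albe bl).
  have h3 : s * oA N be (A u) < 0 by apply: (apex_lt apexA); rewrite (ltn_trans ualb albe) bl.
  have := plk al be.
  have p1 := pmulr_rlt0 (s * oA N u z) h1; rewrite Lu in p1.
  have p2 := pmulr_rlt0 (s * oA N be (A u)) La; rewrite h3 in p2.
  have p3 := nmulr_rgt0 (s * oA N be z) h2; rewrite Lb in p3.
  by move: p1 p2 p3; lra.
- (* seen from the apex, z comes before u and after v, although u precedes v *)
  have h1 : 0 < s * oA N al (A v) by apply: apexA; clear -alu uv; lia.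
  have h2 : 0 < s * oA N al (A u) by apply: apexA; clear -alu uv; lia.
  have h3 : s * oA N v (A u) < 0 by apply: (apex_lt apexA); exact: uv.
  have := plk al v.
  have p1 := pmulr_rlt0 (s * oA N u z) h1; rewrite Lu in p1.
  have p2 := pmulr_rlt0 (s * oA N v (A u)) La; rewrite h3 in p2.
  have p3 := pmulr_rgt0 (s * oA N v z) h2; rewrite Lv in p3.
  by move: p1 p2 p3; lra.
Qed.

(** Close to the apex, all edges of the chain lie below z, and the number of those met by
    the ray from the apex through z is odd since the ray separates al and be. *)
Lemma convex_apex : convex_vertex A F N.
Proof.
have bl := nbrN_lt; have alt := ltn_trans albe bl.
have [z [gz cz near sec]] := convex_vertexP gp (card_gt2 (l := l)) cF nbN.
have La : 0 < s * oA N al z.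
  by apply: sec; rewrite orientxy add0r; apply: apexA; rewrite albe.
have Lb : s * oA N be z < 0.
  rewrite -oppr_gt0 -mulNr; apply: sec; rewrite orientxy addr0 mulNr oppr_gt0.
  by apply: (apex_lt apexA); rewrite albe.
rewrite cz (par_fan _ _ N) //.
have -> : \xor_(e in F) fan_parity A N z e = chain_xor F (left_of A s z).
  apply: eq_bigr => e eF; have [[x xN ->]|[x [y [xy ->]]]] := cycle_edgeP cF eF.
    by rewrite fan_parity_N ?neqN // !inE eqxx.
  have /andP[xlty yl] := xy; have xl := ltn_trans xlty yl.
  rewrite !inE ![N == _]eq_sym.
  have -> : (x == N) || (y == N) = false by rewrite -!val_eqE /=; clear -xy; lia.
  have nxy : x != y by rewrite -val_eqE /=; clear -xlty; lia.
  rewrite xor_pair // (fan_parity_chord apexA) // /below_apex.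
  have := left_of_mono gz La Lb xy; rewrite /left_of !neqN xl yl /=.
  have -> : (s * oA N y z < 0) = ~~ (0 < s * oA N y z).
    rewrite -leNgt lt_neqAle mulf_neq0 ?(apex_sign_neq0 apexA) //.
    by apply: gz; rewrite eq_sym neqN.
  have -> : 0 < s * oA x y z.
    by apply: near; [rewrite eq_sym neqN|rewrite eq_sym neqN|exact: (chord_apex apexA)].
  by case: (0 < s * oA N x z); case: (0 < s * oA N y z) => // /(_ isT).
rewrite (chain_xor_apex cF nbN) /left_of ?eqxx // !neqN alt bl La /=.
by rewrite [0 < _]ltNge ltW.
Qed.

End WithApex.

(** Let al and be be the neighbours of the apex, and x and y the further neighbours
    of al and be. Outside the angle at the apex all vertices are convex, so there is
    room for one on each side only: x if it lies outside, and otherwise al itself is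
    convex; likewise for be and y. *)
Definition first_corner al x := if (x < al)%N then x else al.
Definition last_corner be y := if (be < y)%N then y else be.

(** All the vertices are convex, hence there are three of them. *)
Lemma pseudo_triangle_noapex F : pseudo_triangle A F -> N \notin cover F ->
  exists x y w, [/\ (x < y < w)%N, (w < l.+2)%N & F = tri x y w].
Proof.
move=> [[cF _] c3] nN.
have c3' : #|cover F| = 3%N.
  suff -> : cover F = [set v in vertices F | `[< convex_vertex A F v >]] by [].
  apply/setP => k; rewrite inE /vertices.
  by case kF: (k \in cover F) => //; apply/esym/asboolP/convex_noapex.
have [x [y [w [xyw FE]]]] := cycle_tri_sorted cF c3'.
exists x, y, w; split=> //; rewrite -neqN; apply: contraNneq nN => <-.
by rewrite FE cover_tri !inE eqxx orbT.
Qed.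

Section WithApexCorners.
Context (F : {set {set I}}) (al be x y : I) (cF : is_cycle F).
Context (nbN : nbrs_of F N al be) (albe : (al < be)%N).
Context (nbal : nbrs_of F al N x) (nbbe : nbrs_of F be N y).

Lemma corners_order : (first_corner al x <= al)%N && (be <= last_corner be y < l.+2)%N.
Proof.
have bl := nbrN_lt nbN; have [Ny _ _ _] := nbbe; rewrite eq_sym neqN in Ny.
rewrite /first_corner /last_corner; case: ifP => h; case: ifP => h'; clear -bl Ny h h'; lia.
Qed.

Lemma corners_cover :
  (first_corner al x \in cover F) && (last_corner be y \in cover F).
Proof.
have [h1 _ h2] := nbrs_mem nbal; have [h3 _ h4] := nbrs_mem nbbe.
by rewrite /first_corner /last_corner; case: ifP => _; case: ifP => _; apply/andP.
Qed.

Lemma convex_vertexE k : k \in cover F -> convex_vertex A F k <->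
  [|| k == N, (k < al)%N, (be < k)%N, (k == al) && (al < x)%N | (k == be) && (y < be)%N].
Proof.
move=> kF; have bl := nbrN_lt nbN; have alt := ltn_trans albe bl.
have [->|kN] := eqVneq k N; first by split=> // _; apply: convex_apex nbN albe.
have [->|kal] := eqVneq k al.
  rewrite (convex_left cF nbN albe nbal) ltnn [(be < al)%N]ltnNge (ltnW albe) /=.
  have -> : (al == be) = false by rewrite -val_eqE /=; clear -albe; lia.
  by rewrite orbF.
have [->|kbe] := eqVneq k be.
  by rewrite (convex_right cF nbN albe nbbe) ltnn [(be < al)%N]ltnNge (ltnW albe).
have [u [w nb]] := cycle_nbrs cF kF.
have notN v : v \in [set u; w] -> v != N.
  rewrite inE [in X in _ || X]inE inE -(nbrs_sym _ nb) set2C => h.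
  apply: contraNneq kal => vN; move: h; rewrite vN (nbrs_sym _ nbN).
  by rewrite (negbTE kbe) orbF.
rewrite (convex_inner cF nbN albe _ nb) ?orbF ?notN ?inE ?eqxx ?orbT //.
by rewrite -neqN.
Qed.

Lemma corners_convex : [/\ convex_vertex A F N, convex_vertex A F (first_corner al x)
  & convex_vertex A F (last_corner be y)].
Proof.
have /andP[c1 c2] := corners_cover; have [_ _ xal _] := nbal; have [_ _ ybe _] := nbbe.
split; first exact: convex_apex nbN albe.
  apply/convex_vertexE => //; rewrite /first_corner; case: ltnP => h.
    by rewrite h orbT.
  have -> : (al < x)%N by move: xal h; rewrite -val_eqE /=; clear; lia.
  by rewrite eqxx !orbT.
apply/convex_vertexE => //; rewrite /last_corner; case: ltnP => h.
  by rewrite h !orbT.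
have -> : (y < be)%N by move: ybe h; rewrite -val_eqE /=; clear; lia.
by rewrite eqxx !orbT.
Qed.

Lemma corners_card : #|[set N; first_corner al x; last_corner be y]| = 3%N.
Proof.
have /and3P[h1 h2 h3] := corners_order.
rewrite setUC cardsU1 cards2 !inE negb_or.
have -> : N != first_corner al x by rewrite eq_sym neqN; clear -h1 h2 h3 albe; lia.
have -> : last_corner be y != N by rewrite neqN.
by have -> : last_corner be y != first_corner al x
  by rewrite -val_eqE /=; clear -h1 h2 h3 albe; lia.
Qed.

(** The three given corners are always convex, and the other convex vertices are exactly
    those outside the angle at the apex. *)
Lemma pseudo_triangle_corners : pseudo_triangle A F <-> simple_polygon A F /\
  forall k, k \in cover F -> k != N -> ~~ (al <= k <= be)%N ->
    k \in [set first_corner al x; last_corner be y].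
Proof.
have [v1 v2 v3] := corners_convex; have /andP[c1 c2] := corners_cover.
have [cN _ _] := nbrs_mem nbN.
have sub : [set N; first_corner al x; last_corner be y] \subset
    [set v in vertices F | `[< convex_vertex A F v >]].
  apply/subsetP => k; rewrite !inE -orbA => /or3P[]/eqP->;
  by apply/andP; split=> //; apply/asboolP.
split=> [[sF c3]|[sF out]]; split=> //.
  move=> k kF kN h; have /subset_leqif_cards[_] := sub.
  rewrite c3 corners_card eqxx => /esym/eqP/setP/(_ k).
  rewrite !inE (negbTE kN) /= /vertices kF /= => ->; apply/asboolP/convex_vertexE => //.
  by move: h; rewrite negb_and -!ltnNge => /orP[]->; rewrite ?orbT.
rewrite -corners_card; apply/esym/eqP; rewrite (subset_leqif_cards sub).
rewrite eqEsubset sub; apply/subsetP => k; rewrite inE => /andP[kF /asboolP].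
move=> /(convex_vertexE kF) => h; rewrite -setUA in_setU1; have [//|kN] := eqVneq k N.
have [/andP[alk kbe]|] := boolP (al <= k <= be)%N; last exact: out.
move: h; rewrite (negbTE kN) /= ltnNge alk [(be < k)%N]ltnNge kbe /=.
rewrite !inE /first_corner /last_corner => /orP[]/andP[/eqP-> h].
  by rewrite [(x < al)%N]ltnNge (ltnW h) eqxx.
by rewrite [(be < y)%N]ltnNge (ltnW h) eqxx orbT.
Qed.

End WithApexCorners.

End ChainPseudoTriangles.

(** * The pseudo-triangles at the apex *)

Section CycleLists.
Context {I : finType}.
Implicit Types (x y : I) (t : seq I) (e : {set I}).
Local Notation pair x y := ([set x; y] : {set I}).

Lemma mem_cycle_edges x t e : uniq (x :: t) ->
  (e \in cycle_edges (x :: t)) = (e \in pairmap (fun x y => pair x y) x (rcons t x)).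
Proof.
move=> ut; have -> : pairmap (fun x y => pair x y) x (rcons t x) =
    [seq pair y (next (x :: t) y) | y <- x :: t].
  apply: (@eq_from_nth _ set0) => [|i]; first by rewrite size_pairmap size_rcons size_map.
  rewrite size_pairmap size_rcons => it.
  rewrite (nth_pairmap x) ?size_rcons // (nth_map x) // next_nth mem_nth // index_uniq //.
  congr [set _; _]; first by case: i it => // i it; rewrite /= nth_rcons -ltnS it.
  rewrite nth_rcons; case: (ltngtP i (size t)) it => [//|h|->] it.
  - by rewrite ltnS leqNgt h in it.
  - by rewrite nth_default.
by apply/imsetP/mapP => -[y yin ->]; exists y.
Qed.

End CycleLists.

Section SortedLists.
Context {m : nat}.
Local Notation I := 'I_m.
Implicit Types (x y k : I) (t : seq I) (e : {set I}).
Local Notation ltI := (fun x y : I => (x < y)%N).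

Lemma ltI_trans : transitive ltI.
Proof. by move=> y x z; apply: ltn_trans. Qed.

Lemma sorted_filter_enum (p : pred I) : sorted ltI [seq k <- enum 'I_m | p k].
Proof.
apply: (sorted_filter ltI_trans).
have : sorted ltn (map val (enum 'I_m)) by rewrite val_enum_ord iota_ltn_sorted.
by rewrite sorted_map.
Qed.

Lemma path_lt_all x t : path ltI x t -> forall y, y \in t -> (x < y)%N.
Proof. by move=> /(order_path_min ltI_trans)/allP. Qed.

Lemma path_le_last x t : path ltI x t -> forall y, y \in x :: t -> (y <= last x t)%N.
Proof.
elim: t x => [|z t IH] x /= => [_ y|/andP[xz pt] y]; first by rewrite inE => /eqP->.
rewrite inE => /orP[/eqP->|]; last exact: IH.
by apply: leq_trans (ltnW xz) (IH _ pt z _); rewrite mem_head.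
Qed.

(** The edges of a monotone path join the consecutive vertices. *)
Lemma mem_pairmap_path x t e : path ltI x t ->
  reflect (exists a b : I, [/\ (a < b)%N, e = [set a; b], a \in x :: t, b \in x :: t &
      forall k, k \in x :: t -> ~~ (a < k < b)%N])
    (e \in pairmap (fun x y => [set x; y] : {set I}) x t).
Proof.
elim: t x => [|z t IH] x /= => [_|/andP[xz pt]].
  constructor=> -[a [b [ab _]]]; rewrite !inE => /eqP ax /eqP bx.
  by rewrite ax bx ltnn in ab.
have zt := path_lt_all pt; have xzt k : k \in z :: t -> (x < k)%N.
  by rewrite inE => /orP[/eqP->//|/zt]; apply: ltn_trans.
rewrite inE; apply: (iffP orP) => [[/eqP->|/(IH _ pt)[a [b [ab eE ain bin h]]]]|].
- exists x, z; rewrite !inE !eqxx ?orbT; split=> // k.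
  rewrite !inE => /or3P[/eqP->|/eqP->|/zt zk]; rewrite ?ltnn ?andbF //.
  by rewrite negb_and -!leqNgt (ltnW zk) orbT.
- exists a, b; split=> //; rewrite 1?inE ?ain ?bin ?orbT // => k.
  rewrite inE => /orP[/eqP->|]; last exact: h.
  by rewrite negb_and -leqNgt ltnW // xzt.
move=> [a [b [ab eE ain bin h]]].
have bzt : b \in z :: t.
  move: bin; rewrite inE => /orP[/eqP bx|//]; move: ain ab; rewrite inE bx.
  by move=> /orP[/eqP->|/xzt h']; [rewrite ltnn|rewrite ltnNge ltnW].
move: ain; rewrite inE => /orP[/eqP ax|azt].
  left; have := h z; rewrite !inE eqxx orbT ax xz /= -leqNgt => /(_ isT) bz.
  move: bzt; rewrite inE => /orP[/eqP bE|/zt]; first by rewrite eE ax bE.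
  by rewrite ltnNge bz.
right; apply/(IH _ pt); exists a, b; split=> // k kin; apply: h.
by rewrite inE kin orbT.
Qed.

End SortedLists.

Section ApexFaces.
Context {l : nat}.
Local Notation I := 'I_l.+3.
Local Notation N := (@ord_max l.+2).
Implicit Types (x y k m al be M : I) (e : {set I}) (F : {set {set I}}).

(** The edges xy, with x < y, of the pseudo-triangle with corners the apex, m and M,
    in which the apex is joined to al and be, and all of whose other vertices are
    those between al and be. The concave chain from m to M runs through the
    vertices strictly between al and be; mid_edge describes its edges. When m = al
    (or M = be) the edge from m to al (or from be to M) disappears. *)
Definition mid_edge m al be M x y :=
  [&& (x == m) || (al < x < be)%N, (y == M) || (al < y < be)%N
    & [forall k : I, ~~ ((al < k < be)%N && (x < k < y)%N)]].

Definition apex_face_edge m al be M x y := if y == N then (x == al) || (x == be)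
  else [|| (x == m) && (y == al), (x == be) && (y == M) | mid_edge m al be M x y].

Definition apex_face m al be M : {set {set I}} := [set e | [exists x : I, exists y : I,
  [&& (x < y)%N, e == [set x; y] & apex_face_edge m al be M x y]]].

Lemma mem_apex_face m al be M x y : (x < y)%N ->
  ([set x; y] \in apex_face m al be M) = apex_face_edge m al be M x y.
Proof.
move=> xy; rewrite inE; apply/existsP/idP => [[a /existsP[b /and3P[ab /eqP/set2_inj]]]|h].
  by move=> [[-> ->]//|[ya xb]]; rewrite -ya -xb ltnNge ltnW in ab.
by exists x; apply/existsP; exists y; rewrite xy eqxx.
Qed.

Lemma apex_faceP m al be M e : e \in apex_face m al be M ->
  exists x y : I, [/\ (x < y)%N, e = [set x; y] & apex_face_edge m al be M x y].
Proof.
by rewrite inE => /existsP[x /existsP[y /and3P[xy /eqP-> h]]]; exists x, y.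
Qed.

Definition corner_order m al be M := [&& (m <= al)%N, (al < be)%N, (be <= M)%N & (M < l.+2)%N].

(** The cycle is the apex, al, m, the vertices strictly between al and be, M, be, where al
    is omitted if it equals m, and be if it equals M. *)
Lemma apex_face_cycle m al be M : corner_order m al be M ->
  is_cycle (apex_face m al be M) /\
  (forall k, k \in cover (apex_face m al be M) =
     [|| k == N, k == m, k == M | (al <= k <= be)%N]).
Proof.
move=> /and4P[h1 h2 h3 h4].
pose p k := [|| k == m, k == M | (al < k < be)%N].
have [t tE] : exists t, [seq k <- enum 'I_l.+3 | p k] = m :: t.
  have : m \in [seq k <- enum 'I_l.+3 | p k] by rewrite mem_filter mem_enum /p eqxx.
  have := sorted_filter_enum p; case cE: [seq k <- enum _ | p k] => [//|a t] /= pt.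
  have : p a by have := mem_head a t; rewrite -cE mem_filter => /andP[].
  rewrite inE => pa /orP[/eqP->|/(path_lt_all pt) am]; first by exists t.
  by move: pa am; rewrite /p -!val_eqE /=; clear -h1 h2 h3; lia.
have pt : path (fun x y : I => (x < y)%N) m t.
  by have := sorted_filter_enum p; rewrite tE.
have mt k : (k \in m :: t) = p k by rewrite -tE mem_filter mem_enum andbT.
have lastM : last m t = M.
  have pM : p M by rewrite /p eqxx orbT.
  have := path_le_last pt; move=> /(_ M); rewrite mt => /(_ pM) Ml.
  have : p (last m t) by rewrite -mt mem_last.
  rewrite /p -!val_eqE /= => pl; apply: val_inj => /=; clear -Ml pl h1 h2 h3; lia.
pose L := if (m < al)%N then [:: al] else [::].
pose Q := if (be < M)%N then [:: be] else [::].
pose s := L ++ m :: t ++ Q.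
have um : uniq (m :: t) by rewrite -tE filter_uniq // enum_uniq.
have memL k : (k \in L) = (m < al)%N && (k == al).
  by rewrite /L; case: ifP => _; rewrite ?inE.
have memQ k : (k \in Q) = (be < M)%N && (k == be).
  by rewrite /Q; case: ifP => _; rewrite ?inE.
have mems k : (k \in s) = [|| k == m, k == M | (al <= k <= be)%N].
  rewrite /s mem_cat inE mem_cat memL memQ.
  have := mt k; rewrite inE => mtk.
  rewrite (_ : _ || _ = [|| (m < al)%N && (k == al), p k | (be < M)%N && (k == be)]).
    by rewrite /p -!val_eqE /=; clear -h1 h2 h3; lia.
  by rewrite -mtk -!orbA.
have us : uniq (N :: s).
  rewrite cons_uniq mems; apply/andP; split.
    by rewrite -!val_eqE /=; clear -h1 h2 h3 h4; lia.
  rewrite /s cat_uniq -cat_cons cat_uniq um; apply/and3P; split.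
  - by rewrite /L; case: ifP.
  - apply/hasPn => k; rewrite mem_cat mt memQ memL /p -!val_eqE /=.
    by clear -h1 h2 h3; lia.
  - rewrite andTb; apply/andP; split; last by rewrite /Q; case: ifP.
    apply/hasPn => k; rewrite memQ mt /p -!val_eqE /=; clear -h1 h2 h3; lia.
have faceE : apex_face m al be M = cycle_edges (N :: s).
  apply/setP => e; rewrite mem_cycle_edges // /s rcons_cat rcons_cons rcons_cat.
  rewrite pairmap_cat mem_cat /= pairmap_cat in_cons mem_cat lastM.
  have -> : (e \in pairmap (fun x y => [set x; y] : {set I}) N L) =
      (m < al)%N && (e == [set N; al]).
    by rewrite /L; case: ifP => _; rewrite /= ?inE.
  have -> : (e \in pairmap (fun x y => [set x; y] : {set I}) M (rcons Q N)) =
      ((be < M)%N && (e == [set be; M])) || (e == [set be; N]).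
    rewrite /Q; case: ltnP => h /=; rewrite !inE ?(set2C M be) //.
    by have -> : M = be by apply: val_inj => /=; clear -h h3; lia.
  have -> : last N L = if (m < al)%N then al else N by rewrite /L; case: ifP.
  have midP : reflect (exists a b : I, [/\ (a < b)%N, e = [set a; b] & mid_edge m al be M a b])
     (e \in pairmap (fun x y => [set x; y] : {set I}) m t).
    apply: (iffP (mem_pairmap_path e pt)) => -[a [b [ab eE]]].
      rewrite !mt => pa pb nk; exists a, b; split=> //.
      apply/and3P; split.
      - by move: pa pb ab; rewrite /p -!val_eqE /=; clear -h1 h2 h3; lia.
      - by move: pa pb ab; rewrite /p -!val_eqE /=; clear -h1 h2 h3; lia.
      - apply/forallP => k; apply/negP => /andP[kin]; apply/negP/nk.
        by rewrite mt /p kin !orbT.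
    move=> /and3P[ha hb /forallP nk]; exists a, b; rewrite !mt /p; split=> //.
    - by rewrite orbCA ha orbT.
    - by rewrite hb orbT.
    move=> k; rewrite mt /p => /or3P[/eqP->|/eqP->|hk].
    - by move: ha; rewrite -!val_eqE /=; clear -h1 h2 h3; lia.
    - by move: hb; rewrite -!val_eqE /=; clear -h1 h2 h3; lia.
    - by have := nk k; rewrite hk.
  have alN : (al < N)%N by rewrite /=; clear -h2 h3 h4; lia.
  have beN : (be < N)%N by rewrite /=; clear -h3 h4; lia.
  have mal : (m < al)%N = false -> al = m.
    by move=> h; apply: val_inj => /=; clear -h h1; lia.
  apply/idP/or4P.
    move=> /apex_faceP[x [y [xy eE]]]; rewrite /apex_face_edge.
    case: ifP => [/eqP yN|yN] => [/orP[]/eqP xE|/or3P[/andP[/eqP xE /eqP yE]|/andP[/eqP xE /eqP yE]|mid]].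
    - rewrite eE yN xE set2C; case: ifP => h; first by apply: Or41; rewrite eqxx.
      by apply: Or42; rewrite (mal h) eqxx.
    - by apply: Or44; rewrite eE yN xE eqxx orbT.
    - by apply: Or42; move: xy; rewrite eE xE yE => ->; rewrite set2C eqxx.
    - by apply: Or44; move: xy; rewrite eE xE yE => ->; rewrite eqxx.
    - by apply: Or43; apply/midP; exists x, y.
  have NN (k : I) : (k < l.+2)%N -> (k == N) = false.
    by rewrite -val_eqE /=; clear; lia.
  case=> [/andP[h /eqP->]|/eqP->|/midP[a [b [ab -> mid]]]|/orP[/andP[h /eqP->]|/eqP->]].
  - by rewrite set2C mem_apex_face // /apex_face_edge !eqxx.
  - case: ifP => h; last by rewrite set2C -(mal h) mem_apex_face // /apex_face_edge !eqxx.
    rewrite set2C mem_apex_face // /apex_face_edge NN ?eqxx //; clear -h2 h3 h4; lia.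
  - rewrite mem_apex_face // /apex_face_edge NN ?mid ?orbT //.
    case/and3P: mid => _ /orP[/eqP->//|hb] _; clear -hb h3 h4; lia.
  - by rewrite mem_apex_face // /apex_face_edge NN ?eqxx ?orbT.
  - by rewrite mem_apex_face // /apex_face_edge !eqxx orbT.
split; last by move=> k; rewrite faceE cover_cycle_edges // !inE mems.
exists (N :: s); split=> //=; rewrite /s size_cat /= size_cat.
have : t != [::].
  by apply/eqP => t0; move: lastM; rewrite t0 => /(congr1 val) /=; clear -h1 h2 h3; lia.
by case: (t) => //= _ t' _; clear; lia.
Qed.

End ApexFaces.

(** * Codes of pseudo-triangulations *)

Section ChainCodes.
Context {l : nat} (W : {set 'I_l.+3}).
Local Notation I := 'I_l.+3.
Implicit Types (i j k a b c x y : I) (e : {set I}) (G X Y : {set {set I}}).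

(** The face above the edge ij is of one of two kinds. It is a triangle with third
    vertex b = c; then b has edges on both sides and, being pointed, is not joined to
    the apex. Or it is a face at the apex, which is seen through the gap between b
    and c = b + 1; then b is i itself or the left neighbour of the apex in the face,
    and c is j or the right neighbour. In either case the remaining edges between i
    and j lie within [i, b] and [c, j]. *)
Definition chain_choice i j (bc : I * I) := let: (b, c) := bc in
  [&& b == c, (i < b < j)%N & b \notin W] ||
  [&& c == b.+1 :> nat, (i <= b)%N, (c <= j)%N, (b == i) || (b \in W) & (c == j) || (c \in W)].

Definition chain_choices i j := [seq bc <- enum {: I * I} | chain_choice i j bc].

Definition chain_join i j (bc : I * I) X Y := [set i; j] |: (X :|: Y).

(** Sets of edges of the chain; those at the apex are given by W. *)
Definition chain_splits := splits (fun i j : I => (j <= i)%N) chain_choices set0 chain_join.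

Lemma mem_chain_choices i j b c : ((b, c) \in chain_choices i j) = chain_choice i j (b, c).
Proof. by rewrite mem_filter mem_enum andbT. Qed.

Lemma chain_choice_order i j b c : chain_choice i j (b, c) ->
  [&& (i <= b)%N, (b <= c)%N, (c <= j)%N, (b < j)%N & (i < c)%N].
Proof. by rewrite /= -!val_eqE /=; case: (b \in W); case: (c \in W); lia. Qed.

Lemma chain_choices_gap i j b c : ~~ (j <= i)%N -> (b, c) \in chain_choices i j ->
  ((b - i < j - i) && (j - c < j - i))%N.
Proof. by rewrite mem_chain_choices => _ /chain_choice_order; lia. Qed.

Lemma chain_splits_edges i j G : G \in chain_splits i j ->
  forall e, e \in G -> exists x y, [/\ (i <= x)%N, (x < y)%N, (y <= j)%N & e = [set x; y]].
Proof.
move: i j G; apply: (splits_ind chain_choices_gap) => [i j _ e|]; first by rewrite inE.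
move=> i j b c X Y nl; rewrite mem_chain_choices => /chain_choice_order bc _ _ IX IY e.
rewrite !inE => /or3P[/eqP->|/IX[x [y [h1 h2 h3 ->]]]|/IY[x [y [h1 h2 h3 ->]]]].
- by exists i, j; split=> //; rewrite ltnNge.
- by exists x, y; split=> //; clear -bc h1 h2 h3; lia.
- by exists x, y; split=> //; clear -bc h1 h2 h3; lia.
Qed.

Lemma chain_splits_within i j G x y : G \in chain_splits i j -> [set x; y] \in G ->
  [&& (i <= x)%N, (x <= j)%N, (i <= y)%N & (y <= j)%N].
Proof.
move=> hG /(chain_splits_edges hG)[a [b [h1 h2 h3 /set2_inj[[-> ->]|[-> ->]]]]];
clear -h1 h2 h3; lia.
Qed.

Lemma chain_splits_root i j G : G \in chain_splits i j -> (i < j)%N -> [set i; j] \in G.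
Proof.
rewrite ltnNge => + nl => /(@mem_splits _ _ _ _ _ _ chain_choices_gap _ _ _ nl).
by move=> [b [c [X [Y [_ _ _ ->]]]]]; rewrite !inE eqxx.
Qed.

(** The choice at the root can be read off from the edges at i and j: b is the
    last neighbour of i before j, or i if there is none, and c the first neighbour
    of j after i. *)
Lemma chain_join_edges i j b c X Y : (i < j)%N -> chain_choice i j (b, c) ->
  X \in chain_splits i b -> Y \in chain_splits c j ->
  let G := chain_join i j (b, c) X Y in
  [/\ forall y, (i < y < j)%N -> [set i; y] \in G -> (y <= b)%N,
      (i < b)%N -> [set i; b] \in G,
      forall x, (i < x < j)%N -> [set x; j] \in G -> (c <= x)%N,
      (c < j)%N -> [set c; j] \in G &
      X = [set e in G | e \subset [set k : I | (k <= b)%N]] /\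
      Y = [set e in G | e \subset [set k : I | (c <= k)%N]]].
Proof.
move=> ij /chain_choice_order bc hX hY; split.
- move=> y iy; rewrite !inE => /or3P[/eqP/set2_inj[[_ yj]|[ij' _]]|h|h].
  + by move: iy; rewrite yj ltnn andbF.
  + by rewrite ij' ltnn in ij.
  + by have := chain_splits_within hX h; clear; lia.
  + by have := chain_splits_within hY h; clear -bc; lia.
- by move=> ib; rewrite !inE (chain_splits_root hX ib) orbT.
- move=> x ix; rewrite !inE => /or3P[/eqP/set2_inj[[xi _]|[xj _]]|h|h].
  + by move: ix; rewrite xi ltnn.
  + by move: ix; rewrite xj ltnn andbF.
  + by have := chain_splits_within hX h; clear -bc; lia.
  + by have := chain_splits_within hY h; clear; lia.
- by move=> cj; rewrite !inE (chain_splits_root hY cj) !orbT.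
have sub x y (p : pred I) : ([set x; y] \subset [set k | p k]) = p x && p y.
  by rewrite subUset !sub1set !inE.
split; apply/setP => e; rewrite !inE.
  apply/idP/andP => [eX|[/or3P[/eqP->|//|eY]]].
  - rewrite eX orbT; split=> //; have [x [y [h1 h2 h3 ->]]] := chain_splits_edges hX eX.
    by rewrite sub; clear -h2 h3; lia.
  - by rewrite sub; clear -bc; lia.
  - have [x [y [h1 h2 h3 ->]]] := chain_splits_edges hY eY.
    by rewrite sub; clear -bc h1 h2; lia.
apply/idP/andP => [eY|[/or3P[/eqP->|eX|//]]].
- rewrite eY !orbT; split=> //; have [x [y [h1 h2 h3 ->]]] := chain_splits_edges hY eY.
  by rewrite sub; clear -h2 h1; lia.
- by rewrite sub; clear -bc; lia.
- have [x [y [h1 h2 h3 ->]]] := chain_splits_edges hX eX.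
  by rewrite sub; clear -bc h3 h2; lia.
Qed.

Lemma chain_splits_uniq i j : uniq (chain_splits i j).
Proof.
apply: (splits_uniq chain_choices_gap) => {i j} [i j|].
  by rewrite filter_uniq // enum_uniq.
move=> i j b c X Y b' c' X' Y'; rewrite -ltnNge !mem_chain_choices => ij h hX hY h' hX' hY' E.
have [h1 h2 h3 h4 [h5 h6]] := chain_join_edges ij h hX hY.
have [h1' h2' h3' h4' [h5' h6']] := chain_join_edges ij h' hX' hY'.
have o := chain_choice_order h; have o' := chain_choice_order h'.
rewrite -E in h1' h2' h3' h4' h5' h6'.
have bb : b = b'.
  apply/val_inj/eqP; rewrite /= eqn_leq; apply/andP; split; rewrite leqNgt; apply/negP => lt.
    have : (b <= b')%N.
      by apply: h1'; [clear -lt o o'; lia|apply: h2; clear -lt o o'; lia].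
    by rewrite leqNgt lt.
  have : (b' <= b)%N.
    by apply: h1; [clear -lt o o'; lia|apply: h2'; clear -lt o o'; lia].
  by rewrite leqNgt lt.
have cc : c = c'.
  apply/val_inj/eqP; rewrite /= eqn_leq; apply/andP; split; rewrite leqNgt; apply/negP => lt.
    have : (c <= c')%N.
      by apply: h3; [clear -lt o o'; lia|apply: h4'; clear -lt o o'; lia].
    by rewrite leqNgt lt.
  have : (c' <= c)%N.
    by apply: h3'; [clear -lt o o'; lia|apply: h4; clear -lt o o'; lia].
  by rewrite leqNgt lt.
by split; [rewrite bb cc|rewrite h5 h5' bb|rewrite h6 h6' cc].
Qed.

End ChainCodes.

(** * The code of a pseudo-triangulation *)

Lemma cycle_nbrs_with (I : finType) (F : {set {set I}}) k v : is_cycle F ->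
  [set k; v] \in F -> exists x, nbrs_of F k v x.
Proof.
move=> cF kv; have kF : k \in cover F.
  by apply/bigcupP; exists [set k; v]; rewrite // !inE eqxx.
have [u [w nb]] := cycle_nbrs cF kF; move: kv; rewrite (nbrs_sym _ nb).
by move=> /orP[]/eqP->; [exists w|exists u; apply: nbrs_swap].
Qed.

(** The two edges of F at a vertex are already all the edges of F' there. *)
Lemma cycle_subset_eq (I : finType) (F F' : {set {set I}}) : is_cycle F -> is_cycle F' ->
  F \subset F' -> cover F' \subset cover F -> F = F'.
Proof.
move=> cF cF' sub cov; apply/eqP; rewrite eqEsubset sub; apply/subsetP => e eF'.
have [x [y [xy eE]]] := cycle_edge2 cF' eF'; rewrite {}eE in eF' *.
have xF' : x \in cover F' by apply/bigcupP; exists [set x; y]; rewrite // !inE eqxx.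
have [u [w nb]] := cycle_nbrs cF (subsetP cov x xF').
have [u' [w' nb']] := cycle_nbrs cF' xF'.
have uF : [set x; u] \in F by rewrite (nbrs_sym _ nb) eqxx.
have wF : [set x; w] \in F by rewrite (nbrs_sym _ nb) eqxx orbT.
move: (subsetP sub _ uF) (subsetP sub _ wF) eF'; rewrite !(nbrs_sym _ nb') (nbrs_sym _ nb).
have [uw _ _ _] := nb.
by move=> /orP[]/eqP uE /orP[]/eqP wE; move: uw; rewrite uE wE ?eqxx // orbC.
Qed.

Section PseudoTriangulation.
Context {R : realType} {l : nat} (A : 'I_l.+3 -> 'rV[R]_2) (s : R).
Local Notation I := 'I_l.+3.
Local Notation N := (@ord_max l.+2).
Local Notation oA i j z := (orient (A i) (A j) z).
Implicit Types (i j k a b x y u v w al be m M : I) (z g c : 'rV[R]_2).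
Implicit Types (e : {set I}) (F G : {set {set I}}).
Context (gp : general_position A)
  (apexA : forall i j, (i < j < l.+2)%N -> 0 < s * oA N i (A j))
  (chainA : forall i j k, (i < j < k)%N -> (k < l.+2)%N -> s * oA i j (A k) < 0).
Context (T : {set {set {set I}}}) (hT : pseudo_triangulation A T).

Definition chain_end : I := inord l.+1.

Lemma chain_endE : chain_end = l.+1 :> nat.
Proof. by rewrite inordK. Qed.

Lemma pt_faces : [/\ forall F, F \in T -> pseudo_triangle A F, generic_partition A T
  & \bigcup_(F in T) vertices F = setT].
Proof.
by apply/(polygonal_partitionP _ gp (card_gt2 (l := l))) => // F [[cF _] _].
Qed.

Lemma pt_simple F : F \in T -> simple_polygon A F.
Proof. by have [h _ _] := pt_faces => /h[]. Qed.

Lemma pt_cycle F : F \in T -> is_cycle F.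
Proof. by move=> /pt_simple[]. Qed.

Lemma pt_edge F e : F \in T -> e \in F -> e \in edges T.
Proof. by move=> FT eF; apply/bigcupP; exists F. Qed.

Lemma pt_nocross x u y v : (x < u < y)%N -> (y < v < l.+2)%N ->
  [set x; y] \in edges T -> [set u; v] \in edges T -> False.
Proof.
have [_ gpT _] := pt_faces; exact: (faces_nocross gp apexA chainA pt_simple gpT).
Qed.

Lemma pt_uncrossed F x y : F \in T -> [set x; y] \in edges T -> (x < y < l.+2)%N ->
  uncrossed F x y.
Proof.
move=> FT xyT xy u v uv uvF; have uvT := pt_edge FT uvF; split; apply/negP => h.
  by apply: (pt_nocross _ _ xyT uvT); clear -h xy uv; lia.
by apply: (pt_nocross _ _ uvT xyT); clear -h xy uv; lia.
Qed.

Lemma nbrs_apex F : F \in T -> N \in cover F ->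
  exists al be, nbrs_of F N al be /\ (al < be < l.+2)%N.
Proof.
move=> FT NF; have [u [w nb]] := cycle_nbrs (pt_cycle FT) NF.
have [uw uN wN _] := nb; rewrite neqN in uN; rewrite neqN in wN.
have [h|h|/val_inj h] := ltngtP u w.
- by exists u, w; rewrite h.
- by exists w, u; rewrite h; split=> //; apply: nbrs_swap.
- by rewrite h eqxx in uw.
Qed.

(** The face at the points close to the apex, in the direction between a and a + 1. *)
Lemma top_face a : (a < l.+1)%N ->
  exists F al be, [/\ F \in T, nbrs_of F N al be, (al <= a < be)%N & (be < l.+2)%N].
Proof.
move=> al1; have bl : (a.+1 < l.+3)%N by clear -al1; lia.
pose b : I := Ordinal bl.
have [z [gz hz zE]] := point_apex gp apexA (erefl : b = a.+1 :> nat) al1.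
have [_ [cov _] _] := pt_faces; have [F FT pF] := cov z gz hz.
have cF := pt_cycle FT; rewrite zE // in pF.
have NF : N \in cover F.
  by apply: contraTT pF => /(up_wedge_noapex cF (erefl : b = a.+1 :> nat) al1)->.
have [al [be [nb /andP[albe bel]]]] := nbrs_apex FT NF.
exists F, al, be; split=> //.
move: pF; rewrite (up_wedge_apex cF (erefl : b = a.+1 :> nat) al1 nb); clear -albe; lia.
Qed.

Lemma top_face_unique F G a al be al' be' : F \in T -> G \in T ->
  nbrs_of F N al be -> (al <= a < be)%N -> (be < l.+2)%N ->
  nbrs_of G N al' be' -> (al' <= a < be')%N -> F = G.
Proof.
move=> FT GT nb ab bel nb' ab'; have al1 : (a < l.+1)%N by clear -ab bel; lia.
have bl : (a.+1 < l.+3)%N by clear -al1; lia.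
pose b : I := Ordinal bl.
have [z [gz hz zE]] := point_apex gp apexA (erefl : b = a.+1 :> nat) al1.
have [_ [_ dis] _] := pt_faces; apply: (dis z) => //; rewrite zE; try exact: pt_cycle.
  rewrite (up_wedge_apex (pt_cycle FT) (erefl : b = a.+1 :> nat) al1 nb); clear -ab; lia.
rewrite (up_wedge_apex (pt_cycle GT) (erefl : b = a.+1 :> nat) al1 nb'); clear -ab'; lia.
Qed.

(** The face at the points just above the edge xy. *)
Lemma above_face x y : (x < y < l.+2)%N -> [set x; y] \in edges T ->
  exists2 F, F \in T & up F x y.
Proof.
move=> xy xyT; have [z [gz hz zE]] := point_above gp apexA chainA xy.
have [_ [cov _] _] := pt_faces; have [F FT pF] := cov z gz hz.
by exists F; rewrite // -zE //; [apply: pt_cycle|apply: pt_uncrossed].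
Qed.

Lemma above_face_unique F G x y : (x < y < l.+2)%N -> [set x; y] \in edges T ->
  F \in T -> G \in T -> up F x y -> up G x y -> F = G.
Proof.
move=> xy xyT FT GT uF uG; have [z [gz hz zE]] := point_above gp apexA chainA xy.
have [_ [_ dis] _] := pt_faces.
by apply: (dis z) => //; rewrite zE //; try exact: pt_cycle; exact: pt_uncrossed.
Qed.

(** If the face F above the edge were not bounded by it, then F would also lie
    below it. A face G bounded by the edge lies on one of the two sides, hence
    equals F. *)
Lemma above_face_edge F x y : (x < y < l.+2)%N -> (0 < x)%N || (y < l.+1)%N ->
  [set x; y] \in edges T -> F \in T -> up F x y -> [set x; y] \in F.
Proof.
move=> xy out xyT FT uF; apply/negPn/negP => nxyF.
have [G GT xyG] := bigcupP xyT.
suff FG : F = G by rewrite FG xyG in nxyF.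
have [uG|nuG] := boolP (up G x y); first exact: (above_face_unique xy xyT).
have [k [kl kxy]] : exists k, (k < l.+2)%N /\ (k < x)%N || (y < k)%N.
  have [x0|x0] := posnP x; last first.
    by exists ord0; split=> //=; rewrite x0.
  exists chain_end; rewrite chain_endE; split=> //.
  by move: out; rewrite x0 /= => ->.
have [z [gz hz zE]] := point_below gp apexA chainA xy kl kxy.
have [_ [_ dis] _] := pt_faces.
apply: (dis z) => //; rewrite zE //; try exact: pt_cycle; try exact: pt_uncrossed.
  by rewrite uF (negbTE nxyF).
by rewrite (negbTE nuG) xyG.
Qed.

(** The points just above the segment from 0 to l + 1 are inside some face, which needs an
    edge that spans the whole chain. *)
Lemma root_edge : [set ord0; chain_end] \in edges T.
Proof.
have xy : (@ord0 l.+2 < chain_end < l.+2)%N by rewrite chain_endE ltnSn.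
have [z [gz hz zE]] := point_above gp apexA chainA xy.
have [_ [cov _] _] := pt_faces; have [F FT pF] := cov z gz hz.
have cF := pt_cycle FT; rewrite zE // in pF; last first.
  by move=> u v uv _; rewrite chain_endE /=; clear -uv; lia.
have [e eF /existsP[u /existsP[v /and5P[uv vl /eqP eE u0 ev]]]] := xor_exists pF.
apply: (pt_edge FT); rewrite -(_ : e = [set ord0; chain_end]) // eE.
have -> : u = ord0 by apply: val_inj; rewrite /=; clear -u0; move: u0 => /=; lia.
by have -> : v = chain_end by apply: val_inj => /=; move: ev; rewrite chain_endE; clear -vl; lia.
Qed.

Lemma apex_edge0 : [set N; ord0] \in edges T.
Proof.
have [F [al [be [FT nb ab _]]]] := top_face (isT : (@ord0 l.+2 < l.+1)%N).
have -> : ord0 = al by apply: val_inj => /=; move: ab => /=; clear; lia.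
by apply: (pt_edge FT); rewrite (nbrs_sym _ nb) eqxx.
Qed.

Lemma apex_edge_end : [set N; chain_end] \in edges T.
Proof.
have il : @inord l.+2 l = l :> nat by rewrite inordK //; clear; lia.
have al : (@inord l.+2 l < l.+1)%N by rewrite il.
have [F [al' [be [FT nb ab bel]]]] := top_face al.
have -> : chain_end = be.
  by apply: val_inj => /=; rewrite chain_endE; move: ab; rewrite il; clear -bel; lia.
by apply: (pt_edge FT); rewrite (nbrs_sym _ nb) eqxx orbT.
Qed.

(** Every vertex in the angle of a face at the apex is a vertex of that face,
    since otherwise it would lie inside. *)
Lemma apex_face_full F al be k : F \in T -> nbrs_of F N al be -> (be < l.+2)%N ->
  (al < k < be)%N -> k \in cover F.
Proof.
move=> FT nb bel kab; apply/negPn/negP => nkF; have cF := pt_cycle FT.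
have kl : (k < l.+2)%N by clear -kab bel; lia.
have [_ _ cvr] := pt_faces.
have /bigcupP[G GT kG] : k \in \bigcup_(F in T) vertices F by rewrite cvr inE.
have FG : F <> G by move=> h; rewrite h kG in nkF.
have [u [w nbk]] := cycle_nbrs (pt_cycle GT) kG.
have kuG : [set k; u] \in G by rewrite (nbrs_sym _ nbk) eqxx.
have kuT := pt_edge GT kuG.
have [uN|uN] := eqVneq u N.
  move: kuG; rewrite uN set2C => NkG.
  have [x nbG] := cycle_nbrs_with (pt_cycle GT) NkG.
  have [kx xN] : k != x /\ (x < l.+2)%N by case: nbG => h _ xN _; rewrite -neqN.
  have [h|h|/val_inj h] := ltngtP k x; last by rewrite h eqxx in kx.
    apply: FG; apply: (@top_face_unique F G k al be k x) => //; clear -kab h; lia.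
  have kl' : (k.-1 < l.+3)%N by clear -kl; lia.
  apply: FG; apply: (@top_face_unique F G (Ordinal kl') al be x k) => //=.
  - by clear -kab; lia.
  - exact: nbrs_swap.
  - by clear -h; lia.
rewrite neqN in uN.
have [_ uk _ _] := nbk.
have vert p q : [set p; q] \in F -> p != k /\ q != k.
  move=> pqF; split; apply: contraNneq nkF => <-; apply/bigcupP; exists [set p; q];
  by rewrite // !inE eqxx ?orbT.
have nxF p q : [set p; q] = [set k; u] -> [set p; q] \notin F.
  by move=> ->; apply/negP => /vert[]; rewrite eqxx.
have [ku|uk'|/val_inj h] := ltngtP k u; last by rewrite h eqxx in uk.
  have bl : (k.+1 < l.+3)%N by clear -kl; lia.
  pose b : I := Ordinal bl.
  have xy : (k < u < l.+2)%N by rewrite ku.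
  have : [set k; u] \in F; last by apply/negP/nxF.
  apply: above_face_edge => //; first by clear -kab; lia.
  have -> : up F k u = up F k b; last first.
    rewrite (up_wedge_apex cF (erefl : b = k.+1 :> nat) _ nb) /=; clear -kab bel; lia.
  apply: eq_bigr => e eF; have [[q qN ->]|[p [q [pq eE]]]] := cycle_edgeP cF eF.
    by rewrite !spans_N.
  rewrite {}eE in eF *; rewrite !spansE //=; have [pk qk] := vert _ _ eF.
  have [_] := pt_uncrossed FT kuT xy pq eF.
  move: pk; rewrite -val_eqE /=; clear -pq ku; lia.
have bl : (k.-1 < l.+3)%N by clear -kl; lia.
pose b : I := Ordinal bl.
have xy : (u < k < l.+2)%N by rewrite uk'.
rewrite set2C in kuT.
have : [set u; k] \in F; last by apply/negP/nxF; rewrite set2C.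
apply: above_face_edge => //; first by clear -kab bel; lia.
have bk : k = b.+1 :> nat by rewrite /= prednK //; clear -uk'; lia.
have -> : up F u k = up F b k; last first.
  rewrite (up_wedge_apex cF bk _ nb) //=; clear -kab bel; lia.
apply: eq_bigr => e eF; have [[q qN ->]|[p [q [pq eE]]]] := cycle_edgeP cF eF.
  by rewrite !spans_N.
rewrite {}eE in eF *; rewrite !spansE //=; have [pk qk] := vert _ _ eF.
have [+ _] := pt_uncrossed FT kuT xy pq eF.
move: qk; rewrite -val_eqE /=; clear -pq uk'; lia.
Qed.

End PseudoTriangulation.

Section ApexEdges.
Context {l : nat}.
Local Notation I := 'I_l.+3.
Local Notation N := (@ord_max l.+2).
Implicit Types (i j k b p q x y u v m al be M : I).

Lemma apex_face_edge_mid m al be M p q b : corner_order m al be M -> (p < q < l.+2)%N ->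
  (al <= b < be)%N -> (p <= b < q)%N -> apex_face_edge m al be M p q ->
  mid_edge m al be M p q.
Proof.
move=> o pq ab pb; rewrite /apex_face_edge; case: eqP => [qN|_].
  by move: pq; rewrite qN /=; clear; lia.
by rewrite -!val_eqE /= => /or3P[h|h|//]; clear -h pb ab; lia.
Qed.

Lemma mid_edge_unique m al be M p q x y b : corner_order m al be M ->
  (al <= b < be)%N -> (p <= b < q)%N -> (x <= b < y)%N ->
  mid_edge m al be M p q -> mid_edge m al be M x y -> p = x /\ q = y.
Proof.
move=> o ab pb xb /and3P[h1 h2 /forallP h3] /and3P[h4 h5 /forallP h6].
have := h3 x; have := h3 y; have := h6 p; have := h6 q => {h3 h6}.
by move: h1 h2 h4 h5 o; rewrite -!val_eqE /= /corner_order => *; split; apply: val_inj => /=; lia.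
Qed.

End ApexEdges.

Section PseudoTriangulationFaces.
Context {R : realType} {l : nat} (A : 'I_l.+3 -> 'rV[R]_2) (s : R).
Local Notation I := 'I_l.+3.
Local Notation N := (@ord_max l.+2).
Local Notation oA i j z := (orient (A i) (A j) z).
Implicit Types (i j k a b c x y u v w al be m M : I) (z g : 'rV[R]_2).
Implicit Types (e : {set I}) (F G : {set {set I}}).
Context (gp : general_position A)
  (apexA : forall i j, (i < j < l.+2)%N -> 0 < s * oA N i (A j))
  (chainA : forall i j k, (i < j < k)%N -> (k < l.+2)%N -> s * oA i j (A k) < 0).
Context (T : {set {set {set I}}}) (hT : pseudo_triangulation A T).

(** The edge from 0 to l + 1, which has nothing below it, is the only edge that spans the
    whole chain. *)
Lemma above_face_mem F x y : (x < y < l.+2)%N -> [set x; y] \in edges T ->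
  F \in T -> up F x y -> [set x; y] \in F.
Proof.
move=> xy xyT FT uF; have [out|] := boolP ((0 < x)%N || (y < l.+1)%N).
  exact: (above_face_edge gp apexA chainA hT xy out xyT FT uF).
rewrite negb_or -!leqNgt => /andP[x0 yl].
have [e eF /existsP[u /existsP[v /and5P[uv vl /eqP eE ux yv]]]] := xor_exists uF.
rewrite -(_ : e = [set x; y]) // eE.
have -> : u = x by apply: val_inj => /=; clear -ux x0; lia.
by have -> : v = y by apply: val_inj => /=; clear -vl yv xy yl; lia.
Qed.

(** The corners are those of any pseudo-triangle at the apex, and all the vertices in the
    angle at the apex belong to the face. Since the face is simple, its edges can
    only join consecutive vertices, so that it has the edges of apex_face. *)
Lemma apex_face_shape F : F \in T -> N \in cover F -> exists m al be M,
  [/\ corner_order m al be M, nbrs_of F N al be & F = apex_face m al be M].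
Proof.
move=> FT NF; have [al [be [nb /andP[albe bel]]]] := nbrs_apex gp hT FT NF.
have cF := pt_cycle gp hT FT; have [ptF _ _] := pt_faces gp hT.
have NalF : [set al; N] \in F by rewrite set2C (nbrs_sym _ nb) eqxx.
have NbeF : [set be; N] \in F by rewrite set2C (nbrs_sym _ nb) eqxx orbT.
have [x nbal] := cycle_nbrs_with cF NalF; have [y nbbe] := cycle_nbrs_with cF NbeF.
have [sF out] := (pseudo_triangle_corners gp apexA chainA cF nb albe nbal nbbe).1 (ptF F FT).
have /and3P[mal beM Ml] := corners_order x nb nbbe.
have /andP[mF MF] := corners_cover nbal nbbe.
have mE : (first_corner al x == x) && (x < al)%N || (first_corner al x == al) && (al < x)%N.
  have [_ _ xal _] := nbal; move: xal; rewrite /first_corner -!val_eqE /=.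
  by case: ifP; clear; lia.
have ME : (last_corner be y == y) && (be < y)%N || (last_corner be y == be) && (y < be)%N.
  have [_ _ ybe _] := nbbe; move: ybe; rewrite /last_corner -!val_eqE /=.
  by case: ifP; clear; lia.
move: (first_corner al x) (last_corner be y) mal beM Ml mF MF out mE ME => m M.
move=> mal beM Ml mF MF out mE ME.
have o : corner_order m al be M by rewrite /corner_order mal albe beM.
exists m, al, be, M; split=> //; have [cS covS] := apex_face_cycle o.
have full := apex_face_full gp apexA chainA hT FT nb bel.
have [Nin alF beF] := nbrs_mem nb.
have inF k : k \in cover F -> [|| k == N, k == m, k == M | (al <= k <= be)%N].
  move=> kF; have [//|kN] := eqVneq k N.
  have [_|h] := boolP (al <= k <= be)%N; first by rewrite !orbT.
  by have := out k kF kN h; rewrite !inE orbF.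
have vert p q : [set p; q] \in F -> (p \in cover F) && (q \in cover F).
  by move=> pqF; apply/andP; split; apply/bigcupP; exists [set p; q]; rewrite // !inE eqxx ?orbT.
apply: cycle_subset_eq => //; last first.
  apply/subsetP => k; rewrite covS => /or4P[/eqP->|/eqP->|/eqP->|/andP[]] //.
  rewrite leq_eqVlt => /orP[/eqP/val_inj<-//|alk].
  by rewrite leq_eqVlt => /orP[/eqP/val_inj->//|kbe]; apply: full; rewrite alk.
apply/subsetP => e eF; have [[k kl eE]|[u [v [uv eE]]]] := cycle_edgeP cF eF.
  rewrite eE set2C mem_apex_face ?kl // /apex_face_edge eqxx.
  by rewrite -(nbrs_sym _ nb) -eE.
rewrite {}eE in eF *; rewrite mem_apex_face; last by clear -uv; lia.
have vN : (v == N) = false by rewrite -val_eqE /=; clear -uv; lia.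
have uN : (u == N) = false by rewrite -val_eqE /=; clear -uv; lia.
have /andP[uF vF] := vert _ _ eF; have := inF u uF; have := inF v vF.
rewrite /apex_face_edge vN uN /= => hv hu.
have alE t : [set al; t] \in F -> t != N -> t = x.
  by rewrite (nbrs_sym _ nbal) => /orP[/eqP->|/eqP//]; rewrite eqxx.
have beE t : [set be; t] \in F -> t != N -> t = y.
  by rewrite (nbrs_sym _ nbbe) => /orP[/eqP->|/eqP//]; rewrite eqxx.
have ualE : (u == al) ==> (v == x).
  by apply/implyP => /eqP ua; apply/eqP/alE; [rewrite -ua|rewrite vN].
have valE : (v == al) ==> (u == x).
  by apply/implyP => /eqP va; apply/eqP/alE; [rewrite -va set2C|rewrite uN].
have ubeE : (u == be) ==> (v == y).
  by apply/implyP => /eqP ub; apply/eqP/beE; [rewrite -ub|rewrite vN].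
have vbeE : (v == be) ==> (u == y).
  by apply/implyP => /eqP vb; apply/eqP/beE; [rewrite -vb set2C|rewrite uN].
have [//|nleft] := boolP ((u == m) && (v == al)).
have [|nright] := boolP ((u == be) && (v == M)); first by rewrite orbT.
apply/and3P; split.
- move: hu hv ualE ubeE nright mE ME uv; rewrite -!val_eqE /=.
  by clear -mal albe beM; lia.
- move: hu hv valE vbeE nleft mE ME uv; rewrite -!val_eqE /=.
  by clear -mal albe beM; lia.
(* a vertex k between u and v is joined to the apex by a path that avoids u and
   v, but no edge leads from the vertices between u and v to the others *)
apply/forallP => k; apply/negP => /andP[kab kuv].
have NS : N \in [set i : I | (al < i < be)%N && (u < i < v)%N]; last first.
  by move: NS; rewrite !inE /=; clear -bel; lia.
have ne (p q : I) : (p < q)%N || (q < p)%N -> p != q by rewrite -val_eqE /=; clear; lia.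
have uout (t : I) : (u < t < v)%N -> t \notin [set u; v].
  by move=> utv; rewrite !inE negb_or !ne //; clear -utv; lia.
apply: (cycle_connected (k := k) cF eF) => //.
- move=> a b abF _ bnot; rewrite !inE => /andP[aab auv].
  have al_a : a != al by apply: ne; clear -aab; lia.
  have be_a : a != be by apply: ne; clear -aab; lia.
  have bN : b != N.
    apply: contraTneq abF => ->; rewrite set2C (nbrs_sym _ nb) negb_or.
    by rewrite al_a be_a.
  have aN : a != N by rewrite neqN; clear -aab bel; lia.
  have /andP[_ bF] := vert _ _ abF; have := inF b bF.
  have balE : (b == al) ==> (a == x).
    by apply/implyP => /eqP ba; apply/eqP/alE; [rewrite -ba set2C|exact: aN].
  have bbeE : (b == be) ==> (a == y).
    by apply/implyP => /eqP bb; apply/eqP/beE; [rewrite -bb set2C|exact: aN].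
  have nc1 : ~~ ((b < u) && (u < a < v))%N.
    apply/negP => /andP[bu uav]; rewrite set2C in abF.
    by apply: (simple_nocross apexA chainA sF _ _ abF eF); clear -bu uav uv; lia.
  have nc2 : ~~ ((v < b) && (u < a < v))%N.
    apply/negP => /andP[vb uav]; rewrite neqN in bN.
    by apply: (simple_nocross apexA chainA sF _ _ eF abF); clear -vb uav bN; lia.
  rewrite (negbTE bN) => hb; move: hb hu hv balE bbeE nc1 nc2 bnot mE ME.
  by rewrite !inE negb_or -!val_eqE /=; clear -aab auv mal albe beM; lia.
- by rewrite !inE negb_or ![N == _]eq_sym uN vN.
- by apply: full.
- exact: uout.
- by rewrite inE kab kuv.
Qed.

End PseudoTriangulationFaces.

Section Codes.
Context {R : realType} {l : nat} (A : 'I_l.+3 -> 'rV[R]_2) (s : R).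
Local Notation I := 'I_l.+3.
Local Notation N := (@ord_max l.+2).
Local Notation oA i j z := (orient (A i) (A j) z).
Implicit Types (i j k a b c x y u v w al be m M : I) (z g : 'rV[R]_2).
Implicit Types (e : {set I}) (F G : {set {set I}}).
Context (gp : general_position A)
  (apexA : forall i j, (i < j < l.+2)%N -> 0 < s * oA N i (A j))
  (chainA : forall i j k, (i < j < k)%N -> (k < l.+2)%N -> s * oA i j (A k) < 0).

Section OnePseudoTriangulation.
Context (T : {set {set {set I}}}) (hT : pseudo_triangulation A T).

Lemma pt_edgeP e : e \in edges T -> (exists2 k : I, (k < l.+2)%N & e = [set N; k]) \/
  (exists x y : I, (x < y < l.+2)%N /\ e = [set x; y]).
Proof.
by move=> /bigcupP[F FT eF]; apply: (cycle_edgeP (pt_cycle gp hT FT) eF).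
Qed.

(** A ray from the apex in the angle of the face F first stays in F. If uv were met
    before the edge xy of F, then uv would lie inside the angle and have F above it,
    so that it would be an edge of F itself. *)
Lemma first_edge F m al be M b x y u v : F \in T -> F = apex_face m al be M ->
  nbrs_of F N al be -> corner_order m al be M -> (al <= b < be)%N ->
  mid_edge m al be M x y -> (x <= b < y)%N ->
  [set u; v] \in edges T -> (u <= b < v)%N -> (v < l.+2)%N ->
  (u <= x)%N && (y <= v)%N.
Proof.
move=> FT FE nb o ab mid xb uvT ub vl; have cF := pt_cycle gp hT FT.
have ab' := ab; have /and4P[mal albe beM Ml] := o.
have yl : (y < l.+2)%N.
  by case/and3P: mid => _ /orP[/eqP->//|h] _; clear -h beM Ml; lia.
have xy : (x < y < l.+2)%N by rewrite yl andbT; clear -xb; lia.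
have uv : (u < v < l.+2)%N by rewrite vl andbT; clear -ub; lia.
have xyF : [set x; y] \in F.
  rewrite FE mem_apex_face; last by clear -xb; lia.
  rewrite /apex_face_edge mid !orbT; case: eqP => // yN.
  by move: yl; rewrite yN ltnn.
have [//|nle] := boolP ((u <= x)%N && (y <= v)%N).
have xyT := pt_edge FT xyF.
have inner : (x <= u)%N && (v <= y)%N.
  have n1 : ~~ ((x < u < y)%N && (y < v)%N).
    by apply/negP => h; apply: (pt_nocross gp apexA chainA hT _ _ xyT uvT); clear -h vl; lia.
  have n2 : ~~ ((u < x < v)%N && (v < y)%N).
    by apply/negP => h; apply: (pt_nocross gp apexA chainA hT _ _ uvT xyT); clear -h yl; lia.
  by clear -n1 n2 nle xb ub; lia.
have only (p q : I) : (p < q < l.+2)%N -> [set p; q] \in F -> (p <= b < q)%N -> p = x /\ q = y.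
  move=> pq; rewrite FE mem_apex_face; last by clear -pq; lia.
  move=> pqE pb; have mid' := apex_face_edge_mid o pq ab pb pqE.
  exact: (mid_edge_unique o ab pb xb mid' mid).
have upF : up F u v.
  rewrite /up (bigD1 [set x; y]) //= spansE // inner big1 // => e /andP[eF ne].
  have [[k kN ->]|[p [q [pq eE]]]] := cycle_edgeP cF eF; first by rewrite spans_N.
  rewrite {}eE in eF ne *; rewrite spansE //; apply/negbTE/negP => h.
  have [px qy] : p = x /\ q = y by apply: (only _ _ pq eF); clear -h ub; lia.
  by rewrite px qy eqxx in ne.
have uvF := above_face_mem gp apexA chainA hT uv uvT FT upF.
by have [ux vy] := only _ _ uv uvF ub; move: nle; rewrite ux vy !leqnn.
Qed.

(** The edges from m to al and from be to M lie outside the angle at the apex, and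
    the face lies below them. *)
Lemma below_apex_face F m al be M i j : F \in T -> F = apex_face m al be M ->
  nbrs_of F N al be -> corner_order m al be M -> (i < j < l.+2)%N ->
  [set i; j] \in F -> up F i j -> mid_edge m al be M i j.
Proof.
move=> FT FE nb o ij ijF upF; have cF := pt_cycle gp hT FT.
have /and4P[mal albe beM Ml] := o; have [_ cov] := apex_face_cycle o.
have jN : (j == N) = false by rewrite -val_eqE /=; clear -ij; lia.
have vert (p q : I) : (p < q < l.+2)%N -> [set p; q] \in F ->
    (m <= p)%N && (q <= M)%N && ((p < al)%N ==> (p == m)) && ((be < q)%N ==> (q == M)).
  move=> pq pqF.
  have : (p \in cover F) && (q \in cover F).
    by apply/andP; split; apply/bigcupP; exists [set p; q]; rewrite // !inE eqxx ?orbT.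
  by rewrite FE !cov -!val_eqE /=; clear -pq mal albe beM; lia.
move: (ijF); rewrite {1}FE mem_apex_face; last by clear -ij; lia.
rewrite /apex_face_edge jN => /or3P[/andP[/eqP im /eqP ja]|/andP[/eqP ib /eqP jM]|//]; exfalso.
  subst i j; have bl : (al.-1 < l.+3)%N by clear -ij; lia.
  pose b : I := Ordinal bl; have ab : al = b.+1 :> nat by rewrite /= prednK //; clear -ij; lia.
  have : up F b al = false.
    rewrite (up_wedge_apex cF ab _ nb) /=; last by clear -ij; lia.
    by clear -ij albe; lia.
  suff -> : up F b al = up F m al by rewrite upF.
  apply: eq_bigr => e eF; have [[q qN ->]|[p [q [pq eE]]]] := cycle_edgeP cF eF.
    by rewrite !spans_N.
  rewrite {}eE in eF *; rewrite !spansE //=.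
  by have := vert _ _ pq eF; rewrite -!val_eqE /=; clear -ij mal; lia.
subst i j; have bl : (be.+1 < l.+3)%N by clear -ij; lia.
pose b : I := Ordinal bl; have ab : b = be.+1 :> nat by [].
have : up F be b = false.
  rewrite (up_wedge_apex cF ab _ nb) /=; last by clear -ij; lia.
  by clear -ij albe; lia.
suff -> : up F be b = up F be M by rewrite upF.
apply: eq_bigr => e eF; have [[q qN ->]|[p [q [pq eE]]]] := cycle_edgeP cF eF.
  by rewrite !spans_N.
rewrite {}eE in eF *; rewrite !spansE //=.
by have := vert _ _ pq eF; rewrite -!val_eqE /=; clear -ij beM; lia.
Qed.

(** The edges from k to the apex, x and y have a positive combination equal to
    zero, whereas the linear form f is positive on all the edges at a pointed
    vertex. *)
Lemma pointed_one_side k x y : pointed A T k -> (x < k < y)%N -> (y < l.+2)%N ->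
  [set N; k] \in edges T -> [set x; k] \in edges T -> [set k; y] \in edges T -> False.
Proof.
move=> [u [w [ku kw uw ext]]] xky yl Nk xk ky.
pose f t := oA k u (A t) + oA k t (A w).
have fpos t : [set k; t] \in edges T -> 0 < f t.
  move=> kt; rewrite /f; have [->|tu] := eqVneq t u; first by rewrite orientxy add0r.
  have [->|tw] := eqVneq t w; first by rewrite orientxy addr0.
  by have [h1 h2] := ext t kt tu tw; rewrite addr_gt0.
rewrite set2C in xk; rewrite set2C in Nk.
have c1 : 0 < s * oA k x (A y) by rewrite orientNl mulrN oppr_gt0 chainA.
have c2 : 0 < s * oA k y (A N).
  by apply: (chord_apex apexA); rewrite yl andbT; clear -xky; lia.
have c3 : 0 < s * oA k N (A x).
  rewrite orientNl mulrN oppr_gt0; apply: (apex_lt apexA); clear -xky yl; lia.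
have : s * oA k x (A y) * f N + s * oA k y (A N) * f x + s * oA k N (A x) * f y = 0.
  by rewrite /f /orient; ring.
have := mulr_gt0 c1 (fpos _ Nk); have := mulr_gt0 c2 (fpos _ xk).
have := mulr_gt0 c3 (fpos _ ky); move: (f N) (f x) (f y) => *; lra.
Qed.

End OnePseudoTriangulation.

Context (W : {set I}).

Definition chain_code (T : {set {set {set I}}}) : {set {set I}} :=
  [set e in edges T | N \notin e].

Definition code_within (T : {set {set {set I}}}) i j : {set {set I}} :=
  [set e in edges T | e \subset [set k : I | (i <= k <= j)%N]].

Definition in_PPT T := pointed_pseudo_triangulation A T /\
  (forall i, i \in inner l -> ([set N; i] \in edges T <-> i \in W)).

(** By induction on the interval: the edges between i and j are ij and the edges within
    the two parts, because the face above ij shields them from each other. *)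
Lemma PPT_code T : in_PPT T -> chain_code T \in chain_splits W ord0 chain_end.
Proof.
move=> [[hT pT] TW]; have eP := pt_edgeP hT.
have nc := pt_nocross gp apexA chainA hT.
have apexW k : (0 < k < l.+1)%N -> [set N; k] \in edges T -> k \in W.
  by move=> kl /TW h; apply: h; rewrite inE; clear -kl; lia.
suff main i j : (j < l.+2)%N -> (i <= j)%N -> i = j \/ [set i; j] \in edges T ->
    code_within T i j \in chain_splits W i j.
  have -> : chain_code T = code_within T ord0 chain_end.
    apply/setP => e; rewrite !inE; have [eT|//] := boolP (e \in edges T).
    have [[k kN ->]|[x [y [xy ->]]]] := eP e eT.
      rewrite !inE eqxx /= subUset !sub1set !inE chain_endE /=; clear -kN; lia.
    rewrite subUset !sub1set !inE chain_endE -!val_eqE /=; clear -xy; lia.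
  by apply: main; rewrite ?chain_endE //; right; apply: (root_edge gp apexA chainA hT).
have [n le_n] := ubnP (j - i); elim: n i j le_n => // n IH i j le_n jl ij ijT.
have sub (x y i' j' : I) : ([set x; y] \subset [set k : I | (i' <= k <= j')%N]) =
    (i' <= x <= j')%N && (i' <= y <= j')%N by rewrite subUset !sub1set !inE.
have withinP (i' j' : I) e : (j' < l.+2)%N -> e \in code_within T i' j' -> exists x y : I,
    [/\ (i' <= x)%N, (x < y)%N, (y <= j')%N, e = [set x; y] & e \in edges T].
  move=> j'l; rewrite inE => /andP[eT]; have [[k kN eE]|[x [y [xy eE]]]] := eP e eT.
    by rewrite eE sub /=; clear -j'l; lia.
  by rewrite eE sub => h; exists x, y; rewrite -eE; split=> //; clear -h xy; lia.
have [ji|ltij] := leqP j i.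
  rewrite /chain_splits (@splits_leaf _ _ _ _ _ _ (chain_choices_gap (W := W))) // inE.
  apply/eqP/setP => e; rewrite in_set0; apply/negbTE/negP => /(withinP _ _ _ jl).
  by move=> [x [y [h1 h2 h3 _ _]]]; clear -h1 h2 h3 ji; lia.
have {}ijT : [set i; j] \in edges T by case: ijT => // e; move: ltij; rewrite e ltnn.
have ijl : (i < j < l.+2)%N by rewrite ltij.
(* it suffices to find the two ends of the parts above the edge ij *)
suff [b [c [ch ibT cjT split_at]]] : exists b c : I, [/\ chain_choice W i j (b, c),
    i = b \/ [set i; b] \in edges T, c = j \/ [set c; j] \in edges T &
    forall u v, [set u; v] \in edges T -> (i <= u)%N -> (u < v)%N -> (v <= j)%N ->
      [|| (u == i) && (v == j), (v <= b)%N | (c <= u)%N]].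
  have o := chain_choice_order ch.
  apply/(@mem_splits _ _ _ _ _ _ (chain_choices_gap (W := W))); first by rewrite -ltnNge.
  exists b, c, (code_within T i b), (code_within T c j); split.
  - by rewrite mem_chain_choices.
  - by apply: IH => //; clear -o le_n jl ltij; lia.
  - by apply: IH => //; clear -o le_n jl ltij; lia.
  apply/setP => e; rewrite /chain_join in_setU1 in_setU; apply/idP/or3P.
    move=> /(withinP _ _ _ jl)[u [v [h1 h2 h3 eE eT]]]; rewrite eE in eT *.
    have /or3P[/andP[/eqP-> /eqP->]|h|h] := split_at u v eT h1 h2 h3.
    - by apply: Or31; rewrite eqxx.
    - by apply: Or32; rewrite inE eT sub; clear -h1 h2 h; lia.
    - by apply: Or33; rewrite inE eT sub; clear -h h2 h3; lia.
  case=> [/eqP->|h|h].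
  - by rewrite inE ijT sub; clear -ij; lia.
  - have bl : (b < l.+2)%N by clear -o jl; lia.
    have [u [v [h1 h2 h3 eE eT]]] := withinP _ _ _ bl h.
    by rewrite inE eT eE sub; clear -h1 h2 h3 o; lia.
  - have [u [v [h1 h2 h3 eE eT]]] := withinP _ _ _ jl h.
    by rewrite inE eT eE sub; clear -h1 h2 h3 o; lia.
have [F FT upF] := above_face gp apexA chainA hT ijl ijT.
have ijF := above_face_mem gp apexA chainA hT ijl ijT FT upF.
have [NF|nNF] := boolP (N \in cover F).
  have [m [al [be [M [o nb FE]]]]] := apex_face_shape gp apexA chainA hT FT NF.
  have mid := below_apex_face hT FT FE nb o ijl ijF upF.
  have /and4P[mal albe beM Ml] := o.
  have /and3P[hi hj /forallP none] := mid.
  have alT : [set N; al] \in edges T by apply: (pt_edge FT); rewrite (nbrs_sym _ nb) eqxx.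
  have beT : [set N; be] \in edges T.
    by apply: (pt_edge FT); rewrite (nbrs_sym _ nb) eqxx orbT.
  pose b := if (i < al)%N then al else i.
  have bv : (val b = if (i < al)%N then val al else val i) by rewrite /b; case: ifP.
  have bb : (al <= b < be)%N && (i <= b < j)%N.
    by move: hi hj; rewrite bv -!val_eqE /=; clear -mal albe beM ltij; case: ifP; lia.
  have cl : (b.+1 < l.+3)%N by clear -bb jl; lia.
  pose c : I := Ordinal cl; have cv : c = b.+1 :> nat by [].
  have nc' := none c; have nbe := none be.
  have inT (p q : I) : (p < q < l.+2)%N -> apex_face_edge m al be M p q -> [set p; q] \in edges T.
    move=> pq h; apply: (pt_edge FT); rewrite FE mem_apex_face //; clear -pq; lia.
  have ne (p : I) : (p < l.+2)%N -> (p == N) = false by rewrite -val_eqE /=; clear; lia.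
  exists b, c; split.
  - apply/orP; right; rewrite eqxx /=; apply/and4P; split.
    + by clear -bb; lia.
    + by clear -bb; lia.
    + rewrite /b; case: ifP => h; last by rewrite eqxx.
      by rewrite apexW ?orbT //; clear -h albe beM Ml; lia.
    + have [//|cj] := eqVneq c j; rewrite /=.
      have cbe : c = be.
        apply: val_inj => /=; move: nc' cj hi hj bb cv.
        by rewrite -!val_eqE /=; clear -mal albe beM ltij; lia.
      rewrite cbe; apply: apexW => //; move: cj cv; rewrite cbe -!val_eqE /=; clear -albe bb jl Ml beM; lia.
  - rewrite /b; case: ifP => h; last by left.
    right; apply: inT; first by clear -h albe beM Ml; lia.
    rewrite /apex_face_edge ne ?eqxx; last by clear -albe beM Ml; lia.
    suff -> : i == m by [].
    by move: hi; rewrite -!val_eqE /=; clear -h; lia.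
  - have [cj|cj] := eqVneq c j; first by left.
    have cbe : c = be.
      apply: val_inj => /=; move: nc' cj hi hj bb cv.
      by rewrite -!val_eqE /=; clear -mal albe beM ltij; lia.
    right; rewrite cbe; apply: inT; first by move: cj bb; rewrite -cbe -!val_eqE /=; clear -jl; lia.
    rewrite /apex_face_edge ne // eqxx.
    suff -> : j == M by rewrite orbT.
    by move: hj cj bb; rewrite -cbe -!val_eqE /=; clear; lia.
  - move=> u v uvT iu uv vj.
    have [//|vb] := leqP v b; first by rewrite orbT.
    have [//|uc] := leqP c u; first by rewrite !orbT.
    have /andP[ui jv] : (u <= i)%N && (j <= v)%N.
      apply: (first_edge hT FT FE nb o (b := b) _ mid _ uvT) => //;
      by clear -bb uc vb vj jl; move: uc => /=; lia.
    by rewrite -!val_eqE /=; clear -ui jv iu vj; lia.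
have [pt_f _ _] := pt_faces gp hT.
have [x [b [w [xbw wl FE]]]] := pseudo_triangle_noapex gp apexA chainA (pt_f F FT) nNF.
have upE : up F i j = ((x <= i) && (j <= b))%N (+) ((b <= i) && (j <= w))%N
     (+) ((x <= i) && (j <= w))%N.
  by rewrite /up FE xor_tri ?uniq_ltn3 // !spansE //; clear -xbw wl; lia.
have [ix jw] : i = x /\ j = w.
  move: ijF upF ltij; rewrite upE FE mem_tri => /or3P[]/eqP/set2_inj[][-> ->] // h1 h2;
  by exfalso; move: h1 h2; clear -xbw; lia.
subst x w; have xbT : [set i; b] \in edges T.
  by apply: (pt_edge FT); rewrite FE mem_tri eqxx.
have bwT : [set b; j] \in edges T.
  by apply: (pt_edge FT); rewrite FE mem_tri eqxx orbT.
exists b, b; split; try by right.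
- apply/orP; left; rewrite eqxx xbw /=; apply/negP => bW.
  apply: (pointed_one_side (pT b) xbw jl _ xbT bwT).
  by apply/TW => //; rewrite inE; clear -xbw jl; lia.
- move=> u v uvT iu uv vj.
  have n1 : ~~ ((i < u)%N && (u < b < v)%N).
    apply/negP => h; apply: (nc _ _ _ _ _ _ xbT uvT); clear -h vj jl; lia.
  have n2 : ~~ ((u < b < v)%N && (v < j)%N).
    apply/negP => h; apply: (nc _ _ _ _ _ _ uvT bwT); clear -h jl; lia.
  by rewrite -!val_eqE /=; clear -n1 n2 iu uv vj; lia.
Qed.

End Codes.

(** * The code determines the pseudo-triangulation *)

Section MidEdges.
Context {l : nat}.
Local Notation I := 'I_l.+3.
Implicit Types (x y m al be M b : I).

Lemma mid_edge_direction m al be M x y : corner_order m al be M -> (x < y)%N ->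
  mid_edge m al be M x y -> exists b : I, (al <= b < be)%N && (x <= b < y)%N.
Proof.
move=> /and4P[h1 h2 h3 h4] xy /and3P[hx hy _].
exists (if (x < al)%N then al else x); move: hx hy; rewrite -!val_eqE /=.
by case: ifP; clear -h1 h2 h3 xy; lia.
Qed.

Lemma mid_edge_first m al be M : corner_order m al be M ->
  exists y : I, [/\ (m <= al < y)%N, (y < l.+2)%N & mid_edge m al be M m y].
Proof.
move=> /and4P[h1 h2 h3 h4]; have cl : (al.+1 < l.+3)%N by clear -h2 h3 h4; lia.
have [h|h] := boolP (al.+1 < be)%N.
  exists (Ordinal cl); split; [by clear -h1 => /=; lia|by clear -h h3 h4 => /=; lia|].
  rewrite /mid_edge eqxx /= ltnSn h orbT /=; apply/forallP => k; clear; lia.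
exists M; split=> //; first by clear -h1 h2 h3; lia.
by rewrite /mid_edge !eqxx /=; apply/forallP => k; clear -h; lia.
Qed.

Lemma mid_edge_last m al be M : corner_order m al be M ->
  exists x : I, [/\ (x <= be.-1)%N, (x < M)%N & mid_edge m al be M x M].
Proof.
move=> /and4P[h1 h2 h3 h4]; have cl : (be.-1 < l.+3)%N by clear -h3 h4; lia.
have [h|h] := boolP (al.+1 < be)%N.
  exists (Ordinal cl); split; [by []|by clear -h h3 => /=; lia|].
  rewrite /mid_edge eqxx /=; apply/andP; split.
    by apply/orP; right; clear -h; lia.
  by apply/forallP => k; clear -h; lia.
exists m; split; [by clear -h1 h2; lia|by clear -h1 h2 h3; lia|].
by rewrite /mid_edge !eqxx /=; apply/forallP => k; clear -h; lia.
Qed.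

End MidEdges.

Section Injectivity.
Context {R : realType} {l : nat} (A : 'I_l.+3 -> 'rV[R]_2) (s : R).
Local Notation I := 'I_l.+3.
Local Notation N := (@ord_max l.+2).
Local Notation oA i j z := (orient (A i) (A j) z).
Implicit Types (i j k a b c x y u v w al be m M : I) (z g : 'rV[R]_2).
Implicit Types (e : {set I}) (F G : {set {set I}}).
Context (gp : general_position A)
  (apexA : forall i j, (i < j < l.+2)%N -> 0 < s * oA N i (A j))
  (chainA : forall i j k, (i < j < k)%N -> (k < l.+2)%N -> s * oA i j (A k) < 0).

Section OnePseudoTriangulation.
Context (T : {set {set {set I}}}) (hT : pseudo_triangulation A T).

Lemma apex_edge_gap F al be k : F \in T -> nbrs_of F N al be -> (be < l.+2)%N ->
  (al < k < be)%N -> [set N; k] \notin edges T.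
Proof.
move=> FT nb bel kab; apply/negP => /bigcupP[G GT NkG].
have [x nbG] := cycle_nbrs_with (pt_cycle gp hT GT) NkG.
have kx : k != x by case: nbG.
have FG : F = G.
  have [h|h|/val_inj h] := ltngtP k x; last by rewrite h eqxx in kx.
    apply: (@top_face_unique _ _ _ _ gp apexA _ hT F G k al be k x) => //; clear -kab h; lia.
  have kl : (k.-1 < l.+3)%N by clear -kab bel; lia.
  apply: (@top_face_unique _ _ _ _ gp apexA _ hT F G (Ordinal kl) al be x k) => //=.
  - by clear -kab; lia.
  - exact: nbrs_swap.
  - by clear -h; lia.
move: NkG; rewrite -FG (nbrs_sym _ nb) -!val_eqE /=; clear -kab; lia.
Qed.

Lemma top_apex_face k : (k < l.+1)%N -> exists m al be M,
  [/\ apex_face m al be M \in T, nbrs_of (apex_face m al be M) N al be,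
      corner_order m al be M & (al <= k < be)%N].
Proof.
move=> kl; have [F [al' [be' [FT nb ab bel]]]] := top_face gp apexA hT kl.
have [NF _ _] := nbrs_mem nb.
have [m [al [be [M [o nb' FE]]]]] := apex_face_shape gp apexA chainA hT FT NF.
exists m, al, be, M; rewrite -FE; split=> //.
have h1 : [set N; al'] \in F by rewrite (nbrs_sym _ nb) eqxx.
have h2 : [set N; be'] \in F by rewrite (nbrs_sym _ nb) eqxx orbT.
move: h1 h2; rewrite !(nbrs_sym _ nb') -!val_eqE /=; case/and4P: o => _ albe _ _.
by clear -ab albe; lia.
Qed.

Lemma face_above_noapex F i j : F \in T -> N \notin cover F -> (i < j < l.+2)%N ->
  [set i; j] \in F -> up F i j -> exists b, (i < b < j)%N /\ F = tri i b j.
Proof.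
move=> FT nNF ij ijF upF; have [pt_f _ _] := pt_faces gp hT.
have [x [b [w [xbw wl FE]]]] := pseudo_triangle_noapex gp apexA chainA (pt_f F FT) nNF.
have upE : up F i j = ((x <= i) && (j <= b))%N (+) ((b <= i) && (j <= w))%N
     (+) ((x <= i) && (j <= w))%N.
  by rewrite /up FE xor_tri ?uniq_ltn3 // !spansE //; clear -xbw wl; lia.
have [ix jw] : i = x /\ j = w.
  move: ijF upF ij; rewrite upE FE mem_tri => /or3P[]/eqP/set2_inj[][-> ->] // h1 h2;
  by exfalso; move: h1 h2; clear -xbw; lia.
by exists b; rewrite ix jw.
Qed.

End OnePseudoTriangulation.

(** The faces are determined by the edges: a triangle is the face above its
    longest edge, and an apex face is the first face in the directions between
    its neighbours of the apex; its corners are read off from the first edges in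
    these directions. *)
Lemma edges_determine (T T' : {set {set {set I}}}) : pseudo_triangulation A T ->
  pseudo_triangulation A T' -> edges T = edges T' -> T \subset T'.
Proof.
move=> hT hT' E; apply/subsetP => F FT.
have [NF|nNF] := boolP (N \in cover F).
  have [m [al [be [M [o nb FE]]]]] := apex_face_shape gp apexA chainA hT FT NF.
  have /and4P[mal albe beM Ml] := o.
  have alk : (al < l.+1)%N by clear -albe beM Ml; lia.
  have [m' [al' [be' [M' [FT' nb' o' ab']]]]] := top_apex_face hT' alk.
  have /and4P[mal' albe' beM' Ml'] := o'.
  have bel : (be < l.+2)%N by clear -beM Ml; lia.
  have bel' : (be' < l.+2)%N by clear -beM' Ml'; lia.
  have Nal : [set N; al] \in edges T by apply: (pt_edge FT); rewrite (nbrs_sym _ nb) eqxx.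
  have Nbe : [set N; be] \in edges T.
    by apply: (pt_edge FT); rewrite (nbrs_sym _ nb) eqxx orbT.
  have Nal' : [set N; al'] \in edges T'.
    by apply: (pt_edge FT'); rewrite (nbrs_sym _ nb') eqxx.
  have Nbe' : [set N; be'] \in edges T'.
    by apply: (pt_edge FT'); rewrite (nbrs_sym _ nb') eqxx orbT.
  have gap k : (al < k < be)%N -> [set N; k] \notin edges T.
    exact: (apex_edge_gap hT FT nb bel).
  have gap' k : (al' < k < be')%N -> [set N; k] \notin edges T'.
    exact: (apex_edge_gap hT' FT' nb' bel').
  rewrite E in Nal Nbe; rewrite -E in Nal' Nbe'.
  have alE : al' = al.
    apply/val_inj/eqP; rewrite /= eqn_leq; apply/andP; split; first by clear -ab'; lia.
    rewrite leqNgt; apply/negP => lt; have := gap' al; rewrite Nal => h.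
    by have : ~~ true by apply: h; clear -lt ab'; lia.
  have beE : be' = be.
    apply/val_inj/eqP; rewrite /= eqn_leq; apply/andP; split; rewrite leqNgt; apply/negP => lt.
      have := gap' be; rewrite Nbe => h.
      by have : ~~ true by apply: h; rewrite alE; clear -lt albe; lia.
    have := gap be'; rewrite Nbe' => h.
    by have : ~~ true by apply: h; rewrite -alE; clear -lt albe'; lia.
  subst al' be'.
  have midT x y : (x < y)%N -> (y < l.+2)%N -> mid_edge m al be M x y ->
      [set x; y] \in edges T.
    move=> xy yl mid; apply: (pt_edge FT); rewrite FE mem_apex_face // /apex_face_edge mid !orbT.
    by case: eqP => // yN; move: yl; rewrite yN ltnn.
  have midT' x y : (x < y)%N -> (y < l.+2)%N -> mid_edge m' al be M' x y ->
      [set x; y] \in edges T'.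
    move=> xy yl mid; apply: (pt_edge FT'); rewrite mem_apex_face // /apex_face_edge mid !orbT.
    by case: eqP => // yN; move: yl; rewrite yN ltnn.
  have fst x y b := first_edge gp apexA chainA hT (F := F) (b := b) (x := x) (y := y) FT FE nb o.
  have fst' x y b := first_edge gp apexA chainA hT' (b := b) (x := x) (y := y) FT' erefl nb' o'.
  have mE : m = m'.
    have [y [my yl mid]] := mid_edge_first o; have [y' [my' yl' mid']] := mid_edge_first o'.
    have xyT : [set m; y] \in edges T by apply: midT mid => //; clear -my; lia.
    have xyT' : [set m'; y'] \in edges T' by apply: midT' mid' => //; clear -my'; lia.
    rewrite -E in xyT'; rewrite E in xyT.
    have ab : (al <= al < be)%N by rewrite leqnn albe.
    have /andP[h1 _] := fst _ _ _ _ _ ab mid my xyT' my' yl'.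
    have /andP[h2 _] := fst' _ _ _ _ _ ab mid' my' xyT my yl.
    by apply/val_inj/eqP; rewrite /= eqn_leq h2 h1.
  have ME : M = M'.
    have [x [xb xM mid]] := mid_edge_last o; have [x' [xb' xM' mid']] := mid_edge_last o'.
    have xyT : [set x; M] \in edges T by apply: midT mid.
    have xyT' : [set x'; M'] \in edges T' by apply: midT' mid'.
    rewrite -E in xyT'; rewrite E in xyT.
    have bl : (be.-1 < l.+3)%N by clear -bel; lia.
    pose b : I := Ordinal bl.
    have ab : (al <= b < be)%N by rewrite /=; clear -albe; lia.
    have xbM : (x <= b < M)%N by rewrite /= xb; clear -albe beM; lia.
    have xbM' : (x' <= b < M')%N by rewrite /= xb'; clear -albe beM'; lia.
    have /andP[_ h1] := fst _ _ _ _ _ ab mid xbM xyT' xbM' Ml'.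
    have /andP[_ h2] := fst' _ _ _ _ _ ab mid' xbM' xyT xbM Ml.
    by apply/val_inj/eqP; rewrite /= eqn_leq h1 h2.
  by rewrite FE mE ME.
have [pt_f _ _] := pt_faces gp hT.
have [x [y [w [xyw wl FE]]]] := pseudo_triangle_noapex gp apexA chainA (pt_f F FT) nNF.
have xwl : (x < w < l.+2)%N by rewrite wl andbT; clear -xyw; lia.
have xwT : [set x; w] \in edges T' by rewrite -E; apply: (pt_edge FT); rewrite FE mem_tri eqxx !orbT.
have xyT : [set x; y] \in edges T' by rewrite -E; apply: (pt_edge FT); rewrite FE mem_tri eqxx.
have ywT : [set y; w] \in edges T'.
  by rewrite -E; apply: (pt_edge FT); rewrite FE mem_tri eqxx orbT.
have nc := pt_nocross gp apexA chainA hT'.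
have [F' FT' upF'] := above_face gp apexA chainA hT' xwl xwT.
have xwF' := above_face_mem gp apexA chainA hT' xwl xwT FT' upF'.
have [NF'|nNF'] := boolP (N \in cover F').
  have [m [al [be [M [o nb FE']]]]] := apex_face_shape gp apexA chainA hT' FT' NF'.
  have mid := below_apex_face gp hT' FT' FE' nb o xwl xwF' upF'.
  have xw : (x < w)%N by case/andP: xwl.
  have [b /andP[ab xbw]] := mid_edge_direction o xw mid.
  have fst u v := first_edge gp apexA chainA hT' FT' FE' nb o ab mid xbw (u := u) (v := v).
  have [yb|by_] := leqP y b.
    by have := fst y w ywT; rewrite wl => h; exfalso; have := h _ isT; clear -h xyw xbw yb; lia.
  have yl : (y < l.+2)%N by clear -xyw wl; lia.
  by have := fst x y xyT; rewrite yl => h; exfalso; have := h _ isT; clear -h xyw xbw by_; lia.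
have [y' [xyw' FE']] := face_above_noapex hT' FT' nNF' xwl xwF' upF'.
have xyT' : [set x; y'] \in edges T' by apply: (pt_edge FT'); rewrite FE' mem_tri eqxx.
have ywT' : [set y'; w] \in edges T' by apply: (pt_edge FT'); rewrite FE' mem_tri eqxx orbT.
suff yE : y = y' by rewrite FE yE -FE'.
have [h|h|/val_inj//] := ltngtP y y'.
  by case: (nc _ _ _ _ _ _ xyT' ywT); clear -h xyw' xyw wl; lia.
by case: (nc _ _ _ _ _ _ xyT ywT'); clear -h xyw' xyw wl; lia.
Qed.

(** The edges at the apex are known too: they lead to W and to the two ends of the chain. *)
Lemma chain_code_inj (W : {set I}) (T T' : {set {set {set I}}}) : in_PPT A W T ->
  in_PPT A W T' -> chain_code T = chain_code T' -> T = T'.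
Proof.
have sub T1 T2 : in_PPT A W T1 -> in_PPT A W T2 -> chain_code T1 = chain_code T2 ->
    edges T1 \subset edges T2.
  move=> [[h1 _] W1] [[h2 _] W2] E; apply/subsetP => e eT.
  have [Ne|nNe] := boolP (N \in e); last first.
    have : e \in chain_code T1 by rewrite inE eT.
    by rewrite E inE => /andP[].
  have [[k kN eE]|[x [y [xy eE]]]] := pt_edgeP gp h1 eT; last first.
    by move: Ne; rewrite eE !inE -!val_eqE /=; clear -xy; lia.
  rewrite {}eE in eT *; have [ki|] := boolP (k \in inner l).
    by apply/W2/W1.
  rewrite inE negb_and -leqNgt -ltnNge => kout.
  have [k0|k0] := posnP k.
    have -> : k = ord0 by apply: val_inj.
    exact: (apex_edge0 gp apexA h2).
  have -> : k = chain_end.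
    by apply: val_inj => /=; rewrite chain_endE; clear -kout kN k0; lia.
  exact: (apex_edge_end gp apexA h2).
move=> P P' E; have EE : edges T = edges T'.
  by apply/eqP; rewrite eqEsubset !sub.
case: P P' => [[h1 _] _] [[h2 _] _].
by apply/eqP; rewrite eqEsubset !edges_determine.
Qed.

End Injectivity.

(** * Every code comes from a pseudo-triangulation *)

Section Separation.
Context {R : realType} {I : finType} (A : I -> 'rV[R]_2).
Implicit Types (i j a b : I).
Local Notation oA i j z := (orient (A i) (A j) z).

Lemma hull_pair_line i j z : hull A [set i; j] z -> oA i j z = 0.
Proof.
by move=> /hull_pair[t _ ->]; rewrite orient_lin orientxx orientxy !mulr0 addr0.
Qed.

Lemma hull_pair_gt0 i j a b (s : R) z : hull A [set a; b] z ->
  0 < s * oA i j (A a) -> 0 < s * oA i j (A b) -> 0 < s * oA i j z.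
Proof.
move=> /hull_pair[t /andP[t0 t1] ->]; rewrite orient_lin => ha hb.
have -> : s * ((1 - t) * oA i j (A a) + t * oA i j (A b)) =
  (1 - t) * (s * oA i j (A a)) + t * (s * oA i j (A b)) by ring.
have [->|tn] := eqVneq t 1; first by rewrite subrr mul0r add0r mul1r.
have t1' : 0 < 1 - t by rewrite subr_gt0 lt_def eq_sym tn.
have := mulr_gt0 t1' ha; have := mulr_ge0 t0 (ltW hb); lra.
Qed.

Lemma hull_pair_separated i j a b (s : R) z : hull A [set i; j] z -> hull A [set a; b] z ->
  0 < s * oA i j (A a) -> 0 < s * oA i j (A b) -> False.
Proof.
move=> hij hab ha hb; have := hull_pair_gt0 hab ha hb.
by rewrite (hull_pair_line hij) mulr0 ltxx.
Qed.

End Separation.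

Section ChainFaces.
Context {R : realType} {l : nat} (A : 'I_l.+3 -> 'rV[R]_2) (s : R).
Local Notation I := 'I_l.+3.
Local Notation N := (@ord_max l.+2).
Local Notation oA i j z := (orient (A i) (A j) z).
Implicit Types (i j k a b c x y u v w al be m M : I) (z g : 'rV[R]_2).
Implicit Types (e : {set I}) (F G : {set {set I}}).
Context (gp : general_position A)
  (apexA : forall i j, (i < j < l.+2)%N -> 0 < s * oA N i (A j))
  (chainA : forall i j k, (i < j < k)%N -> (k < l.+2)%N -> s * oA i j (A k) < 0).

Lemma below_apex_hull x y z : (x < y < l.+2)%N -> below_apex A s x y z ->
  hull A [set N; x; y] z.
Proof.
move=> xy /and3P[h1 h2 h3].
apply: (@hull_triangle _ _ _ _ N x y _ s); rewrite ?inE ?eqxx ?orbT //; try exact: ltW.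
  exact: apexA.
by rewrite orientNl mulrN oppr_ge0 ltW.
Qed.

Lemma below_apex_xx x z : below_apex A s x x z = false.
Proof. by apply/negP => /and3P[h1 h2 _]; move: (lt_trans h1 h2); rewrite ltxx. Qed.

(** A point of the triangle of the apex, x and y is in the hull of its vertices, which are
    on the right sides of the sides of the triangle of the apex, i and j. *)
Lemma below_apex_sub i j x y z : generic A z -> (i <= x)%N -> (y <= j)%N -> (x <= y)%N ->
  (j < l.+2)%N -> below_apex A s x y z -> below_apex A s i j z.
Proof.
move=> gz ix yj xy jl t.
have {}xy : (x < y < l.+2)%N.
  move: xy t; rewrite leq_eqVlt => /orP[/eqP/val_inj->|]; first by rewrite below_apex_xx.
  by clear -yj jl; lia.
have hz := below_apex_hull xy t; have s0 := apex_sign_neq0 apexA.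
have pos a b : a != b -> 0 <= s * oA a b z -> 0 < s * oA a b z.
  by move=> ab; rewrite lt_def mulf_neq0 //; apply: gz.
have ne a b : (a < b)%N -> a != b by move=> h; rewrite -val_eqE /= neq_ltn h.
have iN : (i < N)%N by clear -ix xy => /=; lia.
have jN : (j < N)%N by [].
have pN : 0 < s * oA N i z.
  apply: pos; first by rewrite eq_sym ne.
  apply: (hull_orient_ge0 hz) => k; rewrite !inE => /orP[/orP[]|]/eqP->.
  - by rewrite orientxx mulr0.
  - by apply: (apex_ge apexA); clear -ix xy; lia.
  - by apply: (apex_ge apexA); clear -ix xy; lia.
have pj : s * oA N j z < 0.
  rewrite -oppr_gt0 -mulrN -orientNl; apply: pos; first exact: ne.
  apply: (hull_orient_ge0 hz) => k; rewrite !inE orientNl mulrN oppr_ge0 => /orP[/orP[]|]/eqP->.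
  - by rewrite orientxx mulr0.
  - by apply: (apex_le apexA); clear -yj xy jl; lia.
  - by apply: (apex_le apexA); clear -yj xy jl; lia.
rewrite /below_apex pN pj /=; apply: pos; first by apply: ne; clear -ix yj xy; lia.
have ij : (i < j < l.+2)%N by clear -ix yj xy jl; lia.
apply: (hull_orient_ge0 hz) => k; rewrite !inE => /orP[/orP[]|]/eqP->.
- exact/ltW/(chord_apex apexA).
- by apply: (chord_between_ge chainA) => //; clear -ix yj xy; lia.
- by apply: (chord_between_ge chainA) => //; clear -ix yj xy; lia.
Qed.

Lemma below_apex_disjoint x y u v z : (y <= u)%N -> (x < y)%N -> (u < l.+2)%N ->
  below_apex A s x y z -> below_apex A s u v z -> False.
Proof.
move=> yu xy ul t /and3P[Lu _ _]; have xyl : (x < y < l.+2)%N by clear -yu xy ul; lia.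
have := below_apex_hull xyl t => /hull_orient_ge0 h.
have : 0 <= s * oA u N z.
  apply: h => k; rewrite !inE orientNl mulrN oppr_ge0 => /orP[/orP[]|]/eqP->.
  - by rewrite orientxx mulr0.
  - by apply: (apex_le apexA); clear -yu xyl ul; lia.
  - by apply: (apex_le apexA); clear -yu xyl ul; lia.
by rewrite orientNl mulrN oppr_ge0 leNgt Lu.
Qed.

(** An edge at the apex meets no edge of the chain except at a common vertex, so
    crossings can only occur between two edges of the chain. *)
Lemma nocross_simple F : is_cycle F -> (forall x u y v, (x < u < y)%N -> (y < v < l.+2)%N ->
  [set x; y] \in F -> [set u; v] \in F -> False) -> simple_polygon A F.
Proof.
move=> cF nc; split=> // e f z eF fF ef he hf.
have share x y w : uniq [:: x; y; w] -> hull A [set x; y] z -> hull A [set x; w] z ->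
    exists2 i, i \in [set x; y] :&: [set x; w] & z = A i.
  by move=> u h1 h2; exists x; [rewrite !inE eqxx|exact: (hull_pair_share gp u)].
have ne a b : (a < b)%N -> (a != b) && (b != a).
  by move=> h; rewrite eq_sym andbb -val_eqE /= neq_ltn h orbT.
have apex_chain a x y : (a < l.+2)%N -> (x < y < l.+2)%N ->
    hull A [set N; a] z -> hull A [set x; y] z ->
    exists2 i, i \in [set N; a] :&: [set x; y] & z = A i.
  move=> al xy h1 h2; have xN : x != N by rewrite neqN; clear -xy; lia.
  have yN : y != N by rewrite neqN; clear -xy; lia.
  have aN : a != N by rewrite neqN.
  have /andP[nxy nyx] : (x != y) && (y != x) by apply: ne; clear -xy; lia.
  have [ax|nax] := eqVneq a x.
    rewrite ax [[set N; x]]set2C in h1 *; apply: share => //.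
    by rewrite /= !inE !negb_or xN nxy [N == y]eq_sym yN.
  have [ay|nay] := eqVneq a y.
    rewrite ay [[set N; y]]set2C [[set x; y]]set2C in h1 h2 *; apply: share => //.
    by rewrite /= !inE !negb_or yN nyx [N == x]eq_sym xN.
  exfalso; move: nax nay; rewrite -!val_eqE /= => nax nay.
  have [lt|] := ltnP a x.
    by apply: (hull_pair_separated (s := s) h1 h2); apply: apexA; clear -lt xy; lia.
  rewrite leq_eqVlt eq_sym (negbTE nax) /= => xa.
  have [lt|] := ltnP y a.
    apply: (hull_pair_separated (s := - s) h1 h2); rewrite mulNr oppr_gt0;
    by apply: (apex_lt apexA); clear -lt xy al; lia.
  rewrite leq_eqVlt (negbTE nay) /= => ya.
  apply: (hull_pair_separated (s := s) h2 h1); first exact: (chord_apex apexA).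
  by apply: (chord_between chainA); rewrite ?xa //; clear -xy; lia.
case: (cycle_edgeP cF eF) (cycle_edgeP cF fF) => [[a al eE]|[x [y [xy eE]]]] [[b bl fE]|[u [v [uv fE]]]].
- rewrite eE fE in ef he hf *; apply: share => //.
  have aN : a != N by rewrite neqN.
  have bN : b != N by rewrite neqN.
  rewrite /= !inE !negb_or ![N == _]eq_sym aN bN /= andbT.
  by apply: contra_neq ef => ->.
- by rewrite eE fE in he hf *; apply: apex_chain.
- rewrite eE fE in he hf *; have [i] := apex_chain _ _ _ bl xy hf he.
  by rewrite setIC; exists i.
have {eE fE} : exists2 i, i \in e :&: f & z = A i; last by [].
rewrite eE fE in eF fF ef he hf *.
wlog xu : x y u v xy uv eF fF ef he hf {eE fE} / (x <= u)%N.
  move=> wl; have [h|/ltnW h] := leqP x u; first exact: (wl x y u v).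
  by rewrite setIC; apply: (wl u v x y) => //; rewrite eq_sym.
have /andP[nxy nyx] : (x != y) && (y != x) by apply: ne; clear -xy; lia.
have /andP[nuv nvu] : (u != v) && (v != u) by apply: ne; clear -uv; lia.
have [xu'|nxu] := eqVneq x u.
  subst u; apply: share => //; rewrite /= !inE !negb_or nxy nuv /= andbT.
  by apply: contra_neq ef => ->.
have [yv|nyv] := eqVneq y v.
  subst v; rewrite [[set x; y]]set2C [[set u; y]]set2C in ef he hf *; apply: share => //.
  rewrite /= !inE !negb_or nyx nvu /= andbT.
  by apply: contra_neq ef => ->.
have [yu|nyu] := eqVneq y u.
  subst u; rewrite [[set x; y]]set2C in ef he hf *; apply: share => //.
  rewrite /= !inE !negb_or nyx nuv /= andbT.
  by apply: contra_neq ef => ->; rewrite set2C.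
exfalso; move: nxu nyv nyu; rewrite -!val_eqE /= => nxu nyv nyu.
have [yltu|uy] := ltnP y u.
  apply: (hull_pair_separated (s := - s) he hf); rewrite mulNr oppr_gt0;
  by apply: (chord_outside chainA) => //; clear -yltu uv; lia.
have [yltv|vy] := ltnP y v.
  by apply: (nc x u y v) => //; [clear -uy nyu nxu xu; lia|clear -yltv uv; lia].
apply: (hull_pair_separated (s := s) he hf);
by apply: (chord_between chainA); clear -xy uv vy xu nxu nyv; lia.
Qed.

Lemma tri_pseudo_triangle x y w : (x < y < w)%N -> (w < l.+2)%N ->
  pseudo_triangle A (tri x y w).
Proof.
move=> xyw wl; have u := uniq_ltn3 xyw; split; first exact: tri_simple.
have nN : N \notin cover (tri x y w).
  by rewrite cover_tri !inE -!val_eqE /=; clear -xyw wl; lia.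
rewrite (_ : [set v in _ | _] = [set x; y; w]).
  rewrite setUC cardsU1 cards2 !inE negb_or.
  move: u; rewrite /= !inE negb_or andbT => /andP[/andP[-> xw] yw].
  by rewrite [w == x]eq_sym [w == y]eq_sym xw yw.
apply/setP => k; rewrite inE -cover_tri /vertices.
case kF: (k \in cover _) => //; apply/asboolP.
exact: (convex_noapex gp apexA chainA (tri_cycle u)).
Qed.

Lemma apex_face_nbrs m al be M : corner_order m al be M ->
  nbrs_of (apex_face m al be M) N al be.
Proof.
move=> /and4P[h1 h2 h3 h4]; split.
- by rewrite -val_eqE /=; clear -h2; lia.
- by rewrite -val_eqE /=; clear -h2 h3 h4; lia.
- by rewrite -val_eqE /=; clear -h3 h4; lia.
move=> y; have [->|yN] := eqVneq y N.
  rewrite -!val_eqE /= !gtn_eqF; try by clear -h2 h3 h4; lia.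
  apply/negP => /apex_faceP[a [b [ab /set2_inj ab' _]]].
  by case: ab' ab => -[<- <-]; rewrite ltnn.
by rewrite set2C mem_apex_face ?/apex_face_edge ?eqxx //; rewrite neqN in yN.
Qed.

Lemma apex_face_pseudo_triangle m al be M : corner_order m al be M ->
  pseudo_triangle A (apex_face m al be M).
Proof.
move=> o; have nb := apex_face_nbrs o; have [cF cov] := apex_face_cycle o.
have /and4P[h1 h2 h3 h4] := o; set F := apex_face m al be M in nb cF cov *.
have NalF : [set al; N] \in F by rewrite set2C (nbrs_sym _ nb) eqxx.
have NbeF : [set be; N] \in F by rewrite set2C (nbrs_sym _ nb) eqxx orbT.
have [x nbal] := cycle_nbrs_with cF NalF; have [y nbbe] := cycle_nbrs_with cF NbeF.
have ne k : (k < l.+2)%N -> (k == N) = false by rewrite -neqN => /negbTE.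
apply/(pseudo_triangle_corners gp apexA chainA cF nb h2 nbal nbbe); split.
  apply: nocross_simple => // x' u y' v xuy yv; rewrite !mem_apex_face /apex_face_edge;
    try by clear -xuy yv; lia.
  rewrite !ne; try by clear -xuy yv; lia.
  rewrite /mid_edge -!val_eqE /= => hxy huv.
  have hxy' : [|| (x' == m :> nat) && (y' == al :> nat), (x' == be :> nat) && (y' == M :> nat) |
      ((x' == m :> nat) || (al < x' < be)%N) && ((y' == M :> nat) || (al < y' < be)%N) && ~~ (al < u < be)%N].
    case/or3P: hxy => [->//|->|/and3P[-> -> /forallP/(_ u)]]; rewrite ?orbT //.
    by rewrite xuy andbT => ->; rewrite !orbT.
  have huv' : [|| (u == m :> nat) && (v == al :> nat), (u == be :> nat) && (v == M :> nat) |
      ((u == m :> nat) || (al < u < be)%N) && ((v == M :> nat) || (al < v < be)%N)].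
    by case/or3P: huv => [->//|->|/and3P[-> -> _]]; rewrite ?orbT.
  clear -hxy' huv' xuy yv h1 h2 h3; lia.
move=> k; rewrite cov => + kN nk; rewrite (negbTE kN) (negbTE nk) orbF /= => /orP[]/eqP kE.
  have mal : (m < al)%N by move: nk; rewrite kE; clear -h1 h2; lia.
  have : [set al; m] \in F.
    by rewrite set2C mem_apex_face // /apex_face_edge ne ?eqxx //; clear -h2 h3 h4; lia.
  rewrite (nbrs_sym _ nbal) ne ?orFb; last by clear -h1 h2 h3 h4; lia.
  by move=> /eqP mx; rewrite /first_corner -mx mal kE !inE eqxx.
have beM : (be < M)%N by move: nk; rewrite kE; clear -h3 h2; lia.
have : [set be; M] \in F.
  by rewrite mem_apex_face // /apex_face_edge ne ?eqxx ?orbT.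
rewrite (nbrs_sym _ nbbe) ne ?orFb //.
by move=> /eqP mx; rewrite /last_corner -mx beM kE !inE eqxx orbT.
Qed.

End ChainFaces.

Section MergeFaces.
Context {l : nat}.
Local Notation I := 'I_l.+3.
Local Notation N := (@ord_max l.+2).
Implicit Types (i j k b c x y z m al be M : I) (e : {set I}) (F : {set {set I}}).

Lemma apex_face_edge_merge m al z be M x y : corner_order m al z z ->
  corner_order z z be M -> (x < y)%N -> apex_face_edge m al be M x y =
  (apex_face_edge m al z z x y || apex_face_edge z z be M x y) && ~~ ((y == N) && (x == z)).
Proof.
move=> /and4P[h1 h2 _ _] /and4P[_ h3 h4 h5] xy; rewrite /apex_face_edge.
have [_|yN] := eqVneq y N.
  by rewrite -!val_eqE /=; clear -h1 h2 h3 h4; lia.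
have mid : mid_edge m al be M x y = mid_edge m al z z x y || mid_edge z z be M x y.
  rewrite /mid_edge -!val_eqE /=; apply/idP/orP.
    move=> /and3P[hx hy /forallP none].
    have nz := none z; have [yz|zy] := leqP y z.
      left; apply/and3P; split; [clear -hx h1 h2 h3 xy yz; lia|clear -hy h2 h3 h4 yz; lia|].
      by apply/forallP => k; have := none k; clear -h2 h3; lia.
    right; apply/and3P; split; [clear -nz hx h1 h2 h3 zy; lia|clear -hy h2 h3 zy; lia|].
    by apply/forallP => k; have := none k; clear -h2 h3; lia.
  case=> /and3P[hx hy /forallP none].
    apply/and3P; split; [clear -hx h3; lia|clear -hy h2 h3 h4; lia|].
    by apply/forallP => k; have := none k; clear -hy; lia.
  apply/and3P; split; [clear -hx h2 h3; lia|clear -hy h2; lia|].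
  by apply/forallP => k; have := none k; clear -hx; lia.
have -> : (x == z) && (y == z) = false by rewrite -!val_eqE /=; clear -xy; lia.
rewrite mid andbT !orbA !orbF.
by case: (_ && _); case: (_ && _); case: (mid_edge m al z z x y); case: (mid_edge z z be M x y).
Qed.

(** Two adjacent faces at the apex with a common corner z become one when their common edge
    from the apex to z is removed. *)
Lemma apex_face_merge m al z be M e : corner_order m al z z -> corner_order z z be M ->
  (e \in apex_face m al be M) =
  ((e \in apex_face m al z z) || (e \in apex_face z z be M)) && (e != [set N; z]).
Proof.
move=> o1 o2; have zN : (z < N)%N by case/and4P: o1.
have E x y : (x < y)%N -> ([set x; y] \in apex_face m al be M) =
   (([set x; y] \in apex_face m al z z) || ([set x; y] \in apex_face z z be M))
   && ([set x; y] != [set N; z]).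
  move=> xy; rewrite !mem_apex_face // (apex_face_edge_merge o1 o2 xy); congr (_ && ~~ _).
  apply/andP/eqP => [[/eqP-> /eqP->]|]; first by rewrite set2C.
  by move=> /set2_inj[[xN yz]|[-> ->]]; [move: xy; rewrite xN yz ltnNge ltnW|rewrite !eqxx].
have sh m' al' be' M' : e \in apex_face m' al' be' M' -> exists x y, (x < y)%N /\ e = [set x; y].
  by move=> /apex_faceP[x [y [xy eE _]]]; exists x, y.
have [h0|n0] := boolP (e \in apex_face m al be M).
  by have [x [y [xy eE]]] := sh _ _ _ _ h0; have := E x y xy; rewrite -eE h0.
have [h1|n1] := boolP (e \in apex_face m al z z).
  by have [x [y [xy eE]]] := sh _ _ _ _ h1; have := E x y xy; rewrite -eE (negbTE n0) h1.
have [h2|//] := boolP (e \in apex_face z z be M).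
by have [x [y [xy eE]]] := sh _ _ _ _ h2; have := E x y xy; rewrite -eE (negbTE n0) (negbTE n1) h2.
Qed.

(** There is no vertex strictly between b and c, so that ij is the only edge from corner to
    corner. *)
Lemma apex_face_gap i b c j e : corner_order i b c j -> c = b.+1 :> nat ->
  N \notin e -> (e \in apex_face i b c j) =
  [|| (i < b)%N && (e == [set i; b]), (c < j)%N && (e == [set c; j]) | e == [set i; j]].
Proof.
move=> /and4P[h1 h2 h3 h4] cb Ne; have ij : (i < j)%N by clear -h1 h2 h3; lia.
have ne k : (k < l.+2)%N -> (k == N) = false by rewrite -val_eqE /=; clear; lia.
have mid x y : (x < y)%N -> mid_edge i b c j x y = (x == i) && (y == j).
  move=> xy; apply/and3P/andP => [[hx hy _]|[/eqP-> /eqP->]].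
    by move: hx hy; rewrite -!val_eqE /=; clear -cb; lia.
  by rewrite !eqxx; split=> //; apply/forallP => k; clear -cb; lia.
apply/idP/or3P.
  move=> /apex_faceP[x [y [xy eE]]]; rewrite /apex_face_edge mid //.
  case: eqP => [yN|_]; first by move: Ne; rewrite eE yN !inE eqxx orbT.
  move=> /or3P[]/andP[/eqP xE /eqP yE]; rewrite eE xE yE eqxx in xy *.
  - by apply: Or31; rewrite xy.
  - by apply: Or32; rewrite xy.
  - exact: Or33.
case=> [/andP[lt /eqP->]|/andP[lt /eqP->]|/eqP->]; rewrite mem_apex_face // /apex_face_edge ne ?eqxx ?orbT //.
- by clear -h2 h3 h4; lia.
- by rewrite mid // !eqxx !orbT.
Qed.

End MergeFaces.

Section BuildFaces.
Context {R : realType} {l : nat} (A : 'I_l.+3 -> 'rV[R]_2) (s : R).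
Local Notation I := 'I_l.+3.
Local Notation N := (@ord_max l.+2).
Local Notation oA i j z := (orient (A i) (A j) z).
Implicit Types (i j k a b c x y u v w al be m M : I) (z g : 'rV[R]_2).
Implicit Types (e : {set I}) (F G X Y : {set {set I}}).
Context (gp : general_position A)
  (apexA : forall i j, (i < j < l.+2)%N -> 0 < s * oA N i (A j))
  (chainA : forall i j k, (i < j < k)%N -> (k < l.+2)%N -> s * oA i j (A k) < 0).
Context (W : {set I}).

Local Notation below := (below_apex A s).

Lemma par_indicator F z : is_cycle F ->
  par A F z = \big[addb/false]_(e : {set I}) ((e \in F) && fan_parity A N z e).
Proof.
move=> cF; rewrite (par_fan _ _ N) // big_mkcond; apply: eq_bigr => e _.
by case: (e \in F).
Qed.

Lemma xor_one (T : finType) (e0 : T) (b : bool) (f : T -> bool) :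
  \big[addb/false]_(e : T) ((b && (e == e0)) && f e) = b && f e0.
Proof.
rewrite (bigD1 e0) //= eqxx andbT big1 ?addbF // => e /negbTE->.
by rewrite andbF.
Qed.

(** The only common edge of the two faces ends at the apex, and its fan triangle is
    degenerate. *)
Lemma par_apex_face_merge m al b be M z : corner_order m al b b -> corner_order b b be M ->
  par A (apex_face m al be M) z =
  par A (apex_face m al b b) z (+) par A (apex_face b b be M) z.
Proof.
move=> o1 o2.
have o : corner_order m al be M.
  by move: o1 o2; rewrite /corner_order; clear; lia.
have [c1 _] := apex_face_cycle o1; have [c2 _] := apex_face_cycle o2.
have [c0 _] := apex_face_cycle o.
have /and4P[_ alb _ bN] := o1; have /and4P[_ bbe _ _] := o2.
rewrite !par_indicator // -big_split; apply: eq_bigr => e _ /=.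
rewrite (apex_face_merge _ o1 o2); have [->|ne] := eqVneq e [set N; b].
  by rewrite fan_parity_N ?andbF // neqN.
rewrite andbT; case e1: (e \in apex_face m al b b); case e2: (e \in apex_face b b be M);
  rewrite ?addbF //=.
have [x [y [xy eE h1]]] := apex_faceP e1; rewrite eE mem_apex_face // in e2.
case/eqP: ne; rewrite eE; move: h1 e2; rewrite /apex_face_edge.
case: eqP => [->|yN].
  move=> h1 h2; suff -> : x = b by rewrite set2C.
  by apply: val_inj; move: h1 h2; rewrite -!val_eqE /=; clear -alb bbe; lia.
by rewrite /mid_edge -!val_eqE /= => h1 h2; exfalso; move: h1 h2; clear -xy alb bbe o1 o2;
  move: o1 o2; rewrite /corner_order; lia.
Qed.

Lemma par_apex_face_gap i b c j z : corner_order i b c j -> c = b.+1 :> nat ->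
  generic A z ->
  par A (apex_face i b c j) z = below i b z (+) below c j z (+) below i j z.
Proof.
move=> o cb gz; have [c0 _] := apex_face_cycle o; have /and4P[h1 h2 h3 h4] := o.
have t x y : (x <= y < l.+2)%N -> below x y z = (x < y)%N && fan_parity A N z [set x; y].
  move=> xy; have [lt|] := ltnP x y.
    by rewrite (fan_parity_chord apexA) //; clear -xy lt; lia.
  move=> yx; have -> : y = x by apply: val_inj => /=; clear -yx xy; lia.
  by rewrite below_apex_xx.
rewrite !t; try by clear -h1 h2 h3 h4; lia.
have -> : (i < j)%N by clear -h1 h2 h3; lia.
rewrite par_indicator // -!xor_one -!big_split; apply: eq_bigr => e _ /=.
have [Ne|Ne] := boolP (N \in e).
  have nE x y : (x < l.+2)%N -> (y < l.+2)%N -> (e == [set x; y]) = false.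
    move=> xl yl; apply: contraTF Ne => /eqP->; rewrite !inE -!val_eqE /=; clear -xl yl; lia.
  rewrite !nE; try by clear -h1 h2 h3 h4; lia.
  rewrite !andbF /=; case eF: (e \in _) => //.
  have [x [y [xy eE _]]] := apex_faceP eF.
  move: Ne; rewrite eE !inE => /orP[]/eqP NE; last first.
    rewrite -NE set2C fan_parity_N // neqN; move: xy; rewrite -NE /=; clear; lia.
  by exfalso; move: xy (ltn_ord y); rewrite -NE /=; clear; lia.
rewrite apex_face_gap //; case: (fan_parity A N z e); rewrite ?andbF ?andbT //=.
have d x y u v : (x < y)%N -> (u < v)%N -> ([set x; y] == [set u; v]) = (x == u) && (y == v).
  move=> xy uv; apply/eqP/andP => [/set2_inj[[-> ->]//|[xv yu]]|[/eqP-> /eqP->]//].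
  by move: xy; rewrite xv yu ltnNge ltnW.
have ij : (i < j)%N by clear -h1 h2 h3; lia.
have [->|n1] := eqVneq e [set i; j].
  rewrite !orbT; have [ib|ib] := ltnP i b; have [cj|cj] := ltnP c j; rewrite //=.
  - by rewrite !d // -!val_eqE /=; clear -h2 h3 ib cj; lia.
  - by rewrite !d // -!val_eqE /=; clear -h2 h3 ib cj; lia.
  - by rewrite !d // -!val_eqE /=; clear -h1 h2 h3 ib cj; lia.
rewrite orbF addbF; case ib: (i < b)%N => //=; case cj: (c < j)%N; rewrite ?orbF ?addbF //=.
have [->|//] := eqVneq e [set i; b].
by rewrite d // -!val_eqE /=; clear -ib h2 cb; lia.
Qed.

Definition quad_face (q : I * I * I * I) := let: (m, al, be, M) := q in apex_face m al be M.

Definition all_faces (Tr : seq {set {set I}}) (Q : seq (I * I * I * I)) :=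
  Tr ++ [seq quad_face q | q <- Q].

(** Tr and Q list the faces that fill the triangle spanned by the apex and the edge
    ij, when G is the set of their edges off the apex: the triangles, and the
    faces at the apex in the order of their directions, given by (m, al, be, M).
    The counts make the two steps additive: an edge at the apex strictly between i
    and j belongs to two faces, and a generic point to at most one. *)
Record faces_below i j G Tr (Q : seq (I * I * I * I)) : Prop := FacesBelow {
  below_tri : forall F, F \in Tr -> exists x y w,
    [/\ (i <= x)%N, (x < y < w)%N, (w <= j)%N & F = tri x y w];
  below_quad : forall m al be M, (m, al, be, M) \in Q ->
    [&& corner_order m al be M, (i <= m)%N & (M <= j)%N];
  below_head : head j [seq q.1.1.2 | q <- Q] = i;
  below_last : last i [seq q.1.2 | q <- Q] = j;
  below_code : forall e, N \notin e -> (e \in G) = has (fun F => e \in F) (all_faces Tr Q);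
  below_spokes : forall k, count (fun F => [set N; k] \in F) (all_faces Tr Q) =
    ((i < j) * ((k == i) + (k == j) + ((i < k < j) && (k \in W)).*2))%N;
  below_count : forall z, generic A z -> count (par A ^~ z) (all_faces Tr Q) = below i j z
}.

Lemma head_cat (T : Type) (x : T) s1 s2 : head x (s1 ++ s2) = head (head x s2) s1.
Proof. by case: s1. Qed.

Lemma tri_spoke x y w k : (x < y < w)%N -> (w < l.+2)%N -> [set N; k] \in tri x y w = false.
Proof.
move=> xyw wl; have ne a b : (a < l.+2)%N -> (b < l.+2)%N -> ([set N; k] == [set a; b]) = false.
  move=> al bl; apply/eqP => /setP/(_ N); rewrite !inE eqxx -!val_eqE /=; clear -al bl; lia.
by rewrite mem_tri !ne //; clear -xyw wl; lia.
Qed.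

Lemma faces_below_leaf i : faces_below i i set0 [::] [::].
Proof.
split=> //=; first by move=> e _; rewrite inE.
  by move=> k; rewrite ltnn.
by move=> z gz; rewrite below_apex_xx.
Qed.

(** The triangle ibj completes the triangles of the apex with ib and bj to that with
    ij. The last face at the apex of the first part and the first one of the second
    share their edge at b, and are merged because b is not to be joined to the apex. *)
Lemma faces_below_tri i b j X Y Tr1 Q1 Tr2 Q2 : (i < b < j)%N -> (j < l.+2)%N ->
  b \notin W -> [set i; b] \in X -> [set b; j] \in Y ->
  faces_below i b X Tr1 Q1 -> faces_below b j Y Tr2 Q2 ->
  exists Tr Q, faces_below i j (chain_join i j (b, b) X Y) Tr Q.
Proof.
move=> ibj jl bW ibX bjY [t1 q1 h1 la1 c1 s1 n1] [t2 q2 h2 la2 c2 s2 n2].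
case/lastP: Q1 => [|Q1 [[[m al] b1] M1]] in q1 h1 la1 c1 s1 n1 *.
  by move: ibj; rewrite -[i]h1 /= ltnn.
case: Q2 => [|[[[m2 b2] be] M] Q2] in q2 h2 la2 c2 s2 n2 *.
  by move: ibj; rewrite -[j]la2 /= ltnn andbF.
rewrite map_rcons last_rcons /= in la1; rewrite /= in h2; subst b1 b2.
have o1 : [&& corner_order m al b M1, (i <= m)%N & (M1 <= b)%N].
  by apply: q1; rewrite mem_rcons mem_head.
have o2 : [&& corner_order m2 b be M, (b <= m2)%N & (M <= j)%N] by apply: q2; rewrite mem_head.
have EM1 : M1 = b.
  by apply: val_inj; move: o1; rewrite /corner_order /=; clear; lia.
have Em2 : m2 = b.
  by apply: val_inj; move: o2; rewrite /corner_order /=; clear; lia.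
subst M1 m2; case/and3P: o1 => o1 im _; case/and3P: o2 => o2 _ Mj.
have o : corner_order m al be M by move: o1 o2; rewrite /corner_order; clear; lia.
exists (tri i b j :: Tr1 ++ Tr2), (Q1 ++ (m, al, be, M) :: Q2).
have hasE e : has (fun F => e \in F) (all_faces (tri i b j :: Tr1 ++ Tr2) (Q1 ++ (m, al, be, M) :: Q2)) =
   (e \in tri i b j) || (has (fun F => e \in F) (all_faces Tr1 (rcons Q1 (m, al, b, b))) ||
     has (fun F => e \in F) (all_faces Tr2 ((b, b, be, M) :: Q2))) && (e != [set N; b])
   || (has (fun F => e \in F) (all_faces Tr1 Q1) || has (fun F => e \in F) (all_faces Tr2 Q2)).
  rewrite /all_faces map_rcons !map_cat !has_cat /= !has_cat has_rcons /= (apex_face_merge _ o1 o2).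
  case: (e \in tri i b j) => //=; case: (has _ Tr1); rewrite ?orbT //=.
  case: (has _ Tr2); rewrite ?orbT //=.
  case: (has _ [seq _ | _ <- Q1]); rewrite ?orbT //=.
  by case: (has _ [seq _ | _ <- Q2]); rewrite ?orbT ?orbF.
have sub1 e : has (fun F => e \in F) (all_faces Tr1 Q1) ->
    has (fun F => e \in F) (all_faces Tr1 (rcons Q1 (m, al, b, b))).
  by rewrite /all_faces map_rcons !has_cat has_rcons => /orP[]->; rewrite ?orbT.
have sub2 e : has (fun F => e \in F) (all_faces Tr2 Q2) ->
    has (fun F => e \in F) (all_faces Tr2 ((b, b, be, M) :: Q2)).
  by rewrite /all_faces !has_cat /= => /orP[]->; rewrite ?orbT.
split.
- move=> F; rewrite inE mem_cat => /or3P[/eqP->|/t1[x [y [w [a1 a2 a3 ->]]]]|/t2[x [y [w [a1 a2 a3 ->]]]]].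
  + by exists i, b, j.
  + by exists x, y, w; split=> //; clear -a3 ibj; lia.
  + by exists x, y, w; split=> //; clear -a1 ibj; lia.
- move=> m' al' be' M'; rewrite mem_cat inE => /or3P[h|/eqP[-> -> -> ->]|h].
  + have := q1 m' al' be' M'; rewrite mem_rcons inE h orbT => /(_ isT) /and3P[-> -> h'].
    by clear -h' ibj; lia.
  + by rewrite o im.
  + have := q2 m' al' be' M'; rewrite inE h orbT => /(_ isT) /and3P[-> h' ->].
    by clear -h' ibj; lia.
- by rewrite map_cat head_cat /=; rewrite map_rcons -cats1 head_cat in h1.
- by rewrite map_cat last_cat.
- move=> e Ne; rewrite hasE -(c1 e Ne) -(c2 e Ne) mem_tri /chain_join !inE.
  have -> : e != [set N; b] by apply: contraNneq Ne => ->; rewrite !inE eqxx.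
  move: (sub1 e) (sub2 e); rewrite -(c1 e Ne) -(c2 e Ne).
  have [->|_] := eqVneq e [set i; b]; first by rewrite ibX !orbT.
  have [->|_] := eqVneq e [set b; j]; first by rewrite bjY !orbT.
  case: (has _ (all_faces Tr1 Q1)) => [/(_ isT)->|_]; first by rewrite !orbT.
  case: (has _ (all_faces Tr2 Q2)) => [/(_ isT)->|_]; first by rewrite !orbT.
  by rewrite andbT !orbF.
- move=> k; have := s1 k; have := s2 k.
  rewrite /all_faces !map_rcons !map_cat !count_cat /= !count_cat -cats1 count_cat /= tri_spoke //.
  have sp m' al' be' M' : corner_order m' al' be' M' ->
      ([set N; k] \in apex_face m' al' be' M') = (k == al') || (k == be').
    by move=> /apex_face_nbrs h; rewrite (nbrs_sym _ h).
  rewrite !sp //; case/and4P: o1 => _ alb _ _; case/and4P: o2 => _ bbe _ _.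
  have [->|] := eqVneq k b.
    rewrite (negbTE bW) -!val_eqE /=; clear -alb bbe ibj.
    move: (count _ _) (count _ _) (count _ _) (count _ _) => a1 a2 a3 a4; lia.
  rewrite -!val_eqE /=; move: (k \in W) (count _ _) (count _ _) (count _ _) (count _ _).
  by clear -alb bbe ibj; lia.
- move=> z gz; have := n1 z gz; have := n2 z gz.
  rewrite /all_faces !map_rcons !map_cat !count_cat /= !count_cat -cats1 count_cat /=.
  rewrite (par_apex_face_merge _ o1 o2).
  have -> : par A (tri i b j) z = below i b z (+) below b j z (+) below i j z.
    rewrite (par_fan _ _ N); last exact: tri_cycle (uniq_ltn3 ibj).
    rewrite xor_tri ?uniq_ltn3 //.
    by rewrite !(fan_parity_chord apexA) //; clear -ibj jl; lia.
  have bl : (b < l.+2)%N by clear -ibj jl; lia.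
  have ib : (i < b)%N by case/andP: ibj.
  have bj : (b < j)%N by case/andP: ibj.
  have d := @below_apex_disjoint _ _ _ _ apexA i b b j z (leqnn b) ib bl.
  have e1 := below_apex_sub apexA chainA gz (leqnn i) (ltnW bj) (ltnW ib) jl.
  have e2 := below_apex_sub apexA chainA gz (ltnW ib) (leqnn j) (ltnW bj) jl.
  move: (below i b z) (below b j z) (below i j z) d e1 e2
    (par A (apex_face m al b b) z) (par A (apex_face b b be M) z).
  move: (count _ _) (count _ _) (count _ _) (count _ _) => a1 a2 a3 a4 [] [] [] d e1 e2 [] [] /=;
  by (try (by case: d)); (try (by have := e1 isT)); (try (by have := e2 isT)); clear; lia.
Qed.

(** The face at the apex above ij fills what is left by the triangles of the apex with ib
    and cj. *)
Lemma faces_below_gap i b c j X Y Tr1 Q1 Tr2 Q2 : c = b.+1 :> nat -> (i <= b)%N ->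
  (c <= j)%N -> (j < l.+2)%N -> (b == i) || (b \in W) -> (c == j) || (c \in W) ->
  ((i < b)%N -> [set i; b] \in X) -> ((c < j)%N -> [set c; j] \in Y) ->
  faces_below i b X Tr1 Q1 -> faces_below c j Y Tr2 Q2 ->
  faces_below i j (chain_join i j (b, c) X Y) (Tr1 ++ Tr2) (Q1 ++ (i, b, c, j) :: Q2).
Proof.
move=> cb ib cj jl bW cW ibX cjY [t1 q1 h1 la1 c1 s1 n1] [t2 q2 h2 la2 c2 s2 n2].
have o : corner_order i b c j by rewrite /corner_order; clear -cb ib cj jl; lia.
split.
- move=> F; rewrite mem_cat => /orP[/t1[x [y [w [a1 a2 a3 ->]]]]|/t2[x [y [w [a1 a2 a3 ->]]]]].
  + by exists x, y, w; split=> //; clear -a3 ib cj cb; lia.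
  + by exists x, y, w; split=> //; clear -a1 ib cj cb; lia.
- move=> m' al' be' M'; rewrite mem_cat inE => /or3P[/q1/and3P[-> -> h]|/eqP[-> -> -> ->]|/q2/and3P[-> h ->]].
  + by rewrite /=; clear -h cb cj; lia.
  + by rewrite o !leqnn.
  + by rewrite andbT /=; clear -h cb ib; lia.
- by rewrite map_cat head_cat /=.
- by rewrite map_cat last_cat.
- move=> e Ne; rewrite /all_faces !map_cat !has_cat /=.
  rewrite (apex_face_gap o cb Ne) /chain_join !inE.
  have p1 : (i < b)%N && (e == [set i; b]) -> e \in X by move=> /andP[h /eqP->]; apply: ibX.
  have p2 : (c < j)%N && (e == [set c; j]) -> e \in Y by move=> /andP[h /eqP->]; apply: cjY.
  move: p1 p2; rewrite (c1 e Ne) (c2 e Ne) /all_faces !has_cat.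
  case: ((i < b)%N && _); case: ((c < j)%N && _); case: (has _ Tr1); case: (has _ Tr2);
  case: (has _ _); case: (has _ _); case: (e == _) => //= p1 p2;
  by [have := p1 isT|have := p2 isT].
- move=> k; have := s1 k; have := s2 k.
  rewrite /all_faces !map_cat !count_cat /=.
  have sp m' al' be' M' : corner_order m' al' be' M' ->
      ([set N; k] \in apex_face m' al' be' M') = (k == al') || (k == be').
    by move=> /apex_face_nbrs h; rewrite (nbrs_sym _ h).
  rewrite !sp //.
  suff E : ((i < b) * ((k == i) + (k == b) + ((i < k < b) && (k \in W)).*2) +
      (c < j) * ((k == c) + (k == j) + ((c < k < j) && (k \in W)).*2) +
      ((k == b) || (k == c)))%N = ((i < j) * ((k == i) + (k == j) + ((i < k < j) && (k \in W)).*2))%N.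
    by rewrite -E => <- <-; clear; lia.
  have bc : (b < c)%N by rewrite cb.
  have ij : (i < j)%N := leq_ltn_trans ib (leq_trans bc cj).
  have [->|kb] := eqVneq k b.
    move: bW; rewrite -!val_eqE /=.
    by case: (b \in W) => /=; rewrite ?andbF ?andbT; clear -ib bc cj; lia.
  have [->|kc] := eqVneq k c.
    move: cW; rewrite -!val_eqE /=.
    by case: (c \in W) => /=; rewrite ?andbF ?andbT; clear -ib bc cj; lia.
  rewrite ij; move: kb kc; rewrite -!val_eqE /=.
  by case: (k \in W) => /=; rewrite ?andbF ?andbT; clear -ib cb cj; lia.
- move=> z gz; have := n1 z gz; have := n2 z gz.
  rewrite /all_faces !map_cat !count_cat /= par_apex_face_gap //.
  have cl : (c < l.+2)%N by clear -cj jl; lia.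
  have bc : (b <= c)%N by clear -cb; lia.
  have bj : (b <= j)%N by clear -cj cb; lia.
  have ic : (i <= c)%N by clear -ib cb; lia.
  have e1 := below_apex_sub apexA chainA gz (leqnn i) bj ib jl.
  have e2 := below_apex_sub apexA chainA gz ic (leqnn j) cj jl.
  have d : below i b z -> below c j z -> False.
    have [lt|] := ltnP i b; first exact: (below_apex_disjoint apexA bc lt cl).
    move=> bi; have -> : b = i by apply: val_inj => /=; clear -ib bi; lia.
    by rewrite below_apex_xx.
  move: (below i b z) (below c j z) (below i j z) d e1 e2.
  move: (count _ _) (count _ _) (count _ _) (count _ _) => a1 a2 a3 a4 [] [] [] d e1 e2 /=;
  by (try (by case: d)); (try (by have := e1 isT)); (try (by have := e2 isT)); clear; lia.
Qed.

End BuildFaces.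

Section CodeSides.
Context {l : nat} (W : {set 'I_l.+3}).
Local Notation I := 'I_l.+3.
Implicit Types (i j k a b c x y : I) (G X Y : {set {set I}}).

Definition has_left G k := [exists x : I, (x < k)%N && ([set x; k] \in G)].
Definition has_right G k := [exists x : I, (k < x)%N && ([set k; x] \in G)].

(** A vertex k strictly between i and j becomes an end of both parts when it is the
    third vertex of a triangle, and of one part only otherwise. *)
Lemma chain_splits_sides i j G : G \in chain_splits W i j -> forall k, (i < k < j)%N ->
  (has_left G k || has_right G k) && ((k \in W) == ~~ (has_left G k && has_right G k)).
Proof.
move: i j G; apply: (splits_ind (chain_choices_gap (W := W))) => [i j ji k|].
  by clear -ji; lia.
move=> i j b c X Y; rewrite -ltnNge mem_chain_choices => ij ch hX hY IX IY k ikj.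
have o := chain_choice_order ch.
set G := chain_join i j (b, c) X Y.
have GE x y : (x < y)%N -> (x == k) || (y == k) ->
    ([set x; y] \in G) = ([set x; y] \in X) || ([set x; y] \in Y).
  move=> xy xk; rewrite !inE; case: eqP => // /set2_inj[[xi yj]|[xj yi]].
    by move: xk; rewrite xi yj -!val_eqE /=; clear -ikj; lia.
  by move: xy ij; rewrite xj yi; clear; lia.
have LE : has_left G k = has_left X k || has_left Y k.
  apply/existsP/orP => [[x /andP[xk]]|[]/existsP[x /andP[xk h]]].
  - by rewrite GE ?eqxx ?orbT // => /orP[h|h]; [left|right]; apply/existsP; exists x; rewrite xk.
  - by exists x; rewrite xk GE ?eqxx ?orbT ?h.
  - by exists x; rewrite xk GE ?eqxx ?orbT ?h ?orbT.
have RE : has_right G k = has_right X k || has_right Y k.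
  apply/existsP/orP => [[x /andP[xk]]|[]/existsP[x /andP[xk h]]].
  - by rewrite GE ?eqxx ?orbT // => /orP[h|h]; [left|right]; apply/existsP; exists x; rewrite xk.
  - by exists x; rewrite xk GE ?eqxx ?orbT ?h.
  - by exists x; rewrite xk GE ?eqxx ?orbT ?h ?orbT.
have LX : has_left X k -> (k <= b)%N.
  by move=> /existsP[x /andP[_ /(chain_splits_within hX)]]; clear; lia.
have RX : has_right X k -> (k < b)%N.
  by move=> /existsP[x /andP[xk /(chain_splits_within hX)]]; clear -xk; lia.
have LY : has_left Y k -> (c < k)%N.
  by move=> /existsP[x /andP[xk /(chain_splits_within hY)]]; clear -xk; lia.
have RY : has_right Y k -> (c <= k)%N.
  by move=> /existsP[x /andP[_ /(chain_splits_within hY)]]; clear; lia.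
have LXb : (i < b)%N -> k = b -> has_left X k.
  by move=> ib ->; apply/existsP; exists i; rewrite ib (chain_splits_root hX ib).
have RYc : (c < j)%N -> k = c -> has_right Y k.
  by move=> cj ->; apply/existsP; exists j; rewrite cj (chain_splits_root hY cj).
rewrite LE RE; have [kb|bk|kb] := ltngtP k b.
- have := IX k; rewrite kb andbT => /(_ (proj1 (andP ikj))).
  have -> : has_left Y k = false by apply: (contra_notF LY); clear -kb o; lia.
  have -> : has_right Y k = false by apply: (contra_notF RY); clear -kb o; lia.
  by rewrite !orbF.
- have -> : has_left X k = false by apply: (contra_notF LX); clear -bk o; lia.
  have -> : has_right X k = false by apply: (contra_notF RX); clear -bk o; lia.
  have [kc|ck|kc] := ltngtP k c.
  + by move: ch; rewrite /= -!val_eqE /=; clear -bk kc; lia.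
  + by have := IY k; rewrite ck => /(_ (proj2 (andP ikj))).
  have {}kc : k = c by apply: val_inj.
  have cj : (c < j)%N by rewrite -kc; case/andP: ikj.
  rewrite (RYc cj kc) orbT /=.
  have -> : has_left Y k = false by apply: (contra_notF LY); rewrite kc ltnn.
  move: ch; rewrite /= kc -!val_eqE /= => /orP[/and3P[bc _ _]|/and5P[_ _ _ _ h]].
    by move: bk; rewrite kc; clear -bc; lia.
  by move: h; case: (c \in W); rewrite ?orbF //; clear -cj; lia.
have {}kb : k = b by apply: val_inj.
have ib : (i < b)%N by rewrite -kb; case/andP: ikj.
rewrite (LXb ib kb) /=.
have -> : has_right X k = false by apply: (contra_notF RX); rewrite kb ltnn.
move: ch; rewrite /= => /orP[/and3P[/eqP bc ibj bW]|/and5P[cb _ _ h _]].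
  rewrite RYc ?kb ?(negbTE bW) //; by [rewrite -bc; case/andP: ibj|].
have -> : has_right Y k = false by apply: (contra_notF RY); rewrite kb; clear -cb; lia.
by move: h; rewrite kb -!val_eqE /=; case: (b \in W); rewrite ?orbF //; clear -ib; lia.
Qed.

End CodeSides.

Section Realisation.
Context {R : realType} {l : nat} (A : 'I_l.+3 -> 'rV[R]_2) (s : R).
Local Notation I := 'I_l.+3.
Local Notation N := (@ord_max l.+2).
Local Notation oA i j z := (orient (A i) (A j) z).
Implicit Types (i j k a b c x y u v w al be m M : I) (z g : 'rV[R]_2).
Implicit Types (e : {set I}) (F G X Y : {set {set I}}).
Context (gp : general_position A)
  (apexA : forall i j, (i < j < l.+2)%N -> 0 < s * oA N i (A j))
  (chainA : forall i j k, (i < j < k)%N -> (k < l.+2)%N -> s * oA i j (A k) < 0).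
Context (W : {set I}).

Lemma code_faces i j G : G \in chain_splits W i j -> (i <= j)%N -> (j < l.+2)%N ->
  exists Tr Q, faces_below A s W i j G Tr Q.
Proof.
move: i j G; apply: (splits_ind (chain_choices_gap (W := W))) => [i j ji ij jl|].
  have -> : j = i by apply: val_inj => /=; clear -ji ij; lia.
  by exists [::], [::]; apply: faces_below_leaf.
move=> i j b c X Y; rewrite -ltnNge mem_chain_choices => ij ch hX hY IX IY _ jl.
have o := chain_choice_order ch.
have [||Tr1 [Q1 f1]] := IX; [by clear -o; lia|by clear -o jl; lia|].
have [||Tr2 [Q2 f2]] := IY; [by clear -o; lia|by clear -o jl; lia|].
move: ch => /= /orP[/and3P[/eqP bc ibj bW]|/and5P[/eqP cb ib cj bW cW]].
  subst c; have [ib bj] := andP ibj.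
  exact: (faces_below_tri apexA chainA ibj jl bW (chain_splits_root hX ib)
    (chain_splits_root hY bj) f1 f2).
exists (Tr1 ++ Tr2), (Q1 ++ (i, b, c, j) :: Q2).
apply: (faces_below_gap apexA chainA cb ib cj jl bW cW _ _ f1 f2).
  exact: (chain_splits_root hX).
exact: (chain_splits_root hY).
Qed.

Lemma pointed_signed (T : {set {set {set I}}}) v u w : [set v; u] \in edges T ->
  [set v; w] \in edges T -> 0 < s * oA v u (A w) ->
  (forall x, [set v; x] \in edges T -> x != u -> x != w ->
     0 < s * oA v u (A x) /\ 0 < s * oA v x (A w)) -> pointed A T v.
Proof.
move=> vu vw uw ext; have := apex_sign_neq0 apexA; case: (ltgtP 0 s) => // s0 _.
  rewrite pmulr_rgt0 // in uw; exists u, w; split=> // x vx xu xw.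
  by have [] := ext x vx xu xw; rewrite !pmulr_rgt0.
rewrite nmulr_rgt0 // in uw; exists w, u; split=> //; first by rewrite orientNr oppr_gt0.
move=> x vx xw xu; have [] := ext x vx xu xw; rewrite !nmulr_rgt0 // => h1 h2.
by split; rewrite orientNr oppr_gt0.
Qed.

(** The three sides of the triangle are the edges of the convex hull. *)
Lemma hull_below_apex z : generic A z -> hull A setT z ->
  below_apex A s ord0 (@chain_end l) z.
Proof.
move=> gz hz; have s0 := apex_sign_neq0 apexA.
have pos a b : a != b -> 0 <= s * oA a b z -> 0 < s * oA a b z.
  by move=> ab; rewrite lt_def mulf_neq0 //; apply: gz.
have endN : chain_end != N :> I by rewrite neqN chain_endE.
have kN k : k = N \/ (k < l.+2)%N.
  by have [->|] := eqVneq k N; [left|rewrite neqN; right].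
apply/and3P; split.
- apply: pos => //; apply: (hull_orient_ge0 hz) => k _; have [->|kl] := kN k.
    by rewrite orientxx mulr0.
  exact: (apex_ge apexA).
- rewrite -oppr_gt0 -mulrN -orientNl; apply: pos => //.
  apply: (hull_orient_ge0 hz) => k _; rewrite orientNl mulrN oppr_ge0.
  have [->|kl] := kN k; first by rewrite orientxx mulr0.
  by apply: (apex_le apexA); rewrite chain_endE; clear -kl; lia.
apply: pos; first by rewrite -val_eqE /= chain_endE.
apply: (hull_orient_ge0 hz) => k _; have [->|kl] := kN k.
  by apply/ltW/(chord_apex apexA); rewrite chain_endE ltnSn.
by apply: (chord_between_ge chainA); rewrite chain_endE //=; clear -kl; lia.
Qed.

(** The chain bulges towards the apex, so at a vertex k of the chain the edges to the
    left, those to the right and the edge to the apex surround k. When one of these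
    three kinds is missing, the others fill an angle less than pi, whose extreme
    edges u and w are the nearest or the farthest vertices of their kind. *)
Lemma sides_pointed (T : {set {set {set I}}}) : pseudo_triangulation A T ->
  (forall k, (0 < k < l.+1)%N -> let C := chain_code T in
     (has_left C k || has_right C k) &&
     (([set N; k] \in edges T) == ~~ (has_left C k && has_right C k))) ->
  forall v, pointed A T v.
Proof.
move=> hT sides v; set C := chain_code T in sides.
have edgeC x y : (x < y)%N -> [set x; y] \in edges T -> (y < l.+2)%N -> [set x; y] \in C.
  by move=> xy xyT yl; rewrite inE xyT !inE -!val_eqE /=; clear -xy yl; lia.
have CT e : e \in C -> e \in edges T by rewrite inE => /andP[].
have CN x y : [set x; y] \in C -> (x < l.+2)%N && (y < l.+2)%N.
  by rewrite !inE -!neqN => /andP[_]; rewrite negb_or ![N == _]eq_sym.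
have nbr x y : [set x; y] \in edges T -> x != N -> y != N ->
    (x < y)%N && ([set x; y] \in C) || (y < x)%N && ([set y; x] \in C).
  move=> xyT xN yN; have xyC : [set x; y] \in C.
    by rewrite inE xyT !inE negb_or ![N == _]eq_sym xN yN.
  rewrite [[set y; x]]set2C xyC !andbT.
  have [[k _ eE]|[a [b [ab eE]]]] := pt_edgeP gp hT xyT.
    move/setP/(_ N): eE; rewrite !inE eqxx ![N == _]eq_sym (negbTE xN) (negbTE yN); done.
  by case: (set2_inj eE) => -[-> ->]; clear -ab; lia.
have t1 (a b c : I) : (a < b < c)%N -> (c < l.+2)%N -> 0 < s * oA b a (A c).
  by move=> abc cl; rewrite orientNl mulrN oppr_gt0 chainA.
have t2 (a b c : I) : (a < b < c)%N -> (c < l.+2)%N -> 0 < s * oA c b (A a).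
  by move=> abc cl; rewrite -orient_cyc t1.
have t3 (a b c : I) : (a < b < c)%N -> (c < l.+2)%N -> 0 < s * oA a c (A b).
  by move=> abc cl; rewrite orientNr mulrN oppr_gt0 chainA.
have [->|vN] := eqVneq v N.
  apply: (@pointed_signed T N ord0 chain_end).
  - exact: (apex_edge0 gp apexA hT).
  - exact: (apex_edge_end gp apexA hT).
  - by apply: apexA; rewrite chain_endE ltnSn.
  move=> x NxT x0 xe; have xN : (x < l.+2)%N.
    have [[k kN /set2_inj[[_ ->]//|[Nk ->]]]|[a [b [ab /set2_inj[[Na xb]|[Nb xa]]]]]] := pt_edgeP gp hT NxT.
    + by move: kN; rewrite -Nk ltnn.
    + by move: ab; rewrite -Na /=; clear; lia.
    + by move: ab; rewrite -Nb /=; clear; lia.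
  move: x0 xe; rewrite -!val_eqE /= chain_endE => x0 xe.
  by split; apply: apexA; rewrite ?chain_endE /=; clear -xN x0 xe; lia.
have vl : (v < l.+2)%N by rewrite -neqN.
have right : [set N; v] \in edges T -> has_right C v -> ~~ has_left C v -> pointed A T v.
  move=> Nv /existsP[x0 P0] nl.
  have [u /andP[vu uC] umax] := @arg_maxnP _ x0 (fun x : I => (v < x)%N && ([set v; x] \in C)) val P0.
  have /andP[_ ul] := CN _ _ uC.
  apply: (@pointed_signed T v u N); [exact: CT|by rewrite set2C|by apply: (chord_apex apexA); rewrite vu|].
  move=> x vx xu xN; have /orP[Px|Px] := nbr _ _ vx vN xN; last first.
    by case/negP: nl; apply/existsP; exists x.
  have xu' : (x < u)%N by rewrite ltn_neqAle xu; apply: umax.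
  have /andP[vx' _] := Px; split; first by apply: t3; rewrite ?vx'.
  by apply: (chord_apex apexA); rewrite vx' -neqN.
have left : [set N; v] \in edges T -> has_left C v -> ~~ has_right C v -> pointed A T v.
  move=> Nv /existsP[x0 P0] nr.
  have [w /andP[wv wC] wmin] := @arg_minnP _ x0 (fun x : I => (x < v)%N && ([set x; v] \in C)) val P0.
  have NA (x : I) : (x < v)%N -> 0 < s * oA v N (A x).
    by move=> xv; rewrite -orient_cyc apexA // xv.
  apply: (@pointed_signed T v N w); [by rewrite set2C|by rewrite set2C; apply: CT|exact: NA|].
  move=> x vx xN xw; have /orP[Px|Px] := nbr _ _ vx vN xN.
    by case/negP: nr; apply/existsP; exists x.
  have wx : (w < x)%N by rewrite ltn_neqAle eq_sym xw; apply: wmin.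
  have /andP[xv _] := Px; split; first exact: NA.
  by apply: t2; rewrite ?wx.
have both : [set N; v] \notin edges T -> has_left C v -> has_right C v -> pointed A T v.
  move=> nNv /existsP[x0 P0] /existsP[y0 Q0].
  have [u /andP[uv uC] umax] := @arg_maxnP _ x0 (fun x : I => (x < v)%N && ([set x; v] \in C)) val P0.
  have [w /andP[vw wC] wmin] := @arg_minnP _ y0 (fun x : I => (v < x)%N && ([set v; x] \in C)) val Q0.
  have /andP[_ wl] := CN _ _ wC.
  apply: (@pointed_signed T v u w); [by rewrite set2C; apply: CT|exact: CT|by apply: t1; rewrite ?uv|].
  move=> x vx xu xw; have [xN|xN] := eqVneq x N.
    by case/negP: nNv; rewrite -xN set2C.
  have xl : (x < l.+2)%N by rewrite -neqN.
  have /orP[Px|Px] := nbr _ _ vx vN xN.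
    have wx : (w < x)%N by rewrite ltn_neqAle eq_sym xw; apply: wmin.
    have /andP[vx' _] := Px; split; first by apply: t1; rewrite ?uv.
    by apply: t3; rewrite ?vw.
  have xu' : (x < u)%N by rewrite ltn_neqAle xu; apply: umax.
  have /andP[xv _] := Px; split; first by apply: t2; rewrite ?xu'.
  by apply: t1; rewrite ?xv.
have rootT := root_edge gp apexA chainA hT.
have [v0|v0] := posnP v.
  have -> : v = ord0 by apply: val_inj.
  rewrite (_ : v = ord0) in right *; last exact: val_inj.
  apply: right; first exact: (apex_edge0 gp apexA hT).
    by apply/existsP; exists chain_end; rewrite chain_endE /= edgeC // chain_endE.
  by apply/existsPn => x.
have [ve|ve] := eqVneq v chain_end.
  rewrite ve in left *; apply: left; first exact: (apex_edge_end gp apexA hT).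
    by apply/existsP; exists ord0; rewrite chain_endE /= edgeC // chain_endE.
  apply/existsPn => x; apply/negP => /andP[h /CN]; rewrite chain_endE in h *.
  by clear -h; lia.
have vin : (0 < v < l.+1)%N.
  by move: ve; rewrite -val_eqE /= chain_endE; clear -v0 vl; lia.
have /andP[ne /eqP E] := sides v vin.
have [hl|hl] := boolP (has_left C v); have [hr|hr] := boolP (has_right C v).
- by apply: both => //; rewrite E hl hr.
- by apply: left => //; rewrite E hl (negbTE hr).
- by apply: right => //; rewrite E (negbTE hl).
- by move: ne; rewrite (negbTE hl) (negbTE hr).
Qed.

(** The faces listed by faces_below for the whole chain are pseudo-triangles, cover
    every generic point of the hull exactly once, and have the given edges. *)
Lemma code_PPT G : G \in chain_splits W ord0 chain_end ->
  exists2 T, in_PPT A W T & chain_code T = G.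
Proof.
move=> hG; have [||Tr [Q [fT fQ _ _ fC fS fP]]] := code_faces hG; rewrite ?chain_endE //.
set L := all_faces Tr Q in fC fS fP; pose T := [set F in L].
have TE F : (F \in T) = (F \in L) by rewrite inE.
have edT e : (e \in edges T) = has (fun F => e \in F) L.
  by apply/bigcupP/hasP => -[F]; [rewrite TE|rewrite -TE] => h1 h2; exists F.
have pT F : F \in T -> pseudo_triangle A F.
  rewrite TE mem_cat => /orP[/fT[x [y [w [_ xyw wj ->]]]]|].
    by apply: (tri_pseudo_triangle gp apexA chainA) => //; move: wj; rewrite chain_endE.
  move=> /mapP[[[[m al] be] M] /fQ/and3P[o _ _] ->].
  exact: (apex_face_pseudo_triangle gp apexA chainA).
have codeT : chain_code T = G.
  apply/setP => e; rewrite inE edT; have [Ne|nNe] := boolP (N \in e); last by rewrite andbT fC.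
  rewrite andbF; apply/esym/negP => /(chain_splits_edges hG)[x [y [_ xy]]].
  rewrite chain_endE => yl eE; move: Ne; rewrite eE !inE -!val_eqE /=; clear -xy yl; lia.
have hT : pseudo_triangulation A T.
  apply/polygonal_partitionP; [exact: gp|exact: card_gt2|by move=> F [[cF _] _]|].
  split=> //; first split.
  - move=> z gz hz; have := fP z gz; rewrite (hull_below_apex gz hz).
    move=> cnt; have : has (par A ^~ z) L by rewrite has_count cnt.
    by move=> /hasP[F FL pF]; exists F; rewrite ?TE.
  - move=> z F F'; rewrite !TE => gz FL FL' pF pF'; apply/eqP/negPn/negP => FF'.
    have : (1 < count (par A ^~ z) L)%N.
      rewrite -size_filter (@uniq_leq_size _ [:: F; F']) //.
        by rewrite /= inE FF'.
      by move=> H; rewrite !inE mem_filter => /orP[]/eqP->; rewrite ?pF ?pF' ?FL ?FL'.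
    by rewrite fP //; case: (below_apex _ _ _ _ _).
  - have in_face e k : k \in e -> has (fun F => e \in F) L -> k \in \bigcup_(F in T) vertices F.
      move=> ke /hasP[F FL eF]; apply/bigcupP; exists F; rewrite ?TE //.
      by apply/bigcupP; exists e.
    have spoke k : (k == ord0) || (k == chain_end) -> has (fun F => [set N; k] \in F) L.
      by rewrite has_count fS chain_endE /= mul1n => /orP[]->; rewrite ?addnS.
    apply/setP => k; rewrite inE; have [->|kN] := eqVneq k N.
      by apply: (in_face [set N; ord0]); rewrite ?inE ?eqxx // spoke ?eqxx.
    have [kE|kE] := boolP ((k == ord0) || (k == chain_end)).
      by apply: (in_face [set N; k]); rewrite ?inE ?eqxx ?orbT // spoke.
    have inG e : e \in G -> has (fun F => e \in F) L.
      move=> eG; rewrite -fC //; have [x [y [_ xy yl ->]]] := chain_splits_edges hG eG.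
      rewrite chain_endE in yl; rewrite !inE -!val_eqE /=; clear -xy yl; lia.
    have kin : (@ord0 l.+2 < k < @chain_end l)%N.
      move: kE kN; rewrite -!val_eqE /= chain_endE; have := ltn_ord k; clear; lia.
    have /andP[/orP[]/existsP[x /andP[_ xG]] _] := chain_splits_sides hG kin.
      by apply: in_face (inG _ xG); rewrite !inE eqxx orbT.
    by apply: in_face (inG _ xG); rewrite !inE eqxx.
have NW k : (0 < k < l.+1)%N -> ([set N; k] \in edges T) = (k \in W).
  move=> kl; rewrite edT has_count fS chain_endE -!val_eqE /= chain_endE.
  by case: (k \in W); clear -kl; lia.
exists T => //; split; last first.
  by move=> k; rewrite inE => kl; rewrite NW.
split=> //; apply: sides_pointed => // k kl; rewrite codeT NW //.
by apply: (chain_splits_sides hG); rewrite chain_endE.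
Qed.

End Realisation.

(** * Solving the two recursions *)

Section StrictlyUpper.
Context {n : nat}.
Implicit Types (X Y P S D : 'M[int]_n.+1) (i j k : 'I_n.+1).

Definition strictly_upper X := forall i j, (j <= i)%N -> X i j = 0.

(** The determinant is one. *)
Lemma unitr1_upper X : strictly_upper X -> 1 + X \is a GRing.unit.
Proof.
move=> hX; suff E : \det (1%:M + X) = 1.
  by apply: (_ : 1%:M + X \in unitmx); rewrite unitmxE E unitr1.
rewrite -det_tr det_trig.
  by rewrite big1 // => i _; rewrite !mxE eqxx hX // addr0.
apply/is_trig_mxP => i j ij; rewrite !mxE hX 1?ltnW // addr0.
by rewrite -val_eqE /= gtn_eqF.
Qed.

Lemma mul_diag_upper X d : strictly_upper X -> strictly_upper (X * diag_mx d).
Proof. by move=> hX i j ji; rewrite -mulmxE mul_mx_diag mxE hX ?mul0r. Qed.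

Lemma diag_mul_upper X d : strictly_upper X -> strictly_upper (diag_mx d * X).
Proof. by move=> hX i j ji; rewrite -mulmxE mul_diag_mx mxE hX ?mulr0. Qed.

(** Row by row, from the last one upwards. *)
Lemma solve_upper X Y D : strictly_upper X -> strictly_upper Y -> D = Y - X * D ->
  strictly_upper D.
Proof.
move=> hX hY hD i; have [k] := ubnP (n - i); elim: k i => // k IH i ik j ji.
rewrite hD !mxE hY // big1 ?subr0 // => a _.
have [ai|ia] := leqP a i; first by rewrite hX ?mul0r.
by rewrite IH ?mulr0 //; [have := ltn_ord a; clear -ik ia; lia|clear -ia ji; lia].
Qed.

(** The entry (i, j) of X * X only depends on entries that are closer to the diagonal. *)
Lemma quadratic_unique S X Y : strictly_upper X -> strictly_upper Y ->
  X = S + X * X -> Y = S + Y * Y -> X = Y.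
Proof.
move=> hX hY eX eY; apply/matrixP => i j.
have [k] := ubnP (j - i)%N; elim: k i j => // k IH i j ijk.
rewrite eX eY ![(S + _) i j]mxE; congr (_ + _); rewrite !mxE; apply: eq_bigr => a _.
have [ai|ia] := leqP a i; first by rewrite (hX i a ai) (hY i a ai) !mul0r.
have [ja|aj] := leqP j a; first by rewrite (hX a j ja) (hY a j ja) !mulr0.
rewrite !IH //.
  by clear -ia aj ijk; lia.
by clear -ia aj ijk; lia.
Qed.

(** Put U = 1 + P Pi, V = 1 + Pi P and D = U^-1 P. As U P = P V, also D V = P. The
    recursion of P says that P V = P P + U S V, that is U D V = U (D D + S) V.
    Cancelling U and V leaves D = S + D D, which determines D; so D = C, and
    P = D V = C + C Pi P. *)
Lemma composed_recursion S P C d : let Pi := diag_mx d in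
  strictly_upper P -> strictly_upper C -> C = S + C * C ->
  P = P * P - P * Pi * P + (1 + P * Pi) * S * (1 + Pi * P) ->
  P = C + C * Pi * P.
Proof.
move=> Pi hP hC eC eP; set U := 1 + P * Pi in eP; set V := 1 + Pi * P in eP.
have uU : U \is a GRing.unit by apply/unitr1_upper/mul_diag_upper.
have uV : V \is a GRing.unit by apply/unitr1_upper/diag_mul_upper.
have UPV : U * P = P * V by rewrite /U /V mulrDl mulrDr mul1r mulr1 mulrA.
pose D := U^-1 * P; have UD : U * D = P by rewrite /D mulVKr.
have DV : D * V = P by rewrite /D -mulrA -UPV mulKr.
suff -> : C = D by rewrite -{1}DV /V mulrDr mulr1 mulrA.
apply: (quadratic_unique (S := S)) => //.
  apply: (solve_upper (X := P * Pi) (Y := P)) => //; first exact: mul_diag_upper.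
  by rewrite -{1}UD /U mulrDl mul1r addrK.
apply: (mulIr uV); apply: (mulrI uU) => /=; rewrite mulrA UD [(_ + _) * V]mulrDl [U * (_ + _)]mulrDr.
rewrite -[D * D * V]mulrA DV.
rewrite [U * (D * P)]mulrA UD [U * (S * V)]mulrA {1}/V mulrDr mulr1 {1}eP mulrA.
by rewrite addrAC addrNK addrC.
Qed.

End StrictlyUpper.

Section Counting.
Context {l : nat} (W : {set 'I_l.+3}) (hW : W \subset inner l).
Local Notation I := 'I_l.+3.
Local Notation N := (@ord_max l.+2).
Implicit Types (i j k b c : I).

Local Notation chain_count i j := ((size (chain_splits W i j))%:R : int).
Local Notation tri_count i j := ((size (tri_splits W i j))%:R : int).

(** The entries are cut off at the chain; in particular the diagonal, where the counts are
    one, is left out, so that the matrices are strictly upper triangular. *)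
Definition chain_mx : 'M[int]_l.+3 :=
  \matrix_(i, j) (if (i < j < l.+2)%N then chain_count i j else 0).
Definition tri_mx : 'M[int]_l.+3 :=
  \matrix_(i, j) (if (i < j < l.+2)%N then tri_count i j else 0).
Definition step_mx : 'M[int]_l.+3 := \matrix_(i, j) ((j == i.+1 :> nat) && (j < l.+2)%N)%:R.
Definition spoke_row : 'rV[int]_l.+3 := \row_k (k \in W)%:R.

Lemma chain_mx_upper : strictly_upper chain_mx.
Proof. by move=> i j ji; rewrite mxE ltnNge ji. Qed.

Lemma tri_mx_upper : strictly_upper tri_mx.
Proof. by move=> i j ji; rewrite mxE ltnNge ji. Qed.

Lemma tri_countE i j : (i.+1 < j)%N ->
  tri_count i j = \sum_(b | apex_allowed W i j b) tri_count i b * tri_count b j.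
Proof.
rewrite ltnNge => nl; rewrite [tri_splits W i j]/tri_splits.
rewrite (@size_splits _ _ _ _ _ _ (tri_choices_gap (W := W))) //.
rewrite natr_sum [tri_choices W i j]/tri_choices big_map big_filter big_enum_cond.
by apply: eq_bigr => b _; rewrite natrM.
Qed.

Lemma tri_count_leaf i j : (j <= i.+1)%N -> tri_count i j = 1.
Proof.
by move=> h; rewrite /tri_splits (@splits_leaf _ _ _ _ _ _ (tri_choices_gap (W := W))).
Qed.

(** The Catalan recursion of the numbers of triangulations of a convex polygon. *)
Lemma tri_mxE : tri_mx = step_mx + tri_mx * tri_mx.
Proof.
apply/matrixP => i j; rewrite !mxE.
have [/andP[ij jl]|out] := boolP (i < j < l.+2)%N; last first.
  rewrite (_ : _ && _ = false); last by clear -out; lia.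
  rewrite add0r big1 // => k _; rewrite !mxE.
  case: ifP => // ik; case: ifP => [kj|]; rewrite ?mulr0 ?mul0r //.
  by clear -out ik kj; lia.
have [ji|nl] := boolP (j <= i.+1)%N.
  rewrite tri_count_leaf //.
  rewrite (_ : _ && _ = true); last by clear -ij jl ji; lia.
  rewrite big1 ?addr0 // => k _; rewrite !mxE.
  case: ifP => // ik; case: ifP => [kj|]; rewrite ?mulr0 ?mul0r //.
  by clear -ji ik kj; lia.
rewrite (_ : _ && _ = false); last by clear -nl; lia.
rewrite add0r tri_countE 1?ltnNge // big_mkcond; apply: eq_bigr => k _ /=.
rewrite !mxE /apex_allowed.
have -> : (j == N) = false by rewrite -val_eqE /=; clear -jl; lia.
rewrite andbT; have [ikj|out] := boolP (i < k < j)%N.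
  by rewrite !ifT //; clear -ikj jl; lia.
case: ifP => ik; case: ifP => kj; rewrite ?mulr0 ?mul0r //.
by clear -out ik kj; lia.
Qed.

Lemma chain_count_leaf i : chain_count i i = 1.
Proof. by rewrite /chain_splits (@splits_leaf _ _ _ _ _ _ (chain_choices_gap (W := W))). Qed.

Definition step_choice i j b c :=
  [&& c == b.+1 :> nat, (i <= b)%N, (c <= j)%N, (b == i) || (b \in W) & (c == j) || (c \in W)].

(** The factor 1 accounts for b = i and c = j, where the part is empty. *)
Lemma chain_mx_step i j b c : let Pi := diag_mx spoke_row in
  (1 + chain_mx * Pi : 'M[int]_l.+3) i b * step_mx b c * (1 + Pi * chain_mx : 'M[int]_l.+3) c j =
  if (i < j < l.+2)%N && step_choice i j b c then chain_count i b * chain_count c j else 0.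
Proof.
move=> Pi; rewrite -!mulmxE /Pi mul_mx_diag mul_diag_mx !mxE.
have [/andP[cb cl]|nbc] := boolP ((c == b.+1 :> nat) && (c < l.+2)%N); last first.
  rewrite mulr0 mul0r; case: ifP => // /andP[h /and5P[h1 _ h2 _ _]].
  by move: nbc; rewrite h1 /=; clear -h h2; lia.
rewrite mulr1; have bl : (b < l.+2)%N by move: cl; rewrite (eqP cb); clear; lia.
have -> : ((i == b)%:R + (if (i < b < l.+2)%N then chain_count i b else 0) * (b \in W)%:R : int) =
    if (i <= b)%N && ((b == i) || (b \in W)) then chain_count i b else 0.
  rewrite bl andbT eq_sym; have [->|ne] := eqVneq b i.
    by rewrite ltnn leqnn mul0r addr0 chain_count_leaf.
  rewrite add0r ltn_neqAle eq_sym -val_eqE in ne *; rewrite ne /=.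
  by case: ifP => _; rewrite ?mul0r //; case: (b \in W); rewrite ?mulr1 ?mulr0.
have -> : ((c == j)%:R + (c \in W)%:R * (if (c < j < l.+2)%N then chain_count c j else 0) : int) =
    if [&& (c <= j)%N, (j < l.+2)%N & (c == j) || (c \in W)] then chain_count c j else 0.
  have [<-|ne] := eqVneq c j.
    by rewrite cl ltnn leqnn mulr0 addr0 chain_count_leaf.
  rewrite add0r ltn_neqAle -val_eqE in ne *; rewrite ne /=.
  case: (c <= j)%N; case: (j < l.+2)%N => //=; rewrite ?mulr0 //.
  by case: (c \in W); rewrite ?mul1r ?mul0r.
rewrite /step_choice cb /=; have [ib|] := leqP i b; last by rewrite mul0r andbF.
have [cj|] := leqP c j; last by rewrite mulr0 !andbF.
have -> : (i < j)%N by rewrite (leq_trans _ cj) // (eqP cb) ltnS.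
by case: (j < l.+2)%N; case: (_ || _); case: (_ || _); rewrite ?mulr0 ?mul0r.
Qed.

Lemma chain_mx_inner i j b :
  chain_mx i b * (1 - (b \in W)%:R) * chain_mx b j =
  if (i < j < l.+2)%N && ((i < b < j)%N && (b \notin W)) then chain_count i b * chain_count b j
  else 0.
Proof.
rewrite !mxE; case: (b \in W); first by rewrite subrr mulr0 mul0r !andbF.
rewrite subr0 mulr1 andbT; have [h|h] := boolP ((i < j < l.+2)%N && (i < b < j)%N).
  by rewrite !ifT //; clear -h; lia.
case: ifP => ib; case: ifP => bj; rewrite ?mulr0 ?mul0r //.
by clear -h ib bj; lia.
Qed.

(** The first two terms are the triangles, with third vertex off W; the last one the faces
    at the apex. *)
Lemma chain_mxE : let Pi := diag_mx spoke_row in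
  chain_mx = chain_mx * chain_mx - chain_mx * Pi * chain_mx +
    (1 + chain_mx * Pi) * step_mx * (1 + Pi * chain_mx).
Proof.
move=> Pi; apply/matrixP => i j.
have -> : chain_mx * chain_mx - chain_mx * Pi * chain_mx = chain_mx * (1 - Pi) * chain_mx.
  by rewrite mulrBr mulrBl mulr1.
rewrite [RHS]mxE.
have -> : (chain_mx * (1 - Pi) * chain_mx : 'M[int]_l.+3) i j =
    \sum_b chain_mx i b * (1 - (b \in W)%:R) * chain_mx b j.
  rewrite mxE; apply: eq_bigr => b _; congr (_ * _).
  by rewrite mulrBr mulr1 -mulmxE /Pi mul_mx_diag !mxE mulrBr mulr1.
have -> : ((1 + chain_mx * Pi) * step_mx * (1 + Pi * chain_mx) : 'M[int]_l.+3) i j =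
    \sum_b \sum_c (1 + chain_mx * Pi : 'M[int]_l.+3) i b * step_mx b c *
      (1 + Pi * chain_mx : 'M[int]_l.+3) c j.
  rewrite mxE exchange_big /=; apply: eq_bigr => c _.
  by rewrite mxE mulr_suml.
under eq_bigr do rewrite chain_mx_inner.
under [X in _ = _ + X]eq_bigr do under eq_bigr do rewrite chain_mx_step.
rewrite mxE; have [h|h] := boolP (i < j < l.+2)%N; last first.
  by rewrite !big1 ?addr0 // => b _; rewrite big1.
have [ij _] := andP h.
rewrite /chain_splits (@size_splits _ _ _ _ _ _ (chain_choices_gap (W := W))) -?ltnNge //.
rewrite natr_sum big_filter big_enum_cond -big_split big_mkcond.
transitivity (\sum_b \sum_c if chain_choice W i j (b, c) then chain_count i b * chain_count c j else 0).
  by rewrite pair_bigA; apply: eq_bigr => -[b c] _; rewrite -natrM.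
apply: eq_bigr => b _ /=; set t := if _ then _ else _.
have -> : t = \sum_c if c == b then t else 0 by rewrite -big_mkcond big_pred1_eq.
rewrite -big_split; apply: eq_bigr => c _ /=; rewrite {}/t /step_choice.
have [->|cb] := eqVneq c b.
  by rewrite ltn_eqF //= orbF addr0.
by rewrite add0r.
Qed.

Lemma chain_count_decomposition : chain_mx = tri_mx + tri_mx * diag_mx spoke_row * chain_mx.
Proof.
exact: composed_recursion chain_mx_upper tri_mx_upper tri_mxE chain_mxE.
Qed.

(** With P the matrix of the first counts and c that of the Catalan numbers, the
    column P(i, l + 1) satisfies P = c + c Pi P, and the numbers of triangulations
    with vertices i, ..., l + 1, q satisfy the same recursion: the triangle at the
    edge iq has its third vertex in W or equal to l + 1. *)
Lemma chain_tri_count i : (i < l.+1)%N ->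
  size (chain_splits W i (@chain_end l)) = size (tri_splits W i N).
Proof.
move=> il; apply/eqP; rewrite -(eqr_nat int); apply/eqP.
have [k] := ubnP (l - i)%N; elim: k i il => // k IH i il lik.
have /matrixP/(_ i (@chain_end l)) := chain_count_decomposition.
rewrite [LHS]mxE chain_endE il ltnSn /= => ->.
rewrite tri_countE // (bigD1 (@chain_end l)) /=; last first.
  rewrite /apex_allowed chain_endE il /=; apply/andP; split; first exact: ltnSn.
  by rewrite !eqxx orbT.
rewrite mxE [(tri_mx * _ * _) _ _]mxE.
rewrite [tri_mx _ _]mxE chain_endE il ltnSn [tri_count chain_end _]tri_count_leaf ?chain_endE //.
rewrite mulr1; congr (_ + _).
rewrite [RHS]big_mkcond; apply: eq_bigr => b _; rewrite -mulmxE mul_mx_diag !mxE.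
have eW : chain_end \notin W.
  by apply/negP => /(subsetP hW); rewrite inE chain_endE; clear; lia.
rewrite /apex_allowed eqxx /= -[b == _]val_eqE /= chain_endE eqSS.
have [bW|bW] := boolP (b \in W); last first.
  by rewrite mulr0 mul0r /= -andbA andbN andbF.
have be : (b < l.+1)%N.
  by move: (subsetP hW b bW); rewrite inE; clear; lia.
rewrite mulr1 /= be ltnSn (ltnW be : (b < l.+2)%N) !andbT ltn_eqF //= andbT.
case: ltnP => ib; rewrite ?mul0r //.
rewrite IH //; clear -ib be lik; lia.
Qed.

End Counting.

(** * From the hypotheses to the signs of the orientations *)

Section SingleChain.
Context {R : realType} {l : nat} (v : 'I_l.+2 -> 'rV[R]_2) (p : 'rV[R]_2).
Implicit Types (i j k : 'I_l.+2).

Lemma add_last_max : add_last v p ord_max = p.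
Proof. by rewrite /add_last unlift_none. Qed.

Lemma add_last_lt (i : 'I_l.+3) (h : (i < l.+2)%N) : add_last v p i = v (Ordinal h).
Proof.
rewrite /add_last; case: unliftP => [j ij|iN]; last first.
  by exfalso; move: (h); rewrite iN ltnn.
by congr v; apply: val_inj; rewrite /= ij /= /bump leqNgt ltn_ord.
Qed.

Lemma convex_polygonP n (w : 'I_n -> 'rV[R]_2) : convex_polygon w ->
  exists2 s : R, s != 0 & forall i j k : 'I_n, (i < j < k)%N -> 0 < s * orient (w i) (w j) (w k).
Proof.
case=> h; [exists 1|exists (-1)] => [|i j k ijk||i j k ijk]; rewrite ?oppr_eq0 ?oner_eq0 //.
  by rewrite mul1r h.
by rewrite mulN1r oppr_gt0 h.
Qed.

(** If p were on the same side of the edge as the polygon, the points close to the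
    midpoint x of the edge on the segment towards p would lie in the triangle ijk. *)
Lemma sees_outside (s : R) i j k : 0 < s * orient (v i) (v j) (v k) -> sees v p i j ->
  orient (v i) (v j) p != 0 -> s * orient (v i) (v j) p < 0.
Proof.
move=> ijk see n0; rewrite ltNge; apply/negP => ge0.
have s0 : s != 0 by apply: contraTneq ijk => ->; rewrite mul0r ltxx.
have {ge0} gt0 : 0 < s * orient (v i) (v j) p by rewrite lt_def mulf_neq0.
pose x := v i + 2^-1 *: (v j - v i).
have hx : hull v [set i; j] x by apply/hull_pair; exists 2^-1 => //; apply/andP; split; lra.
have pos a b : 0 < s * orient (v a) (v b) x ->
    small (fun e => 0 < s * orient (v a) (v b) (x + e *: (p - x))).
  move=> h; apply: small_imp (small_gt0 (s * orient (v a) (v b) p) h) => e _.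
  by rewrite orient_lin; congr (0 < _); ring.
have hjk : 0 < s * orient (v j) (v k) x.
  rewrite /x orient_lin orientxx mulr0 addr0 orient_cyc mulrCA.
  by apply: mulr_gt0 => //; lra.
have hki : 0 < s * orient (v k) (v i) x.
  rewrite /x orient_lin orientxy mulr0 add0r -orient_cyc mulrCA.
  by apply: mulr_gt0 => //; lra.
have [e /andP[e0 e1] [h1 h2]] := small_ex (small_and (pos _ _ hjk) (pos _ _ hki)).
apply: (see x (1 - e) hx); first by apply/andP; split; lra.
have -> : (1 - (1 - e)) *: p + (1 - e) *: x = x + e *: (p - x).
  by rewrite subKr scalerBr scalerBl scale1r addrC addrAC addrA.
apply: (hull_triangle (i := i) (j := j) (k := k) (s := s)) => //; try exact: ltW.
rewrite orient_lin [orient (v i) (v j) x]orient_lin orientxx orientxy !mulr0 addr0 mulr0 add0r.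
by rewrite mulrCA mulr_ge0 // ltW.
Qed.

(** Since p sees the edges of the polygon from outside, it sees consecutive vertices in
    order, in the sense opposite to that of the polygon. The orientation
    of p, i, j is superadditive along the chain, which extends this to all pairs.
    For l = 0 the three points are merely in general position. *)
Lemma single_chain_signs : single_chain v p -> let A := add_last v p in exists s : R,
  (forall i j : 'I_l.+3, (i < j < l.+2)%N -> 0 < s * orient (A ord_max) (A i) (A j)) /\
  (forall i j k : 'I_l.+3, (i < j < k)%N -> (k < l.+2)%N -> s * orient (A i) (A j) (A k) < 0).
Proof.
move=> [/convex_polygonP[t t0 conv] gp _ sees_p] A.
have AE (i : 'I_l.+3) (h : (i < l.+2)%N) : A i = v (Ordinal h) by apply: add_last_lt.
have AN : A ord_max = p by apply: add_last_max.
have [l0|l0] := posnP l.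
  exists (orient (A ord_max) (A ord0) (A (inord 1))); split=> [i j ij|i j k]; last first.
    by clear -l0; lia.
  have -> : i = ord0 by apply: val_inj => /=; clear -ij l0; lia.
  have -> : j = inord 1.
    by apply: val_inj; rewrite /= inordK //; clear -ij l0; lia.
  rewrite -expr2 exprn_even_gt0 //=; apply: gp.
  by rewrite /= !inE -!val_eqE /= inordK // l0.
have chainA (i j k : 'I_l.+3) : (i < j < k)%N -> (k < l.+2)%N -> 0 < t * orient (A i) (A j) (A k).
  move=> ijk kl; have jl : (j < l.+2)%N by clear -ijk kl; lia.
  have il : (i < l.+2)%N by clear -ijk kl; lia.
  by rewrite !AE; apply: conv.
exists (- t); split=> [i j|i j k ijk kl]; last by rewrite mulNr oppr_lt0 chainA.
have edge (a b : 'I_l.+3) : b = a.+1 :> nat -> (b < l.+2)%N -> 0 < - t * orient (A ord_max) (A a) (A b).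
  move=> ba bl; have al : (a < l.+2)%N by clear -ba bl; lia.
  rewrite -orient_cyc mulNr oppr_gt0 AN !AE.
  have [k hk] : exists k : 'I_l.+2, 0 < t * orient (v (Ordinal al)) (v (Ordinal bl)) (v k).
    have [a0|a0] := posnP a.
      exists ord_max; apply: conv => /=; clear -a0 ba l0; lia.
    exists ord0; rewrite orient_cyc -orient_cyc orient_cyc; apply: conv => /=; clear -a0 ba; lia.
  apply: (sees_outside hk); first by have [h _] := sees_p l0; apply: h.
  rewrite -!AE -AN; apply: gp; rewrite /= !inE -!val_eqE /=; clear -ba bl; lia.
move=> /andP[+ jl]; have [k] := ubnP (j - i)%N; elim: k j jl => // k IH j jl jik ij.
have [ji|ji] := leqP j i.+1; first by apply: edge => //; clear -ij ji; lia.
have bl : (j.-1 < l.+3)%N by clear -jl; lia.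
pose b := Ordinal bl; have bj : j = b.+1 :> nat by rewrite /= prednK //; clear -ij; lia.
have ib : (i < b)%N by clear -bj ji; lia.
have h1 : 0 < - t * orient (A ord_max) (A i) (A b) by apply: IH => //; clear -bj jl jik ib; lia.
have h2 := edge b j bj jl.
have h3 : 0 < t * orient (A i) (A b) (A j) by apply: chainA => //; rewrite ib /= bj.
move: h1 h2 h3; rewrite -(orient_split (A i) (A b) (A j) (A ord_max)).
rewrite -![orient (A ord_max) _ _]orient_cyc [orient (A j) (A i) _]orientNl.
by move: (orient _ _ _) (orient _ _ _) (orient _ _ _) => x y z; lra.
Qed.

End SingleChain.

Theorem theorem6 (R : realType) (l : nat) (v : 'I_l.+2 -> 'rV[R]_2)
    (p q : 'rV[R]_2) (W : {set 'I_l.+3})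
    (hA : single_chain v p)
    (hW : W \subset inner l)
    (hB : convex_polygon (add_last v q))
    (hq : orient (v ord0) (v ord_max) p * orient (v ord0) (v ord_max) q < 0) :
  #|PPT v p W| = #|triangulations_within v q W|.
Proof.
have [_ gp _ _] := hA; have [s [apexA chainA]] := single_chain_signs hA.
have [t _ convA] := convex_polygonP hB.
have -> : #|PPT v p W| = size (chain_splits W ord0 (@chain_end l)).
  have inP T : T \in PPT v p W <-> in_PPT (add_last v p) W T.
    by rewrite inE; split => [/asboolP|h]; [|apply/asboolP].
  rewrite -(card_in_imset (f := @chain_code l)); last first.
    by move=> T T' /inP h /inP h'; apply: (chain_code_inj gp apexA chainA h h').
  rewrite -(card_uniqP (chain_splits_uniq W ord0 (@chain_end l))).
  apply: eq_card => G; apply/imsetP/idP => [[T /inP h ->]|/(code_PPT gp apexA chainA)[T h <-]].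
    exact: (PPT_code gp apexA chainA h).
  by exists T => //; apply/inP.
have -> : #|triangulations_within v q W| = size (tri_splits W ord0 ord_max).
  rewrite -(card_uniqP (tri_splits_uniq W ord0 ord_max)).
  apply: eq_card => T; rewrite inE; apply/asboolP/idP => [[h h']|].
    exact: (triangulation_code convA).
  exact: (code_triangulation convA).
exact: chain_tri_count.
Qed.
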